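(* Let $p$ be a prime, $G=\mathbb{Z}/p\mathbb{Z}$, and $\Bbbk$ a field extension of $\mathbb{C}$. Let $\Delta$ be a $(d-1)$-dimensional Buchsbaum (over $\Bbbk$) simplicial complex admitting a free action by $G$, let $0\le m\le p-1$ be fixed, and let $\Theta=(\theta_1,\dots,\theta_d)$ be a $G$-homogeneous linear system of parameters for $\Bbbk[\Delta]$ such that $\theta_i\in\Bbbk[\Delta]_1^m$ for all $i$. Then the $(\mathbb{Z}\times G)$-graded Hilbert series of $\Bbbk(\Delta;\Theta)=\Bbbk[\Delta]/\Theta\Bbbk[\Delta]$ is $$\mathrm{Hilb}(\Bbbk(\Delta;\Theta),\lambda,t)=\sum_{i=0}^d\left[(-1)^i\binom{d}{i}t^{mi}+\left(\frac1p\sum_{k=0}^{p-1}t^k\right)\left(h_i(\Delta)+(-1)^{i+1}\binom{d}{i}\right)\right]\lambda^i+\sum_{i=0}^d\binom{d}{i}\lambda^i\sum_{j=0}^{i-1}(-1)^{i-j-1}\left(\sum_{k=0}^{p-1}t^k\beta_{j-1}(\Delta)^{mi-k}\right).$$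
   Context: $\Delta$ is a simplicial complex on vertex set $[n]$. Write $\tilde H^i$ for reduced simplicial cohomology with coefficients in $\Bbbk$ and $\beta_i=\dim_\Bbbk\tilde H^i$. $\mathrm{lk}_\Delta\sigma=\{\tau\in\Delta:\sigma\cup\tau\in\Delta,\sigma\cap\tau=\emptyset\}$. $\Delta$ is Buchsbaum (over $\Bbbk$) if it is pure and $\beta_i(\mathrm{lk}_\Delta\sigma)=0$ for all nonempty faces $\sigma$ and all $i<\dim\mathrm{lk}_\Delta\sigma$. The $h$-numbers are $h_i(\Delta)=\sum_{j=0}^i(-1)^{i-j}\binom{d-j}{i-j}f_{j-1}(\Delta)$, where $f_{j}$ is the number of $j$-dimensional faces. A group acting by simplicial automorphisms acts freely if $g\cdot\sigma\ne\sigma$ for all nonempty faces $\sigma$ and all $g\neq 1$. $A=\Bbbk[x_1,\dots,x_n]$ and $\Bbbk[\Delta]=A/(\prod_{i\in\sigma}x_i:\sigma\notin\Delta)$ is the Stanley–Reisner ring. Fix a generator $g$ of $G$ and a primitive $p$-th root of unity $\zeta\in\Bbbk$. $G$ acts on $A$ and $\Bbbk[\Delta]$ by $g\cdot x_v=x_{g\cdot v}$. For a $\mathbb{Z}$-graded module $M$ with compatible degree-preserving $G$-action, $M_i^j=\{m\in M_i:g\cdot m=\zeta^jm\}$ ($j$ read mod $p$); this is a $(\mathbb{Z}\times G)$-grading, and $\mathrm{Hilb}(M,\lambda,t)=\sum_{i}\sum_{j=0}^{p-1}(\dim_\Bbbk M_i^j)\lambda^it^j$ with $t^p=1$. The quotient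 by $G$-homogeneous elements inherits this grading. A linear system of parameters (l.s.o.p.) for $\Bbbk[\Delta]$ is a sequence $\theta_1,\dots,\theta_d$ of linear forms such that $\Bbbk[\Delta]/(\theta_1,\dots,\theta_d)\Bbbk[\Delta]$ is finite-dimensional over $\Bbbk$. $\beta_i(\Delta)^j=\dim_\Bbbk\tilde H^i(\Delta)^j$, where $\tilde H^i(\Delta)^j=\{c\in\tilde H^i(\Delta):g\cdot c=\zeta^jc\}$, $g$ acting by pullback of cochains; the superscript is read mod $p$. *)

(* Defs.v *)
From HB Require Import structures.
From mathcomp Require Import boolp classical_sets reals complex.
From mathcomp Require Import all_boot all_order all_fingroup all_algebra.
From mathcomp Require Import generic_quotient ring_quotient qpoly mpoly.

Set Implicit Arguments.
Unset Strict Implicit.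
Unset Printing Implicit Defensive.

Import GRing.Theory Num.Theory.
Local Open Scope ring_scope.
Local Open Scope quotient_scope.

Section LinearAlgebra.
Variables (K : fieldType) (V : lmodType K).

Definition has_dim (S : set V) (r : nat) : Prop :=
  exists b : 'I_r -> V,
    [/\ forall i, S (b i),
        forall c : 'I_r -> K, \sum_i c i *: b i = 0 -> forall i, c i = 0
      & forall v, S v -> exists c : 'I_r -> K, v = \sum_i c i *: b i].

(* Only meaningful for a subspace S of finite dimension (it is 0 on
   infinite-dimensional subspaces). *)
Definition dim (S : set V) : nat := xget 0%N [set r | has_dim S r]%classic.

Definition finite_dimensional : Prop := exists r, has_dim [set: V]%classic r.

Definition eigenpart (f : V -> V) (a : K) (S : set V) : set V :=
  [set v | S v /\ f v = a *: v]%classic.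

Definition lspan (S : set V) : {pred V} := fun v =>
  `[< exists r (c : 'I_r -> K) (s : 'I_r -> V),
        (forall i, S (s i)) /\ v = \sum_i c i *: s i >].

Lemma lspan0 S : 0 \in lspan S.
Proof.
apply/asboolP; exists 0%N, (fun=> 0), (fun=> 0).
by split=> [[]|] //; rewrite big_ord0.
Qed.

Lemma lspanZ S a v : v \in lspan S -> a *: v \in lspan S.
Proof.
move=> /asboolP[r [c [s [Ss ->]]]]; apply/asboolP.
exists r, (fun i => a * c i), s; split=> //.
by rewrite scaler_sumr; apply: eq_bigr => i _; rewrite scalerA.
Qed.

Lemma lspanD S v w : v \in lspan S -> w \in lspan S -> v + w \in lspan S.
Proof.
move=> /asboolP[r [c [s [Ss ->]]]] /asboolP[r' [c' [s' [Ss' ->]]]].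
apply/asboolP; exists (r + r')%N.
exists (fun i => match split i with inl j => c j | inr j => c' j end).
exists (fun i => match split i with inl j => s j | inr j => s' j end).
split=> [i|]; first by case: (split i).
rewrite big_split_ord /=; congr (_ + _); apply: eq_bigr => i _.
  by rewrite (unsplitK (inl i)).
by rewrite (unsplitK (inr i)).
Qed.

Lemma mem_lspan (S : set V) v : S v -> v \in lspan S.
Proof.
move=> Sv; apply/asboolP; exists 1%N, (fun=> 1), (fun=> v).
by split=> //; rewrite big_ord1 scale1r.
Qed.

Lemma lspan_zmod_closed S : zmod_closed (lspan S).
Proof.
split=> [|v w Sv Sw]; first exact: lspan0.
by apply: lspanD => //; rewrite -scaleN1r; apply: lspanZ.
Qed.

HB.instance Definition _ S :=
  GRing.isZmodClosed.Build V (lspan S) (lspan_zmod_closed S).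

(* The quotient module V / <S>. *)
Definition lquot (S : set V) : Type := Quotient.quot (lspan S).

HB.instance Definition _ S := GRing.Zmodule.on (lquot S).
HB.instance Definition _ S :=
  EqQuotient.copy (lquot S) (Quotient.quot (lspan S)).

Definition lproj (S : set V) (v : V) : lquot S := \pi_(lquot S) v.

Definition lquot_scale S (a : K) (x : lquot S) : lquot S :=
  lproj S (a *: repr x).

Lemma lproj_eq S v w : (lproj S v == lproj S w) = (v - w \in lspan S).
Proof. by rewrite /lproj piE. Qed.

Lemma lprojD S : {morph lproj S : v w / v + w}.
Proof. by move=> v w; rewrite /lproj; exact: raddfD. Qed.

Lemma lreprK S x : lproj S (repr x) = x.
Proof. exact: reprK. Qed.

Lemma lquot_scale_pi S a v : lquot_scale a (lproj S v) = lproj S (a *: v).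
Proof.
apply/eqP; rewrite lproj_eq -scalerBr; apply: lspanZ.
by rewrite -lproj_eq lreprK.
Qed.

Lemma lquot_scaleA S a b (x : lquot S) :
  lquot_scale a (lquot_scale b x) = lquot_scale (a * b) x.
Proof. by rewrite -[x]lreprK !lquot_scale_pi scalerA. Qed.

Lemma lquot_scale1 S : left_id 1 (@lquot_scale S).
Proof. by move=> x; rewrite -[x]lreprK lquot_scale_pi scale1r. Qed.

Lemma lquot_scaleDr S : right_distributive (@lquot_scale S) +%R.
Proof.
move=> a x y; rewrite -[x]lreprK -[y]lreprK -lprojD !lquot_scale_pi.
by rewrite scalerDr lprojD.
Qed.

Lemma lquot_scaleDl S (x : lquot S) : {morph (@lquot_scale S)^~ x : a b / a + b}.
Proof. by move=> a b; rewrite -[x]lreprK !lquot_scale_pi scalerDl lprojD. Qed.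

HB.instance Definition _ S := GRing.Zmodule_isLmodule.Build K (lquot S)
  (@lquot_scaleA S) (@lquot_scale1 S) (@lquot_scaleDr S) (@lquot_scaleDl S).

(* The map induced on V / <S> by a linear map f preserving <S>. *)
Definition lquot_map (S : set V) (f : V -> V) (x : lquot S) : lquot S :=
  lproj S (f (repr x)).

End LinearAlgebra.

Section Complexes.
Variable n : nat.
Implicit Types (D : {set {set 'I_n}}) (s t : {set 'I_n}).

(* Faces are subsets of the vertex set [n]; the singletons are not required to
   be faces. *)
Record scomplex := SComplex {
  faces :> {set {set 'I_n}};
  scomplex_face0 : finset.set0 \in faces;
  scomplex_sub : forall s t, s \in faces -> t \subset s -> t \in faces
}.

Definition face_dim s : int := #|s|%:Z - 1.

Definition complex_dim D : int := (\max_(s in D) #|s|)%:Z - 1.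

Definition link D s : {set {set 'I_n}} :=
  [set t in D | (s :|: t \in D) && [disjoint s & t]].

Definition facet D s : bool := maxset [pred t | t \in D] s.

Definition pure D : Prop :=
  forall s, facet D s -> face_dim s = complex_dim D.

Definition f_number D (i : int) : nat := #|[set s in D | face_dim s == i]|.

Definition h_number D (d i : nat) : int :=
  \sum_(0 <= j < i.+1)
    (-1) ^+ (i - j) * ('C(d - j, i - j) * f_number D (j%:Z - 1))%:Z.

End Complexes.

Section Cohomology.
Variables (K : fieldType) (n : nat) (D : {set {set 'I_n}}).
Implicit Types (s t : {set 'I_n}) (i j : int) (g : 'I_n -> 'I_n).

(* Each face is oriented by the natural order of its vertices, so a cochain is
   a function on faces; C^i consists of those supported on i-dimensional
   faces, with C^(-1) spanned by the indicator of the empty face. *)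
Definition cochains : Type := {ffun {set 'I_n} -> K^o}.
HB.instance Definition _ := GRing.Lmodule.on cochains.

Definition cochain i : set cochains :=
  [set c : cochains |
    forall s, c s != 0 -> s \in D /\ face_dim s = i]%classic.

Definition coboundary (c : cochains) : cochains :=
  [ffun t => if t \in D then
     \sum_(v in t) (-1) ^+ #|[set u in t | (u < v)%N]| * c (t :\ v)
   else 0].

Definition cocycle i : set cochains :=
  [set c | cochain i c /\ coboundary c = 0]%classic.

Definition coboundaries i : set cochains :=
  [set coboundary c | c in cochain (i - 1)]%classic.

Definition red_cohomology i : set (lquot (coboundaries i)) :=
  [set lproj (coboundaries i) c | c in cocycle i]%classic.

(* (g^* c)(s) = c(g s): g maps the ordered simplex s = {v_0 < ... < v_k} to
   (g v_0, ..., g v_k), whose orientation differs from the one of the ordered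
   set g s by the parity of the number of inversions of g on s. *)
Definition inversions g s : nat :=
  #|[set uv : 'I_n * 'I_n |
      [&& uv.1 \in s, uv.2 \in s, (uv.1 < uv.2)%N & (g uv.2 < g uv.1)%N]]|.

Definition pullback g (c : cochains) : cochains :=
  [ffun s => (-1) ^+ inversions g s * c [set g v | v in s]].

Definition betti i : nat := dim (@red_cohomology i).

Definition betti_eigen g (zeta : K) i j : nat :=
  dim (eigenpart (lquot_map (pullback g)) (zeta ^ j) (@red_cohomology i)).

End Cohomology.

Definition Buchsbaum (K : fieldType) n (D : {set {set 'I_n}}) : Prop :=
  pure D /\
  forall s, s \in D -> s != finset.set0 ->
  forall i : int, i < complex_dim (link D s) -> betti K (link D s) i = 0%N.

Section StanleyReisner.
Variables (K : fieldType) (n : nat) (D : scomplex n).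
Implicit Types (s : {set 'I_n}) (f : {mpoly K[n]}) (g : 'I_n -> 'I_n).

Definition SR_multiples : set {mpoly K[n]} :=
  [set h | exists f s, s \notin faces D /\ h = f * \prod_(v in s) 'X_v]%classic.

Definition SR_ideal : {pred {mpoly K[n]}} := lspan SR_multiples.

Lemma SR_ideal_closed : idealr_closed SR_ideal.
Proof.
split; first exact: lspan0.
  apply/negP => /asboolP[r [c [h [Sh]]]].
  move/(congr1 (mcoeff 0%MM)); rewrite mcoeff1 eqxx raddf_sum /= => /eqP.
  rewrite big1 ?oner_eq0 // => i _; rewrite mcoeffZ.
  have [f [s [sD ->]]] := Sh i.
  have [v vs] : exists v, v \in s.
    apply/set0Pn; apply: contra sD => /eqP->; exact: scomplex_face0.
  rewrite rmorphM rmorph_prod (bigD1 v) //= mcoeffX mnm1_eq0 /=.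
  by rewrite mul0r !mulr0.
move=> a f h /asboolP[r [c [e [Se ->]]]] Sh; apply: lspanD => //.
rewrite mulr_sumr; apply/asboolP; exists r, c, (fun i => a * e i); split=> [i|].
  have [f' [s [sD ->]]] := Se i; exists (a * f'), s; split=> //.
  by rewrite mulrA.
by apply: eq_bigr => i _; rewrite scalerAr.
Qed.

HB.instance Definition _ := isIdealr.Build {mpoly K[n]} SR_ideal SR_ideal_closed.

Definition SR_ring : Type := {ideal_quot SR_ideal}.
HB.instance Definition _ := GRing.ComNzRing.on SR_ring.

Definition SR_proj f : SR_ring := \pi_({ideal_quot SR_ideal}) f.

Lemma SR_proj_is_zmod_morphism : zmod_morphism SR_proj.
Proof. by move=> f h; rewrite /SR_proj raddfB. Qed.

Lemma SR_proj_is_monoid_morphism : monoid_morphism SR_proj.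
Proof. by split=> [|f h]; rewrite /SR_proj ?rmorph1 ?rmorphM. Qed.

HB.instance Definition _ :=
  GRing.isZmodMorphism.Build {mpoly K[n]} SR_ring SR_proj
    SR_proj_is_zmod_morphism.
HB.instance Definition _ :=
  GRing.isMonoidMorphism.Build {mpoly K[n]} SR_ring SR_proj
    SR_proj_is_monoid_morphism.

Definition SR_scale (a : K) (x : SR_ring) : SR_ring := SR_proj a%:MP * x.

Lemma SR_scaleA a b x : SR_scale a (SR_scale b x) = SR_scale (a * b) x.
Proof. by rewrite /SR_scale mulrA -rmorphM /= -mpolyCM. Qed.

Lemma SR_scale1 : left_id 1 SR_scale.
Proof. by move=> x; rewrite /SR_scale mpolyC1 rmorph1 mul1r. Qed.

Lemma SR_scaleDr : right_distributive SR_scale +%R.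
Proof. by move=> a x y; rewrite /SR_scale mulrDr. Qed.

Lemma SR_scaleDl x : {morph SR_scale^~ x : a b / a + b}.
Proof. by move=> a b; rewrite /SR_scale mpolyCD rmorphD mulrDl. Qed.

HB.instance Definition _ := GRing.Zmodule_isLmodule.Build K SR_ring
  SR_scaleA SR_scale1 SR_scaleDr SR_scaleDl.

Lemma SR_scaleAl (a : K) (x y : SR_ring) : a *: (x * y) = a *: x * y.
Proof. exact: mulrA. Qed.

HB.instance Definition _ :=
  GRing.Lmodule_isLalgebra.Build K SR_ring SR_scaleAl.

Definition SR_piece (i : nat) : set SR_ring :=
  [set SR_proj f | f in [set f : {mpoly K[n]} | f \is i.-homog]]%classic.

Definition poly_act g f : {mpoly K[n]} := f \mPo [tuple 'X_(g v) | v < n].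

(* The action induced by poly_act, for g preserving D. *)
Definition SR_act g (x : SR_ring) : SR_ring := SR_proj (poly_act g (repr x)).

Section Quotient.
Variables (d : nat) (theta : 'I_d -> SR_ring).

Definition theta_multiples : set SR_ring :=
  [set y | exists (x : SR_ring) (k : 'I_d), y = x * theta k]%classic.

(* k(D; Theta): the linear span of theta_multiples is the ideal (Theta). *)
Definition SR_quot : Type := lquot theta_multiples.
HB.instance Definition _ := GRing.Lmodule.on SR_quot.

Definition lsop : Prop :=
  (forall k, SR_piece 1 (theta k)) /\ finite_dimensional SR_quot.

Definition SR_quot_piece (i : nat) : set SR_quot :=
  [set lproj theta_multiples x | x in SR_piece i]%classic.

(* The action induced by SR_act, for G-homogeneous theta. *)
Definition SR_quot_act g : SR_quot -> SR_quot := lquot_map (SR_act g).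

End Quotient.
End StanleyReisner.

(* Q[t]/(t^p - 1) for 0 < p (for p = 0 the library quotients by 'X). *)
Definition tring (p : nat) : Type := {poly %/ ('X^p - 1 : {poly rat})}.
HB.instance Definition _ p := GRing.ComUnitAlgebra.on (tring p).
Definition tvar (p : nat) : tring p := 'qX.

(* The coefficient of lambda^i in Hilb(M, lambda, t), where M_i is given by
   piece i (and is 0 for negative i) and the generator of G acts by act. *)
Definition Hilb_coef (K : fieldType) (V : lmodType K) (p : nat) (zeta : K)
    (act : V -> V) (piece : nat -> set V) (i : nat) : tring p :=
  \sum_(j < p) (dim (eigenpart act (zeta ^ (j : int)) (piece i)))%:R
                * tvar p ^+ j.

Arguments red_cohomology K {n} D i.
Arguments betti K {n} D i.
Arguments betti_eigen {K n} D g zeta i j.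
Arguments SR_piece {K n D} i.
Arguments SR_act {K n D} g x.
Arguments SR_quot_piece {K n D d} theta i.
Arguments SR_quot_act {K n D d} theta g.

Section Actions.
Variables (aT : finGroupType) (n : nat) (to : {action aT &-> 'I_n}).
Variable D : {set {set 'I_n}}.

Definition simplicial_action : Prop := [acts [set: aT]%g, on D | to^*].

Definition free_action : Prop :=
  forall (a : aT) (s : {set 'I_n}), a != 1%g -> s \in D -> s != finset.set0 ->
    (to^*)%act s a != s.

End Actions.

(* Main.v *)
Require Import Defs.
From HB Require Import structures.
From mathcomp Require Import boolp classical_sets reals complex.
From mathcomp Require Import all_boot all_order all_fingroup all_algebra.
From mathcomp Require Import generic_quotient ring_quotient qpoly mpoly.
From mathcomp Require Import cyclic zify ring.

(** Let P be the complex whose j-th term is the direct sum, over the faces s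
    with j vertices, of the face rings of the stars of s, so that P^0 = k[D].
    Its part of polynomial degree 0 is the augmented cochain complex of D, and
    it is exact in positive polynomial degree.  Multiplication by a variable is
    null-homotopic on P, and theta_1, ..., theta_d is a regular sequence on P^j
    for j > 0.  So, on P / (theta_1, ..., theta_r), multiplication by
    theta_(r+1) is zero in cohomology and injective on the terms with j > 0; the
    resulting short exact sequences give, by induction on r,
      dim H^j(P / (theta_1, ..., theta_r))_a = C(r, a) dim H^(j+a)(P)_0,
    and the kernel of theta_(r+1) on k[D] / (theta_1, ..., theta_r) is H^0.
    This determines the Hilbert function of k[D] / (theta_1, ..., theta_d) by
    recursion, and all of it is compatible with the projections onto the
    eigenspaces of g.  As g acts freely on nonempty faces, each homogeneous
    component of k[D] of positive degree is a sum of copies of the regular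
    representation.

    The regularity on stars is Reisner's theorem.  The links of nonempty faces
    have no cohomology below the top degree, so the argument above, by induction
    on the dimension, shows that the parameters are regular on their face rings.
    The face ring of the star of s is a polynomial ring over that of the link;
    comparing Hilbert functions yields the regularity on stars, because for
    linear forms regularity can be read off the Hilbert function of the
    quotient, which only depends on the span of the forms. *)

Set Implicit Arguments.
Unset Strict Implicit.
Unset Printing Implicit Defensive.

Import GRing.Theory Num.Theory.
Local Open Scope ring_scope.

(** * Dimensions of subquotients *)

(** Multiplication by a form of weight m shifts weights, so the eigenspaces that fit together along
    it vary with the degree. Reaching weight k in degree i means starting in degree 0 from weight k
    - mi; families are acted on by pullback, which inverts g, so the cohomology met is that of
    weight mi - k. In positive degrees all eigenspaces of k[D] have the same dimension. Degree 0 is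
    the exception: the constants are one trivial representation, and correcting for them produces,
    through the factor (1 - lambda)^d, the terms in C(d, i) outside the Betti sum.

    The induction on r changes the quotient at every step. No quotient type is formed in it: each
    object is a pair of subspaces of one fixed module, and induced or connecting maps are linear
    relations. *)

Lemma choice_ex2 (A B : Type) (P Q : A -> B -> Prop) :
  (forall a, exists2 b, P a b & Q a b) ->
  exists2 f : A -> B, (forall a, P a (f a)) & forall a, Q a (f a).
Proof.
move=> h; have h' a : exists b, P a b /\ Q a b by have [b Pb Qb] := h a; exists b.
by have [f hf] := choice h'; exists f => a; have [] := hf a.
Qed.

Section RelativeDimension.
Variable K : fieldType.

Definition subsp (V : lmodType K) (W : V -> Prop) : Prop :=
  W 0 /\ forall (a : K) u v, W u -> W v -> W (a *: u + v).

(* dim (W / U) = r for a subspace U of W; no quotient type is formed. *)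
Definition has_rd (V : lmodType K) (W U : V -> Prop) (r : nat) : Prop :=
  exists b : 'I_r -> V,
    [/\ forall i, W (b i),
        forall c : 'I_r -> K, U (\sum_i c i *: b i) -> forall i, c i = 0
      & forall v, W v -> exists c : 'I_r -> K, U (v - \sum_i c i *: b i)].

Section Subspaces.
Variable V : lmodType K.
Implicit Types (W U X : V -> Prop).

Lemma subsp0 W : subsp W -> W 0. Proof. by case. Qed.

Lemma subspP W a u v : subsp W -> W u -> W v -> W (a *: u + v).
Proof. by case=> _; apply. Qed.

Lemma subspZ W a u : subsp W -> W u -> W (a *: u).
Proof. by move=> sW Wu; rewrite -[_ *: _]addr0; apply: subspP => //; case: sW. Qed.

Lemma subspD W u v : subsp W -> W u -> W v -> W (u + v).
Proof. by move=> sW Wu Wv; rewrite -[u]scale1r; apply: subspP. Qed.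

Lemma subspN W u : subsp W -> W u -> W (- u).
Proof. by move=> sW Wu; rewrite -scaleN1r; apply: subspZ. Qed.

Lemma subspB W u v : subsp W -> W u -> W v -> W (u - v).
Proof. by move=> sW Wu Wv; apply: subspD => //; apply: subspN. Qed.

Lemma subsp_sum W (I : Type) (r : seq I) (P : pred I) (F : I -> V) :
  subsp W -> (forall i, P i -> W (F i)) -> W (\sum_(i <- r | P i) F i).
Proof.
move=> sW WF; elim/big_ind: _ => //; first exact: subsp0.
by move=> u v; apply: subspD.
Qed.

Definition indep U m (v : 'I_m -> V) : Prop :=
  forall c : 'I_m -> K, U (\sum_i c i *: v i) -> forall i, c i = 0.

(** Expressing the [v i] modulo U in the given basis yields a matrix; a row vector killing it gives
    a combination of the [v i] in U, so the rows are free. *)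
Lemma steinitz W U r m (v : 'I_m -> V) :
  subsp U -> has_rd W U r -> (forall i, W (v i)) -> indep U v -> (m <= r)%N.
Proof.
move=> sU [b [Wb _ sb]] Wv iv.
have [C hC] := choice (fun i => sb _ (Wv i)).
pose M : 'M[K]_(m, r) := \matrix_(i, j) C i j.
suff: row_free M by rewrite -row_leq_rank => /leq_trans; apply; exact: rank_leq_col.
rewrite -kermx_eq0; apply/rowV0P => u /sub_kermxP uM.
apply/rowP => i; rewrite mxE; apply: (iv (fun i => u 0 i)).
rewrite (_ : \sum_i _ = \sum_i u 0 i *: (v i - \sum_j C i j *: b j)).
  by apply: subsp_sum => // k _; apply: subspZ.
under [RHS]eq_bigr do rewrite scalerBr.
rewrite sumrB [X in _ - X](_ : _ = 0) ?subr0 //.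
under eq_bigr do rewrite scaler_sumr.
rewrite exchange_big big1 //= => j _.
under eq_bigr do rewrite scalerA.
rewrite -scaler_suml (_ : \sum_i _ = (u *m M) 0 j); last first.
  by rewrite !mxE; apply: eq_bigr => k _; rewrite mxE.
by rewrite uM mxE scale0r.
Qed.

Lemma has_rd_uniq W U r r' :
  subsp U -> has_rd W U r -> has_rd W U r' -> r = r'.
Proof.
move=> sU h h'; apply/eqP; rewrite eqn_leq; apply/andP; split.
  by case: h => b [Wb ib _]; exact: (steinitz sU h' Wb ib).
by case: h' => b [Wb ib _]; exact: (steinitz sU h Wb ib).
Qed.

Lemma has_rd0 W U : (forall v, W v -> U v) -> has_rd W U 0.
Proof.
move=> WU; exists (fun=> 0); split=> [[]|c _ []|v Wv] //.
by exists (fun=> 0); rewrite big_ord0 subr0; apply: WU.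
Qed.

Lemma has_rd0P W U v : has_rd W U 0 -> W v -> U v.
Proof. by move=> [b [_ _ sb]] /sb[c]; rewrite big_ord0 subr0. Qed.

Definition cat_fam (T : Type) m k (f : 'I_m -> T) (g : 'I_k -> T) (i : 'I_(m + k)) :=
  match split i with inl j => f j | inr j => g j end.

Lemma cat_faml (T : Type) m k (f : 'I_m -> T) (g : 'I_k -> T) i :
  cat_fam f g (lshift k i) = f i.
Proof. by rewrite /cat_fam (unsplitK (inl i)). Qed.

Lemma cat_famr (T : Type) m k (f : 'I_m -> T) (g : 'I_k -> T) i :
  cat_fam f g (rshift m i) = g i.
Proof. by rewrite /cat_fam (unsplitK (inr i)). Qed.

Lemma sum_cat_fam m k (c : 'I_(m + k) -> K) (f : 'I_m -> V) (g : 'I_k -> V) :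
  \sum_i c i *: cat_fam f g i =
  \sum_i c (lshift k i) *: f i + \sum_i c (rshift m i) *: g i.
Proof.
by rewrite big_split_ord /=; congr (_ + _); apply: eq_bigr => i _;
  rewrite ?cat_faml ?cat_famr.
Qed.

Lemma has_rd_add W X U r1 r2 : subsp X -> (forall v, U v -> X v) ->
  (forall v, X v -> W v) -> has_rd X U r1 -> has_rd W X r2 ->
  has_rd W U (r1 + r2).
Proof.
move=> sX UX XW [b1 [Wb1 ib1 sb1]] [b2 [Wb2 ib2 sb2]].
exists (cat_fam b1 b2); split.
- by move=> i; rewrite /cat_fam; case: (split i) => j //; apply: XW.
- move=> c; rewrite sum_cat_fam => Uc.
  have c2 : forall i, c (rshift r1 i) = 0.
    apply: ib2; rewrite -(addKr (\sum_i c (lshift r2 i) *: b1 i) (\sum_i _)).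
    apply: subspD => //; last exact: UX.
    by apply: subspN => //; apply: subsp_sum => // i _; apply: subspZ.
  have c1 : forall i, c (lshift r2 i) = 0.
    apply: ib1; move: Uc; rewrite [X in _ + X]big1 ?addr0 // => i _.
    by rewrite c2 scale0r.
  by move=> i; rewrite -(splitK i); case: (split i) => j /=.
- move=> v /sb2[c2 /sb1[c1 h]]; exists (cat_fam c1 c2).
  rewrite sum_cat_fam.
  under eq_bigr do rewrite cat_faml.
  under [X in _ - (_ + X)]eq_bigr do rewrite cat_famr.
  by rewrite opprD addrA addrAC.
Qed.

(** A family of maximal length among those independent modulo U spans W modulo U; the bound N makes
    a maximal length exist. *)
Lemma has_rd_bound W U N : subsp W -> subsp U -> (forall v, U v -> W v) ->
  (forall m (v : 'I_m -> V), (forall i, W (v i)) -> indep U v -> (m <= N)%N) ->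
  exists2 r, (r <= N)%N & has_rd W U r.
Proof.
move=> sW sU UW bd.
pose P m := `[< exists v : 'I_m -> V, (forall i, W (v i)) /\ indep U v >].
have exP : exists m, P m.
  by exists 0%N; apply/asboolP; exists (fun=> 0); split=> [[]|c _ []].
have ubP m : P m -> (m <= N)%N by move=> /asboolP[v [Wv iv]]; apply: bd Wv iv.
have [m /asboolP[v [Wv iv]] mmax] := ex_maxnP exP ubP.
exists m; first exact: bd Wv iv.
exists v; split=> // w Ww; apply: contrapT => nw.
suff: P (m + 1)%N by move=> /mmax; rewrite addn1 ltnn.
apply/asboolP; exists (cat_fam v (fun=> w)); split=> [i|c].
  by rewrite /cat_fam; case: (split i).
rewrite sum_cat_fam big_ord1.
case: (eqVneq (c (rshift m ord0)) 0) => [c0|c0] Uc; last first.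
  case: nw; exists (fun i => - (c (rshift m ord0))^-1 * c (lshift 1 i)).
  rewrite (_ : w - _ = (c (rshift m ord0))^-1 *:
    (\sum_i c (lshift 1 i) *: v i + c (rshift m ord0) *: w)).
    exact: subspZ.
  rewrite scalerDr scalerA mulVf // scale1r addrC; congr (_ + _).
  rewrite -sumrN scaler_sumr; apply: eq_bigr => i _.
  by rewrite scalerA mulNr scaleNr opprK.
move: Uc; rewrite c0 scale0r addr0 => /iv c1 i.
by rewrite -(splitK i); case: (split i) => j //=; rewrite ord1.
Qed.

Lemma has_rd_split W X U r : subsp W -> subsp X -> subsp U ->
  (forall v, U v -> X v) -> (forall v, X v -> W v) -> has_rd W U r ->
  exists r1 r2, [/\ has_rd X U r1, has_rd W X r2 & r = (r1 + r2)%N].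
Proof.
move=> sW sX sU UX XW h.
have [r1 _ h1] : exists2 r1, (r1 <= r)%N & has_rd X U r1.
  apply: has_rd_bound => // m v Xv; apply: steinitz h _ => //.
  by move=> i; apply: XW.
have [r2 _ h2] : exists2 r2, (r2 <= r)%N & has_rd W X r2.
  apply: has_rd_bound => // m v Wv iv.
  by apply: (steinitz sU h Wv) => c /UX/iv.
exists r1, r2; split=> //.
exact: has_rd_uniq sU h (has_rd_add sX UX XW h1 h2).
Qed.

Lemma has_rd_sub W X U r : subsp W -> subsp X -> subsp U ->
  (forall v, U v -> X v) -> (forall v, X v -> W v) -> has_rd W U r ->
  exists r', has_rd X U r'.
Proof.
move=> sW sX sU UX XW h.
by have [r1 [r2 [? _ _]]] := has_rd_split sW sX sU UX XW h; exists r1.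
Qed.

Lemma has_rd_quo W X U r : subsp W -> subsp X -> subsp U ->
  (forall v, U v -> X v) -> (forall v, X v -> W v) -> has_rd W U r ->
  exists r', has_rd W X r'.
Proof.
move=> sW sX sU UX XW h.
by have [r1 [r2 [_ ? _]]] := has_rd_split sW sX sU UX XW h; exists r2.
Qed.

Lemma eq_has_rd W W' U U' r : (forall v, W v <-> W' v) ->
  (forall v, U v <-> U' v) -> has_rd W U r -> has_rd W' U' r.
Proof.
move=> eW eU; have -> : W' = W.
  by apply/funext => v; apply/propext; split=> /eW.
by have -> : U' = U by apply/funext => v; apply/propext; split=> /eU.
Qed.

End Subspaces.

(** * Transport of relative dimensions along linear relations *)

Section Correspondence.
Variables (V V' : lmodType K) (T : V -> V' -> Prop).
Hypothesis T0 : T 0 0.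
Hypothesis TP : forall a u v u' v', T u u' -> T v v' -> T (a *: u + v) (a *: u' + v').

Lemma corr_sum m (c : 'I_m -> K) b b' : (forall i, T (b i) (b' i)) ->
  T (\sum_i c i *: b i) (\sum_i c i *: b' i).
Proof.
move=> h; elim/big_rec2: _ => // i u u' _; exact: TP.
Qed.

Lemma has_rd_corr (W U : V -> Prop) (W' U' : V' -> Prop) r :
  (forall v, W v -> exists2 v', W' v' & T v v') ->
  (forall v', W' v' -> exists2 v, W v & T v v') ->
  (forall v v', T v v' -> (U v <-> U' v')) ->
  has_rd W U r -> has_rd W' U' r.
Proof.
move=> hW hW' hU [b [Wb ib sb]].
have [b' Wb' Tb] := choice_ex2 (fun i => hW _ (Wb i)).
exists b'; split=> //.
  by move=> c h; apply: ib; apply/(hU _ _ (corr_sum c Tb)).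
move=> v' /hW'[v /sb[c h] Tv]; exists c.
suff Tz : T (v - \sum_i c i *: b i) (v' - \sum_i c i *: b' i) by apply/(hU _ _ Tz).
rewrite addrC [X in T _ X]addrC -!scaleN1r.
by apply: TP => //; exact: corr_sum.
Qed.

(** Here T induces only a surjection. Its kernel is [X] below, and passing from U to X lowers the
    dimension. *)
Lemma has_rd_corr_le (W U : V -> Prop) (W' U' : V' -> Prop) r :
  subsp W -> subsp U -> subsp U' -> (forall v, U v -> W v) ->
  (forall v, W v -> exists2 v', W' v' & T v v') ->
  (forall v', W' v' -> exists2 v, W v & T v v') ->
  (forall v v', T v v' -> U v -> U' v') ->
  has_rd W U r -> exists2 r', (r' <= r)%N & has_rd W' U' r'.
Proof.
move=> sW sU sU' UW hW hW' hU h.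
pose X v := W v /\ exists2 v', U' v' & T v v'.
have sX : subsp X.
  split; first by split; [exact: subsp0 | exists 0 => //; exact: subsp0].
  move=> a u v [Wu [u' Uu Tu]] [Wv [v' Uv Tv]]; split; first exact: subspP.
  by exists (a *: u' + v'); [exact: subspP|exact: TP].
have UX v : U v -> X v.
  move=> Uv; split; first exact: UW.
  by have [v' _ Tv] := hW _ (UW _ Uv); exists v' => //; apply: hU Tv Uv.
have XW v : X v -> W v by case.
have [r1 [r2 [_ h2 ->]]] := has_rd_split sW sX sU UX XW h.
exists r2; first exact: leq_addl.
have [b [Wb ib sb]] := h2.
have [b' Wb' Tb] := choice_ex2 (fun i => hW _ (Wb i)).
exists b'; split=> //.
  move=> c Uc; apply: ib; split; first by apply: subsp_sum => // i _; apply: subspZ.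
  by exists (\sum_i c i *: b' i) => //; apply: corr_sum.
move=> v' /hW'[v /sb[c [Wc [w Uw Tw]]] Tv]; exists c.
have Tz : T (v - \sum_i c i *: b i) (v' - \sum_i c i *: b' i).
  rewrite addrC [X in T _ X]addrC -!scaleN1r.
  by apply: TP => //; exact: corr_sum.
(* Two images of the same vector differ by an image of 0, which lies in U'. *)
have := TP (-1) Tw Tz; rewrite scaleN1r addNr => /hU/(_ (subsp0 sU)).
by move=> Uz; have := subspD sU' Uw Uz; rewrite scaleN1r addNKr.
Qed.

End Correspondence.
End RelativeDimension.

(** * Hilbert functions and regular sequences *)

Section PartialSums.

(** On generating functions this is multiplication by 1 / (1 - lambda), the effect of adjoining a
    variable of degree 1. *)
Definition psum (f : nat -> nat) (a : nat) : nat := \sum_(b < a.+1) f b.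

Lemma psumS f a : psum f a.+1 = (psum f a + f a.+1)%N.
Proof. by rewrite /psum big_ord_recr. Qed.

Lemma psum0 f : psum f 0 = f 0.
Proof. by rewrite /psum big_ord1. Qed.

Lemma leq_psum f g : (forall a, f a <= g a)%N -> forall a, (psum f a <= psum g a)%N.
Proof. by move=> fg a; apply: leq_sum => i _. Qed.

Lemma leq_iter_psum k f g : (forall a, f a <= g a)%N ->
  forall a, (iter k psum f a <= iter k psum g a)%N.
Proof. by move=> fg; elim: k => // k IH a; apply: leq_psum. Qed.

Lemma psum_inj f g : psum f =1 psum g -> f =1 g.
Proof.
move=> h [|a]; first by have := h 0%N; rewrite !psum0.
by have := h a.+1; rewrite !psumS h => /addnI.
Qed.

Lemma iter_psum_inj k f g : iter k psum f =1 iter k psum g -> f =1 g.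
Proof. by elim: k => // k IH /psum_inj. Qed.

Lemma eq_psum f g : f =1 g -> psum f =1 psum g.
Proof. by move=> fg a; apply: eq_bigr. Qed.

Lemma eq_iter_psum k f g : f =1 g -> iter k psum f =1 iter k psum g.
Proof. by move=> fg; elim: k => // k IH; apply: eq_psum. Qed.

(** [D r] stands for the Hilbert function after dividing by r forms, [N r] for the dimensions of the
    kernel of the next form. *)
Variables D N : nat -> nat -> nat.
Hypothesis D0 : forall r, D r.+1 0 = D r 0.
Hypothesis DS : forall r a, (D r.+1 a.+1 + D r a = D r a.+1 + N r a)%N.

Lemma psum_step r a : psum (D r.+1) a = (D r a + \sum_(b < a) N r b)%N.
Proof.
elim: a => [|a IH]; first by rewrite psum0 big_ord0 addn0 D0.
by rewrite psumS IH big_ord_recr /=; have := DS r a; lia.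
Qed.

Lemma leq_psum_step r a : (D r a <= psum (D r.+1) a)%N.
Proof. by rewrite psum_step leq_addr. Qed.

Lemma iter_psum_mono e r a : (r <= e)%N ->
  (iter r psum (D r) a <= iter e psum (D e) a)%N.
Proof.
move=> /subnK <-; elim: (e - r)%N => // k IH.
apply: leq_trans IH _; rewrite addSn iterSr.
exact/leq_iter_psum/leq_psum_step.
Qed.

(** In general D 0 <= psum (D 1) <= psum (psum (D 2)) <= ..., and a step is an equality exactly when
    its kernel vanishes. The hypothesis closes the chain. *)
Lemma psum_defect0 e : (forall a, iter e psum (D e) a <= D 0 a)%N ->
  forall r a, (r < e)%N -> N r a = 0%N.
Proof.
move=> he r a re.
have /iter_psum_inj h : iter r psum (D r) =1 iter r psum (psum (D r.+1)).
  move=> b; apply/eqP; rewrite eqn_leq leq_iter_psum; last exact: leq_psum_step.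
  rewrite -iterSr (leq_trans (iter_psum_mono _ re)) // (leq_trans (he b)) //.
  exact: (@iter_psum_mono r 0).
(* Degree a + 1 is taken because the sum of defects in [psum_step] stops strictly below its
   argument. *)
have /eqP := h a.+1; rewrite psum_step -{1}[D r a.+1]addn0 eqn_add2l eq_sym.
by rewrite sum_nat_eq0 => /forallP/(_ ord_max)/eqP.
Qed.

Lemma psum_reg e : (forall r a, (r < e)%N -> N r a = 0%N) ->
  D 0 =1 iter e psum (D e).
Proof.
elim: e => // e IH h a; rewrite IH; last by move=> r b re; apply: h; apply: leqW.
rewrite iterSr; apply: eq_iter_psum => b.
by rewrite psum_step big1 ?addn0 // => i _; apply: h.
Qed.

End PartialSums.

(** * Successive quotients of a graded module by commuting operators of degree 1 *)

Section GradedModule.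
Variables (K : fieldType) (V : lmodType K).
Variables (X I : nat -> V -> Prop) (th : nat -> V -> V).

Definition prev (a : nat) : V -> Prop := if a is a'.+1 then X a' else fun v => v = 0.

(* The degree-a part of I + (th 0, ..., th (r - 1)) X. *)
Fixpoint gensub (r a : nat) : V -> Prop :=
  if r is r'.+1 then fun v => exists u w,
    [/\ gensub r' a u, prev a w & v = u + th r' w]
  else I a.

Definition thker (r a : nat) (v : V) : Prop := X a v /\ gensub r a.+1 (th r v).

Hypothesis sX : forall a, subsp (X a).
Hypothesis sI : forall a, subsp (I a).
Hypothesis IX : forall a v, I a v -> X a v.
Hypothesis thP : forall r (c : K) u v, th r (c *: u + v) = c *: th r u + th r v.
Hypothesis thX : forall r a v, X a v -> X a.+1 (th r v).
Hypothesis thI : forall r a v, I a v -> I a.+1 (th r v).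
Hypothesis thC : forall r s v, th r (th s v) = th s (th r v).

Lemma th_D r u v : th r (u + v) = th r u + th r v.
Proof. by rewrite -[u]scale1r thP !scale1r. Qed.

Lemma th_0 r : th r 0 = 0.
Proof. by apply: (addrI (th r 0)); rewrite -th_D !addr0. Qed.

Lemma th_N r u : th r (- u) = - th r u.
Proof. by apply/eqP; rewrite -addr_eq0 -th_D addNr th_0. Qed.

Lemma th_B r u v : th r (u - v) = th r u - th r v.
Proof. by rewrite th_D th_N. Qed.

Lemma subsp_prev a : subsp (prev a).
Proof.
case: a => [|a] //=; split=> // c u v -> ->; by rewrite scaler0 addr0.
Qed.

Lemma subsp_gensub r a : subsp (gensub r a).
Proof.
elim: r => //= r IH; split.
  exists 0, 0; split; [exact: (subsp0 IH)|exact: (subsp0 (subsp_prev a))|].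
  by rewrite th_0 addr0.
move=> c u v [u1 [u2 [hu1 hu2 ->]]] [v1 [v2 [hv1 hv2 ->]]].
exists (c *: u1 + v1), (c *: u2 + v2); split; [exact: subspP| |].
  by apply: subspP => //; exact: subsp_prev.
by rewrite thP scalerDr addrACA.
Qed.

Lemma th_prev r a v : prev a v -> X a (th r v).
Proof. by case: a => [|a] /=; [move=> ->; rewrite th_0;
  apply: subsp0|apply: thX]. Qed.

Lemma gensub_X r a v : gensub r a v -> X a v.
Proof.
elim: r v => [|r IH] v /=; first exact: IX.
by move=> [u [w [/IH Xu /th_prev Xw ->]]]; apply: subspD.
Qed.

Lemma gensubS r a v : gensub r a v -> gensub r.+1 a v.
Proof.
move=> h; exists v, 0; split=> //; first exact: (subsp0 (subsp_prev a)).
by rewrite th_0 addr0.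
Qed.

Lemma gensub_le r s a v : (r <= s)%N -> gensub r a v -> gensub s a v.
Proof. by move=> /subnK <-; elim: (s - r)%N => // k IH /IH; apply: gensubS. Qed.

Lemma gensub_I r a v : I a v -> gensub r a v.
Proof. exact: (@gensub_le 0). Qed.

Lemma th_gensubS r a v : X a v -> gensub r.+1 a.+1 (th r v).
Proof.
move=> h; exists 0, v; split=> //; last by rewrite add0r.
exact: (subsp0 (subsp_gensub _ _)).
Qed.

Lemma th_gensub s r a v : gensub r a v -> gensub r a.+1 (th s v).
Proof.
elim: r v => [|r IH] v /=; first exact: thI.
move=> [u [w [/IH Xu Xw ->]]]; exists (th s u), (th s w); split=> //.
  by apply: th_prev.
by rewrite th_D (thC s r).
Qed.

Lemma gensub0 r v : gensub r 0 v <-> I 0 v.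
Proof.
split; last exact: gensub_I.
elim: r v => //= r IH v [u [w [/IH Iu -> ->]]].
by rewrite th_0 addr0.
Qed.

Lemma subsp_thker r a : subsp (thker r a).
Proof.
split; first by split; [exact: subsp0|rewrite th_0;
  exact: (subsp0 (subsp_gensub _ _))].
move=> c u v [Xu hu] [Xv hv]; split; first exact: subspP.
by rewrite thP; apply: subspP => //; apply: subsp_gensub.
Qed.

Lemma gensub_thker r a v : gensub r a v -> thker r a v.
Proof. by move=> h; split; [exact: gensub_X h|exact: th_gensub]. Qed.

(** Dimension count in 0 -> ker -> M_a -> M_(a+1) -> M_(a+1) / th r M_a -> 0, where M is the
    quotient of X by [gensub r]. *)
Lemma hilb_step r a x1 x0 k y :
  has_rd (X a.+1) (gensub r a.+1) x1 -> has_rd (X a) (gensub r a) x0 ->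
  has_rd (thker r a) (gensub r a) k -> has_rd (X a.+1) (gensub r.+1 a.+1) y ->
  (y + x0 = x1 + k)%N.
Proof.
move=> h1 h0 hk hy.
have kX v : thker r a v -> X a v by case.
have sJ := subsp_gensub r.
have [k' [z [hk' hz x0E]]] :=
  has_rd_split (sX a) (subsp_thker r a) (sJ a) (@gensub_thker r a) kX h0.
have kk' := has_rd_uniq (sJ a) hk hk'.
(* [th r] identifies X / [thker r] with [gensub r.+1] / [gensub r] one degree higher. *)
have hz' : has_rd (gensub r.+1 a.+1) (gensub r a.+1) z.
  apply: (@has_rd_corr _ _ _
    (fun v w => X a v /\ gensub r a.+1 (w - th r v)) _ _ _ _ _ _ _ _ _ _ hz).
  - by split; [exact: subsp0|rewrite th_0 subr0; exact: subsp0].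
  - move=> c u v u' v' [Xu hu] [Xv hv]; split; first exact: subspP.
    by rewrite thP opprD addrACA -scalerBr; apply: subspP.
  - move=> v Xv; exists (th r v); first exact: th_gensubS.
    by split=> //; rewrite subrr; exact: subsp0.
  - move=> w [u [v [hu Xv ->]]]; exists v => //; split=> //.
    by rewrite addrK.
  - move=> v w [Xv hw]; split=> [[_ hv]|ww].
      by rewrite -(subrK (th r v) w); apply: subspD.
    by split=> //; rewrite -(subKr w (th r v)); apply: subspB.
have := has_rd_add (subsp_gensub r.+1 a.+1) (@gensubS r a.+1)
  (@gensub_X r.+1 a.+1) hz' hy.
by move=> /(has_rd_uniq (sJ a.+1) h1) ->; rewrite x0E -kk'; lia.
Qed.

Hypothesis finX : forall a, exists r, has_rd (X a) (I a) r.

Lemma hilb_exists : exists D : nat -> nat -> nat,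
  forall r a, has_rd (X a) (gensub r a) (D r a).
Proof.
have h r a : exists x, has_rd (X a) (gensub r a) x.
  have [x hx] := finX a.
  apply: (has_rd_quo (sX a) (subsp_gensub r a) (sI a) _ _ hx).
    by move=> v; apply: gensub_I.
  by move=> v; apply: gensub_X.
have [D hD] := choice (fun ra : nat * nat => h ra.1 ra.2).
by exists (fun r a => D (r, a)) => r a; apply: (hD (r, a)).
Qed.

Lemma thker_exists : exists N : nat -> nat -> nat,
  forall r a, has_rd (thker r a) (gensub r a) (N r a).
Proof.
have [D hD] := hilb_exists.
have h r a : exists x, has_rd (thker r a) (gensub r a) x.
  apply: (has_rd_sub (sX a) (subsp_thker r a) (subsp_gensub r a) _ _ (hD r a)).
    by move=> v; apply: gensub_thker.
  by move=> v [].
have [N hN] := choice (fun ra : nat * nat => h ra.1 ra.2).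
by exists (fun r a => N (r, a)) => r a; apply: (hN (r, a)).
Qed.

Variable D : nat -> nat -> nat.
Hypothesis hD : forall r a, has_rd (X a) (gensub r a) (D r a).

Lemma hilb_rec : exists N : nat -> nat -> nat,
  [/\ forall r a, has_rd (thker r a) (gensub r a) (N r a),
      forall r, D r.+1 0 = D r 0
    & forall r a, (D r.+1 a.+1 + D r a = D r a.+1 + N r a)%N].
Proof.
have [N hN] := thker_exists; exists N; split=> // [r|r a].
  apply: (has_rd_uniq (subsp_gensub r 0)); last exact: hD.
  by apply: eq_has_rd (hD r.+1 0) => // v; rewrite !gensub0.
exact: hilb_step (hD _ _) (hD _ _) (hN _ _) (hD _ _).
Qed.

Lemma reg_of_hilb e : (forall a, iter e psum (D e) a <= D 0 a)%N ->
  forall r a v, (r < e)%N -> thker r a v -> gensub r a v.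
Proof.
move=> he r a v re; have [N [hN N0 NS]] := hilb_rec.
have := hN r a; rewrite (psum_defect0 N0 NS he) // => h.
exact: has_rd0P.
Qed.

Lemma hilb_of_reg e : (forall r a v, (r < e)%N -> thker r a v -> gensub r a v) ->
  D 0 =1 iter e psum (D e).
Proof.
move=> he; have [N [hN N0 NS]] := hilb_rec.
apply: (psum_reg N0 NS) => r a re.
apply: (has_rd_uniq (subsp_gensub r a)) (hN r a) _.
by apply: has_rd0 => v; apply: he.
Qed.

End GradedModule.

(** * Complexes with null-homotopic multiplications *)

Section GradedComplex.
Variables (K : fieldType) (V : lmodType K).
Variables (X I : nat -> nat -> V -> Prop) (th : nat -> V -> V) (dl : V -> V).

Local Notation J r j a := (gensub (X j) (I j) th r a).

Definition prevj (j a : nat) : V -> Prop :=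
  if j is j'.+1 then X j' a else fun v => v = 0.

Definition cyc (r j a : nat) (v : V) : Prop := X j a v /\ J r j.+1 a (dl v).

Definition bnd (r j a : nat) (v : V) : Prop :=
  exists w, prevj j a w /\ J r j a (v - dl w).

Hypothesis sX : forall j a, subsp (X j a).
Hypothesis sI : forall j a, subsp (I j a).
Hypothesis IX : forall j a v, I j a v -> X j a v.
Hypothesis thP : forall r (c : K) u v, th r (c *: u + v) = c *: th r u + th r v.
Hypothesis thX : forall r j a v, X j a v -> X j a.+1 (th r v).
Hypothesis thI : forall r j a v, I j a v -> I j a.+1 (th r v).
Hypothesis thC : forall r s v, th r (th s v) = th s (th r v).
Hypothesis dlP : forall (c : K) u v, dl (c *: u + v) = c *: dl u + dl v.
Hypothesis dlX : forall j a v, X j a v -> X j.+1 a (dl v).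
Hypothesis dlI : forall j a v, I j a v -> I j.+1 a (dl v).
Hypothesis dlK : forall v, dl (dl v) = 0.
Hypothesis dl_th : forall r v, dl (th r v) = th r (dl v).

Let sJ r j a : subsp (J r j a).
Proof. by apply: subsp_gensub => // *; apply: thP. Qed.

Let JX r j a v : J r j a v -> X j a v.
Proof. by apply: gensub_X => // *; [apply: IX|apply: thX]. Qed.

Let thJ s r j a v : J r j a v -> J r j a.+1 (th s v).
Proof. by apply: th_gensub => // *; [apply: thX|apply: thI]. Qed.

Let JS r j a v : J r j a v -> J r.+1 j a v.
Proof. by apply: gensubS. Qed.

Let J0 r j v : J r j 0 v <-> I j 0 v.
Proof. exact: gensub0. Qed.

Let thJS r j a v : X j a v -> J r.+1 j a.+1 (th r v).
Proof. by apply: th_gensubS. Qed.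

Let thB r u v : th r (u - v) = th r u - th r v.
Proof. exact: th_B. Qed.

Lemma dl_D u v : dl (u + v) = dl u + dl v.
Proof. by rewrite -[u]scale1r dlP !scale1r. Qed.

Lemma dl_0 : dl 0 = 0.
Proof. by apply: (addrI (dl 0)); rewrite -dl_D !addr0. Qed.

Lemma dl_N u : dl (- u) = - dl u.
Proof. by apply/eqP; rewrite -addr_eq0 -dl_D addNr dl_0. Qed.

Lemma dl_B u v : dl (u - v) = dl u - dl v.
Proof. by rewrite dl_D dl_N. Qed.

Lemma dl_gensub r j a v : J r j a v -> J r j.+1 a (dl v).
Proof.
elim: r v => [|r IH] v /=; first exact: dlI.
move=> [u [w [/IH Ju pw ->]]]; exists (dl u), (dl w); split=> //.
  by case: a pw {Ju IH} => [|a] /=; [move=> ->; rewrite dl_0|apply: dlX].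
by rewrite dl_D dl_th.
Qed.

Lemma subsp_prevj j a : subsp (prevj j a).
Proof. by case: j => [|j] //=; split=> // c u v -> ->; rewrite scaler0 addr0. Qed.

Lemma dl_prevj j a v : prevj j a v -> X j a (dl v).
Proof. by case: j => [|j] /=; [move=> ->; rewrite dl_0;
  apply: subsp0|apply: dlX]. Qed.

Lemma subsp_cyc r j a : subsp (cyc r j a).
Proof.
split; first by split; [exact: subsp0|rewrite dl_0; exact: subsp0].
move=> c u v [Xu hu] [Xv hv]; split; first exact: subspP.
by rewrite dlP; apply: subspP.
Qed.

Lemma subsp_bnd r j a : subsp (bnd r j a).
Proof.
split.
  exists 0; split; first exact: (subsp0 (subsp_prevj j a)).
  by rewrite dl_0 subrr; exact: subsp0.
move=> c u v [u' [pu hu]] [v' [pv hv]]; exists (c *: u' + v'); split.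
  by apply: subspP => //; exact: subsp_prevj.
by rewrite dlP opprD addrACA -scalerBr; apply: subspP.
Qed.

Lemma gensub_bnd r j a v : J r j a v -> bnd r j a v.
Proof.
move=> h; exists 0; rewrite dl_0 subr0; split=> //.
exact: (subsp0 (subsp_prevj j a)).
Qed.

Lemma dl_bnd r j a v : X j a v -> bnd r j.+1 a (dl v).
Proof. by move=> h; exists v; rewrite subrr; split=> //; exact: subsp0. Qed.

Lemma bnd_cyc r j a v : bnd r j a v -> cyc r j a v.
Proof.
move=> [w [pw hw]]; split.
  rewrite -(subrK (dl w) v); apply: subspD => //; first exact: JX hw.
  exact: dl_prevj.
by have := dl_gensub hw; rewrite dl_B dlK subr0.
Qed.

Lemma bnd0 r a v : bnd r 0 a v <-> J r 0 a v.
Proof.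
split; last exact: gensub_bnd.
by move=> [w [/= ->]]; rewrite dl_0 subr0.
Qed.

Lemma cyc_deg0 r j v : cyc r j 0 v <-> cyc 0 j 0 v.
Proof. by split=> -[Xv hv]; split=> //; move: hv; rewrite !J0. Qed.

Lemma bnd_deg0 r j v : bnd r j 0 v <-> bnd 0 j 0 v.
Proof. by split=> -[w [pw hw]]; exists w; split=> //; move: hw; rewrite !J0. Qed.

Variable e : nat.

(* Null-homotopy makes th r act as zero on the cohomology of the quotient
   complex, and together with REG it splits the long exact sequence of the
   multiplication by th r into short ones. *)
Hypothesis NH : forall r j a v, (r < e)%N -> cyc r j a v -> bnd r j a.+1 (th r v).

Hypothesis REG : forall r j a v, (r < e)%N -> X j.+1 a v ->
  J r j.+1 a.+1 (th r v) -> J r j.+1 a v.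

(** If [th r] kills v modulo J, it kills [dl v], which then vanishes by REG in the term j = 1.
    Conversely [th r] sends cocycles to coboundaries, and these are zero at j = 0. *)
Lemma thker_cyc r a v : (r < e)%N ->
  thker (X 0) (I 0) th r a v <-> cyc r 0 a v.
Proof.
move=> re; split=> [[Xv hv]|Zv].
  split=> //; apply: (REG re); first exact: dlX.
  by rewrite -dl_th; apply: dl_gensub.
by split; [case: Zv|apply/bnd0/NH].
Qed.

Section Step.
Variables (r j a : nat).
Hypothesis re : (r < e)%N.

(** The kernel of the connecting map from stage r + 1 to stage r, which sends the class of v to that
    of w when dl v = th r w modulo J. *)
Let mid (v : V) : Prop := cyc r.+1 j a.+1 v /\
  exists w, bnd r j.+1 a w /\ J r j.+1 a.+1 (dl v - th r w).

Let subsp_mid : subsp mid.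
Proof.
split.
  split; first exact: (subsp0 (subsp_cyc _ _ _)).
  exists 0; split; first exact: (subsp0 (subsp_bnd _ _ _)).
  by rewrite dl_0 th_0 // subrr; exact: subsp0.
move=> c u v [zu [u' [bu hu]]] [zv [v' [bv hv]]]; split.
  by apply: subspP => //; apply: subsp_cyc.
exists (c *: u' + v'); split; first by apply: subspP => //; apply: subsp_bnd.
by rewrite thP dlP opprD addrACA -scalerBr; apply: subspP.
Qed.

Let bnd_mid v : bnd r.+1 j a.+1 v -> mid v.
Proof.
move=> bv; split; first exact: bnd_cyc.
case: bv => w [pw [u [x [hu /= Xx uE]]]].
exists (dl x); split; first exact: dl_bnd.
rewrite -dl_th -dl_B.
have -> : v - th r x = dl w + u by rewrite -(subrK (dl w) v) uE [LHS]addrAC addrK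
  addrC.
by rewrite dl_D dlK add0r; apply: dl_gensub.
Qed.

(** Injectivity is where null-homotopy enters: a coboundary at stage r + 1 is dl y + th r x modulo
    J; when it comes from a cocycle at stage r, REG makes x a cocycle, so [th r x] is already a
    coboundary at stage r. *)
Lemma mid_bot x : has_rd (cyc r j a.+1) (bnd r j a.+1) x ->
  has_rd mid (bnd r.+1 j a.+1) x.
Proof.
move=> h.
apply: (@has_rd_corr _ _ _ (fun v w => cyc r j a.+1 v /\
  exists x, X j a x /\ w = v + th r x) _ _ _ _ _ _ _ _ _ _ h).
- split; first exact: (subsp0 (subsp_cyc _ _ _)).
  by exists 0; rewrite th_0 // addr0; split=> //; exact: subsp0.
- move=> c u v u' v' [zu [x1 [X1 ->]]] [zv [x2 [X2 ->]]]; split.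
    by apply: subspP => //; apply: subsp_cyc.
  exists (c *: x1 + x2); split; first exact: subspP.
  by rewrite thP scalerDr addrACA.
- move=> v zv; exists v; last first.
    by split=> //; exists 0; rewrite th_0 // addr0; split=> //; exact: subsp0.
  split; first by case: zv => Xv hv; split=> //; apply: JS.
  exists 0; split; first exact: (subsp0 (subsp_bnd _ _ _)).
  by case: zv => _ hv; rewrite th_0 // subr0.
- move=> w [zw [y [[x1 [/= X1 hx1]] hy]]]; exists (w - th r x1); last first.
    split; last by exists x1; rewrite subrK.
    split; first by apply: subspB => //; [case: zw|apply: thX].
    rewrite dl_B dl_th -(subrK (th r y) (dl w)) -addrA -thB.
    by apply: subspD => //; apply: thJ.
  split; first by apply: subspB => //; [case: zw|apply: thX].
  rewrite dl_B dl_th -(subrK (th r y) (dl w)) -addrA -thB.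
  by apply: subspD => //; apply: thJ.
- move=> v w [zv [x1 [X1 ->]]]; split.
    move=> [y [py hy]]; exists y; split=> //.
    by rewrite addrAC; apply: subspD => //; [apply: JS|apply: thJS].
  move=> [y [py [u [x2 [hu /= X2 uE]]]]].
  have h1 : v - dl y = u + th r (x2 - x1).
    by rewrite thB addrA -uE addrAC addrK.
  have X12 : X j a (x2 - x1) by apply: subspB.
  have z12 : cyc r j a (x2 - x1).
    split=> //; apply: (REG re); first exact: dlX.
    rewrite -dl_th -(addKr u (th r _)) -h1 dl_D dl_N dl_B dlK subr0.
    by apply: subspD; [|apply: subspN => //; apply: dl_gensub|case: zv].
  have [y' [py' hy']] := NH re z12.
  exists (y + y'); split; first by apply: subspD => //; apply: subsp_prevj.
  rewrite dl_D opprD addrA h1 -addrA.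
  exact: subspD.
Qed.

(** The connecting map is onto by null-homotopy: if th r w = dl y modulo J, then y is a preimage of
    w. REG makes w determined by v up to J. *)
Lemma mid_top x : has_rd (cyc r j.+1 a) (bnd r j.+1 a) x ->
  has_rd (cyc r.+1 j a.+1) mid x.
Proof.
move=> h.
apply: (@has_rd_corr _ _ _ (fun w v => [/\ cyc r j.+1 a w, X j a.+1 v &
  J r j.+1 a.+1 (dl v - th r w)]) _ _ _ _ _ _ _ _ _ _ h).
- split; [exact: (subsp0 (subsp_cyc _ _ _))|exact: subsp0|].
  by rewrite dl_0 th_0 // subrr; exact: subsp0.
- move=> c u v u' v' [z1 X1 h1] [z2 X2 h2]; split; [|exact: subspP|].
    by apply: subspP => //; apply: subsp_cyc.
  by rewrite thP dlP opprD addrACA -scalerBr; apply: subspP.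
- move=> w zw; have [y [/= Xy hy]] := NH re zw.
  have hy' : J r j.+1 a.+1 (dl y - th r w) by rewrite -opprB; apply: subspN.
  exists y => //; split=> //; exists (dl y - th r w), w; split=> //=.
    by case: zw.
  by rewrite subrK.
- move=> v [Xv [u [w [hu /= Xw dvE]]]]; exists w; last first.
    split=> //; last by rewrite dvE addrK.
    split=> //; apply: (REG re); first exact: dlX.
    rewrite -dl_th -(addKr u (th r w)) -dvE dl_D dl_N dlK addr0.
    by apply: subspN => //; apply: dl_gensub.
  split=> //; apply: (REG re); first exact: dlX.
  rewrite -dl_th -(addKr u (th r w)) -dvE dl_D dl_N dlK addr0.
  by apply: subspN => //; apply: dl_gensub.
- move=> w v [zw Xv hv]; split=> [bw|[_ [w' [bw' hw']]]].
    split; last by exists w.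
    split=> //; exists (dl v - th r w), w; split=> //=; first by case: zw.
    by rewrite subrK.
  have Xw' : X j.+1 a w' by have [] := bnd_cyc bw'.
  rewrite -(subrK w' w); apply: subspD => //; first exact: subsp_bnd.
  apply: gensub_bnd; apply: (REG re); first by apply: subspB => //; case: zw.
  rewrite thB (_ : _ - _ = (dl v - th r w') - (dl v - th r w)).
    exact: subspB.
  by rewrite opprB [RHS]addrC addrA subrK.
Qed.

Lemma coh_step x y : has_rd (cyc r j a.+1) (bnd r j a.+1) x ->
  has_rd (cyc r j.+1 a) (bnd r j.+1 a) y ->
  has_rd (cyc r.+1 j a.+1) (bnd r.+1 j a.+1) (x + y).
Proof.
move=> /mid_bot hx /mid_top hy.
by apply: (has_rd_add subsp_mid bnd_mid _ hx hy) => v [].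
Qed.

End Step.

Variable h : nat -> nat.
Hypothesis h0 : forall j, has_rd (cyc 0 j 0) (bnd 0 j 0) (h j).
Hypothesis hS : forall j a v, cyc 0 j a.+1 v -> bnd 0 j a.+1 v.

(** Both pieces in [coh_step] keep the total index j + a, so the coefficients add by Pascal's
    rule. *)
Lemma coh_dim r j a : (r <= e)%N ->
  has_rd (cyc r j a) (bnd r j a) ('C(r, a) * h (j + a)).
Proof.
elim: r j a => [|r IH] j [|a] re.
- by rewrite bin0 mul1n addn0.
- by rewrite bin0n mul0n; apply: has_rd0 => v; apply: hS.
- have := IH j 0%N (ltnW re); rewrite !bin0; apply: eq_has_rd => v.
    by rewrite cyc_deg0 -(cyc_deg0 r.+1).
  by rewrite bnd_deg0 -(bnd_deg0 r.+1).
- rewrite binS mulnDl -[in X in (_ + X)%N]addSnnS.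
  by apply: coh_step => //; apply: IH; apply: ltnW.
Qed.

Variable D : nat -> nat -> nat.
Hypothesis hD : forall r a, has_rd (X 0 a) (J r 0 a) (D r a).

Lemma hilb_coh r : (r < e)%N ->
  D r.+1 0 = D r 0 /\
  forall a, (D r.+1 a.+1 + D r a = D r a.+1 + 'C(r, a) * h a)%N.
Proof.
move=> re; split=> [|a].
  apply: (has_rd_uniq (sJ r 0 0)); last exact: hD.
  by apply: eq_has_rd (hD r.+1 0) => // v; rewrite !J0.
apply: hilb_step (hD _ _) (hD _ _) _ (hD _ _) => //.
- exact: (IX (j := 0%N)).
- by move=> r0 a0 v; apply: thX.
- by move=> r0 a0 v; apply: thI.
apply: eq_has_rd (coh_dim 0 a (ltnW re)) => v; first by rewrite thker_cyc.
by rewrite bnd0.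
Qed.

(** The first sum expands multiplication by (1 - lambda)^r. For the second, let c_i be the
    alternating sum of the h_j with j < i. Then c_(i+1) = h_i - c_i, so adding C(r, i) h_i turns
    C(r, i+1) c_(i+1) - C(r, i) c_i into C(r+1, i+1) c_(i+1). *)
Lemma hilb_formula r i : (r <= e)%N ->
  (D r i)%:Z = \sum_(l < i.+1) (-1) ^+ l * ('C(r, l) * D 0 (i - l))%:Z
     + 'C(r, i)%:Z * \sum_(j < i) (-1) ^+ (i - j - 1) * (h j)%:Z.
Proof.
elim: r i => [|r IH] i re.
  rewrite big_ord_recl big1 ?addr0 => [|l _]; last by rewrite bin0n mul0n mulr0.
  rewrite bin0 subn0 mul1n mul1r; case: i => [|i];
    first by rewrite big_ord0 mulr0 addr0.
  by rewrite bin0n mul0r addr0.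
have [D0 DS] := hilb_coh re.
case: i => [|i].
  by rewrite D0 IH ?(ltnW re) // !big_ord_recl !big_ord0 !bin0.
have -> : (D r.+1 i.+1)%:Z = (D r i.+1)%:Z - (D r i)%:Z + ('C(r, i) * h i)%:Z.
  by have := DS i; lia.
rewrite !IH ?(ltnW re) //.
rewrite [in RHS]big_ord_recl [in X in X + _ - _]big_ord_recl.
rewrite [in RHS](eq_bigr (fun l : 'I_i.+1 =>
   (-1) ^+ (bump 0 l) * ('C(r, l.+1) * D 0%N (i.+1 - (bump 0 l)))%:Z -
   (-1) ^+ l * ('C(r, l) * D 0%N (i - l))%:Z)); last first.
  by move=> l _; rewrite /bump /= add1n subSS binS mulnDl exprS PoszD mulrDr; ring.
rewrite sumrB !bin0 binS PoszD !mulrDl.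
have hs k : \sum_(j < k.+1) (-1) ^+ (k.+1 - j - 1) * (h j)%:Z =
   (h k)%:Z - \sum_(j < k) (-1) ^+ (k - j - 1) * (h j)%:Z.
  rewrite big_ord_recr /= subSnn expr0 mul1r addrC -sumrN; congr (_ + _).
  apply: eq_bigr => j _; rewrite -mulNr; congr (_ * _).
  have -> : (k.+1 - j - 1 = (k - j - 1).+1)%N by have := ltn_ord j; lia.
  by rewrite exprS mulN1r.
rewrite hs PoszM /bump /=.
set A := \sum_(l < _) _; set B := \sum_(l < _) _; set C := \sum_(l < _) _.
ring.
Qed.

End GradedComplex.

(** * Eigenspaces of an operator of finite order *)

Section EigenProjection.
Variables (K : fieldType) (p : nat).
Hypothesis pK : p%:R != 0 :> K.

(** The idempotent, in the group algebra of a cyclic group of order p, of the character sending the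
    generator to w. *)
Definition eproj (V : lmodType K) (psi : V -> V) (w : K) (v : V) : V :=
  p%:R^-1 *: \sum_(k < p) w ^- k *: iter k psi v.

Section Operator.
Variables (V : lmodType K) (psi : V -> V).
Hypothesis psiP : forall (c : K) u v, psi (c *: u + v) = c *: psi u + psi v.

Lemma iter_psiP k c u v : iter k psi (c *: u + v) = c *: iter k psi u + iter k psi v.
Proof. by elim: k => //= k ->. Qed.

Lemma eprojP w c u v : eproj psi w (c *: u + v) = c *: eproj psi w u + eproj psi w v.
Proof.
rewrite /eproj scalerA mulrC -scalerA -scalerDr; congr (_ *: _).
rewrite scaler_sumr -big_split /=; apply: eq_bigr => k _.
by rewrite iter_psiP scalerDr !scalerA mulrC.
Qed.

Lemma psi_0 : psi 0 = 0.
Proof. by have := psiP (-1) 0 0; rewrite scaler0 addr0 scaleN1r addNr. Qed.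

Lemma psi_D u v : psi (u + v) = psi u + psi v.
Proof. by rewrite -[u]scale1r psiP !scale1r. Qed.

Lemma psi_Z c u : psi (c *: u) = c *: psi u.
Proof. by rewrite -[_ *: _]addr0 psiP psi_0 addr0. Qed.

Lemma eproj_eigen w v : w ^+ p = 1 -> iter p psi v = v ->
  psi (eproj psi w v) = w *: eproj psi w v.
Proof.
rewrite /eproj; case: (p) pK => [|q]; first by rewrite eqxx.
move=> _ wp ip; rewrite psi_Z scalerA mulrC -scalerA; congr (_ *: _).
have w0 : w != 0 by apply: contra_eq_neq wp => ->; rewrite expr0n eq_sym oner_eq0.
rewrite (big_morph psi psi_D psi_0).
rewrite [LHS]big_ord_recr [in RHS]big_ord_recl /= scalerDr addrC.
congr (_ + _).
  rewrite psi_Z -iterS ip expr0 invr1 scale1r; congr (_ *: _).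
  by apply: (mulfI (expf_neq0 q w0)); rewrite mulfV ?expf_neq0 // -exprSr.
rewrite scaler_sumr; apply: eq_bigr => k _.
by rewrite psi_Z scalerA /bump /= add1n exprS invfM mulrA mulfV // mul1r.
Qed.

Lemma eproj_id w v : w ^+ p = 1 -> psi v = w *: v -> eproj psi w v = v.
Proof.
rewrite /eproj; case: (p) pK => [|q]; first by rewrite eqxx.
move=> pK' wp pv.
have w0 : w != 0 by apply: contra_eq_neq wp => ->; rewrite expr0n eq_sym oner_eq0.
have ip k : iter k psi v = w ^+ k *: v.
  by elim: k => [|k /= ->]; rewrite ?expr0 ?scale1r // psi_Z pv scalerA exprSr.
under eq_bigr do rewrite ip scalerA mulVf ?expf_neq0 // scale1r.
by rewrite sumr_const card_ord -scaler_nat scalerA mulVf // scale1r.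
Qed.

Lemma eproj_stable w (W : V -> Prop) v : subsp W ->
  (forall v, W v -> W (psi v)) -> W v -> W (eproj psi w v).
Proof.
move=> sW pW Wv; apply: subspZ => //; apply: subsp_sum => // k _.
by apply: subspZ => //; elim: (k : nat) => //= i; apply: pW.
Qed.

(** Lifts eigenvectors of V / U to eigenvectors of V: each term [w ^- k *: iter k psi v] is
    congruent to v modulo U, hence so is their mean. *)
Lemma eproj_mod w (U : V -> Prop) v : w ^+ p = 1 -> subsp U ->
  (forall v, U v -> U (psi v)) -> U (psi v - w *: v) -> U (eproj psi w v - v).
Proof.
move=> wp sU pU Uv; rewrite /eproj.
have w0 : w != 0.
  apply: contra_eq_neq wp => ->; case: p pK => [|q _]; first by rewrite eqxx.
  by rewrite expr0n eq_sym oner_eq0.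
have vE : v = p%:R^-1 *: \sum_(k < p) v.
  by rewrite sumr_const card_ord -scaler_nat scalerA mulVf // scale1r.
rewrite {2}vE -scalerBr -sumrB; apply: subspZ => //; apply: subsp_sum => // k _.
suff h : U (iter k psi v - w ^+ k *: v).
  have := subspZ (w ^- k) sU h.
  by rewrite scalerBr scalerA mulVf ?expf_neq0 // scale1r.
elim: (k : nat) => [|i IH]; first by rewrite expr0 scale1r subrr; exact: subsp0.
rewrite iterS -(subrK (psi (w ^+ i *: v)) (psi _)) -addrA.
apply: subspD => //.
  by have := pU _ IH; rewrite psi_D -[- (_ *: v)]scaleN1r !psi_Z scaleN1r.
by rewrite psi_Z exprSr -scalerA -scalerBr; apply: subspZ.
Qed.

End Operator.

Lemma eproj_twist (V V' : lmodType K) (psi : V -> V) (psi' : V' -> V')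
  (f : V -> V') (c w : K) v :
  (forall (c : K) u v, f (c *: u + v) = c *: f u + f v) ->
  (forall (c : K) u v, psi' (c *: u + v) = c *: psi' u + psi' v) ->
  c != 0 -> (forall v, psi' (f v) = c *: f (psi v)) ->
  eproj psi' (w * c) (f v) = f (eproj psi w v).
Proof.
move=> fP psiP' c0 pf.
have f0 : f 0 = 0 by have := fP (-1) 0 0; rewrite scaler0 addr0 scaleN1r addNr.
have fD u x : f (u + x) = f u + f x by rewrite -[u]scale1r fP !scale1r.
have fZ a u : f (a *: u) = a *: f u by rewrite -[_ *: _]addr0 fP f0 addr0.
rewrite /eproj fZ (big_morph f fD f0); congr (_ *: _); apply: eq_bigr => k _.
have -> : iter k psi' (f v) = c ^+ k *: f (iter k psi v).
  elim: (k : nat) => [|i /= ->]; first by rewrite scale1r.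
  by rewrite (psi_Z psiP') pf scalerA exprSr.
by rewrite fZ scalerA exprMn invfM -mulrA mulVf ?mulr1 // expf_neq0.
Qed.

Section Graded.
Variables (V : lmodType K) (psi : V -> V) (chi mu : K).
Hypothesis psiP : forall (c : K) u v, psi (c *: u + v) = c *: psi u + psi v.
Hypothesis psi_p : forall v, iter p psi v = v.
Hypothesis chi_p : chi ^+ p = 1.
Hypothesis mu_p : mu ^+ p = 1.

(* The weight varies with the degree so that multiplication by a linear form of
   weight mu preserves eig. *)
Definition eig (X : nat -> V -> Prop) (a : nat) (v : V) : Prop :=
  X a v /\ psi v = (chi * mu ^+ a) *: v.

Lemma wt_p a : (chi * mu ^+ a) ^+ p = 1.
Proof. by rewrite exprMn chi_p -exprM mulnC exprM mu_p expr1n mulr1. Qed.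

Lemma wt_neq0 a : chi * mu ^+ a != 0.
Proof.
apply/negP => /eqP h; have := wt_p a; rewrite h.
by case: p pK => [|q _]; rewrite ?eqxx // expr0n => /esym/eqP; rewrite oner_eq0.
Qed.

Lemma mu_neq0 : mu != 0.
Proof.
apply/negP => /eqP h; have := mu_p; rewrite h.
by case: p pK => [|q _]; rewrite ?eqxx // expr0n => /esym/eqP; rewrite oner_eq0.
Qed.

Definition wproj (a : nat) (v : V) : V := eproj psi (chi * mu ^+ a) v.

Lemma wproj_eig a v : psi (wproj a v) = (chi * mu ^+ a) *: wproj a v.
Proof. by apply: eproj_eigen => //; apply: wt_p. Qed.

Lemma wproj_id a v : psi v = (chi * mu ^+ a) *: v -> wproj a v = v.
Proof. by apply: eproj_id => //; apply: wt_p. Qed.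

Lemma wprojP a c u v : wproj a (c *: u + v) = c *: wproj a u + wproj a v.
Proof. exact: eprojP. Qed.

Lemma wproj0 a : wproj a 0 = 0.
Proof. by have := wprojP a (-1) 0 0; rewrite scaler0 addr0 scaleN1r addNr. Qed.

Lemma wprojB a u v : wproj a (u - v) = wproj a u - wproj a v.
Proof. by rewrite addrC -scaleN1r wprojP scaleN1r addrC. Qed.

Lemma subsp_eig X a : subsp (X a) -> subsp (eig X a).
Proof.
move=> sX; split; first by split; [exact: subsp0|rewrite (psi_0 psiP) scaler0].
move=> c u v [Xu hu] [Xv hv]; split; first exact: subspP.
by rewrite psiP hu hv scalerDr !scalerA mulrC.
Qed.

Variables (X I : nat -> V -> Prop) (th : nat -> V -> V).
Hypothesis sX : forall a, subsp (X a).
Hypothesis sI : forall a, subsp (I a).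
Hypothesis psiX : forall a v, X a v -> X a (psi v).
Hypothesis psiI : forall a v, I a v -> I a (psi v).
Hypothesis thP : forall r (c : K) u v, th r (c *: u + v) = c *: th r u + th r v.
Hypothesis psi_th : forall r v, psi (th r v) = mu *: th r (psi v).

Lemma th_wproj r a v : th r (wproj a v) = wproj a.+1 (th r v).
Proof.
rewrite /wproj exprSr mulrA (@eproj_twist _ _ psi _ (th r) mu) //.
exact: mu_neq0.
Qed.

Lemma psi_gensub r a v : gensub X I th r a v -> gensub X I th r a (psi v).
Proof.
elim: r v => [|r IH] v /=; first exact: psiI.
move=> [u [w [/IH Ju pw ->]]]; exists (psi u), (mu *: psi w).
split=> //; last by rewrite psi_D // psi_th -[mu *: psi w]addr0 thP (th_0 thP) addr0.
case: a pw {Ju IH} => [|a] /=; first by move=> ->; rewrite psi_0 // scaler0.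
by move=> Xw; apply: subspZ => //; apply: psiX.
Qed.

Lemma wproj_gensub r a b v : gensub X I th r a v -> gensub X I th r a (wproj b v).
Proof.
by apply: eproj_stable; [exact: subsp_gensub | exact: psi_gensub].
Qed.

(** The witnesses can be projected, because [th r] carries the projection of weight chi mu^a to the
    one of weight chi mu^(a+1). *)
Lemma eig_gensub r a v :
  gensub (eig X) (eig I) th r a v <-> eig (gensub X I th r) a v.
Proof.
split.
  elim: r v => [|r IH] v //= [u [w [/IH [Ju pu] pw ->]]]; split.
    exists u, w; split=> //; by case: a pw {IH Ju pu} => [|a] //= [].
  rewrite psi_D // psi_th pu scalerDr; congr (_ + _).
  case: a pw {IH Ju pu} => [|a] /=.
    by move=> ->; rewrite psi_0 // th_0 // !scaler0.
  move=> [_ ->]; rewrite exprSr mulrA -[_ *: w]addr0 thP th_0 // addr0 scalerA.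
  by rewrite mulrC.
move=> [Jv pv]; rewrite -(wproj_id pv).
elim: r {pv} v Jv => [|r IH] v /=.
  move=> Iv; split; last exact: wproj_eig.
  by apply: eproj_stable => //; exact: psiI.
move=> [u [w [Ju pw ->]]].
rewrite -[u]scale1r wprojP scale1r.
exists (wproj a u); case: a IH pw Ju => [|a] IH /=.
  move=> -> Ju; exists 0; split=> //; first exact: IH.
  by rewrite th_0 // wproj0.
move=> Xw Ju; exists (wproj a w); split; [exact: IH| |by rewrite th_wproj].
by split; [apply: eproj_stable => //; exact: psiX|exact: wproj_eig].
Qed.

End Graded.

Section GradedComplexEigen.
Variables (V : lmodType K) (psi : V -> V) (chi mu : K).
Variables (X I : nat -> nat -> V -> Prop) (th : nat -> V -> V) (dl : V -> V).
Hypothesis psiP : forall (c : K) u v, psi (c *: u + v) = c *: psi u + psi v.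
Hypothesis psi_p : forall v, iter p psi v = v.
Hypothesis chi_p : chi ^+ p = 1.
Hypothesis mu_p : mu ^+ p = 1.
Hypothesis sX : forall j a, subsp (X j a).
Hypothesis sI : forall j a, subsp (I j a).
Hypothesis psiX : forall j a v, X j a v -> X j a (psi v).
Hypothesis psiI : forall j a v, I j a v -> I j a (psi v).
Hypothesis thP : forall r (c : K) u v, th r (c *: u + v) = c *: th r u + th r v.
Hypothesis psi_th : forall r v, psi (th r v) = mu *: th r (psi v).
Hypothesis dlP : forall (c : K) u v, dl (c *: u + v) = c *: dl u + dl v.
Hypothesis psi_dl : forall v, psi (dl v) = dl (psi v).

Let Xe j := eig psi chi mu (X j).
Let Ie j := eig psi chi mu (I j).

Lemma dl_wproj a v : dl (wproj psi chi mu a v) = wproj psi chi mu a (dl v).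
Proof.
rewrite /wproj -[X in eproj psi X (dl v)]mulr1 (@eproj_twist _ _ psi _ dl 1)
  ?oner_eq0 //.
by move=> u; rewrite scale1r.
Qed.

Lemma eig_dl a v : psi v = (chi * mu ^+ a) *: v ->
  psi (dl v) = (chi * mu ^+ a) *: dl v.
Proof. by move=> h; rewrite psi_dl h -[_ *: v]addr0 dlP (dl_0 dlP) addr0. Qed.

Lemma eig_cyc r j a v :
  cyc Xe Ie th dl r j a v <-> eig psi chi mu (cyc X I th dl r j) a v.
Proof.
have eg i b u := eig_gensub psiP psi_p chi_p mu_p (sX i) (sI i) (psiX (j := i))
  (psiI (j := i)) thP psi_th r b u.
split=> [[[Xv pv] /eg[hv _]]|[[Xv hv] pv]]; first by split.
by split=> //; apply/eg; split=> //; apply: eig_dl.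
Qed.

Lemma eig_bnd r j a v :
  bnd Xe Ie th dl r j a v <-> eig psi chi mu (bnd X I th dl r j) a v.
Proof.
have eg i b u := eig_gensub psiP psi_p chi_p mu_p (sX i) (sI i) (psiX (j := i))
  (psiI (j := i)) thP psi_th r b u.
split=> [[w [pw /eg[hw pv]]]|[[w [pw hw]] pv]].
  split; first by exists w; split=> //; case: (j) pw => //= j' [].
  rewrite -{1}(subrK (dl w) v) psi_D // pv -[in RHS](subrK (dl w) v) [RHS]scalerDr.
  congr (_ + _).
  case: (j) pw => [|j'] /=; first by move=> ->; rewrite (dl_0 dlP) psi_0 // scaler0.
  by move=> [_ ?]; apply: eig_dl.
(* A primitive of an eigenvector may be replaced by its projection, since [dl] commutes with
   [wproj]. *)
exists (wproj psi chi mu a w); split.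
  case: (j) pw => [|j'] /=.
    by move=> ->; apply: wproj0.
  move=> Xw; split; last exact: wproj_eig.
  by apply: eproj_stable => //; exact: psiX.
rewrite dl_wproj -(wproj_id psiP chi_p mu_p pv) -wprojB //.
apply/eg; split; last exact: wproj_eig.
by apply: wproj_gensub => //; [exact: psiX|exact: psiI].
Qed.

End GradedComplexEigen.
End EigenProjection.

(** * The complex of the face rings of the stars *)

Section Polynomials.
Variables (K : fieldType) (n : nat).
Implicit Types (b : 'X_{1..n}) (f h : {mpoly K[n]}) (s t : {set 'I_n}) (v : 'I_n).

Definition msup b : {set 'I_n} := [set v | b v != 0%N].

Definition linform (c : 'I_n -> K) : {mpoly K[n]} := \sum_v c v *: 'X_v.

Lemma addUBm v b : b v != 0%N -> (U_(v) + (b - U_(v)))%MM = b.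
Proof.
move=> b0; apply/mnmP => w; rewrite mnmDE mnmBE mnm1E.
by case: eqVneq => [<-|_] /=; rewrite ?subn0 // subnKC // lt0n.
Qed.

Lemma mcoeffXM v f b :
  ('X_v * f)@_b = if b v == 0%N then 0 else f@_(b - U_(v))%MM.
Proof.
case: eqVneq => [b0|b0]; last first.
  by rewrite -{1}(addUBm b0) mulrC mcoeffMX.
rewrite mulrC [f]mpolyE mulr_suml raddf_sum big1_seq //= => m _.
rewrite -scalerAl mcoeffZ -mpolyXD mcoeffX; case: eqP => [mb|]; last by rewrite mulr0.
by move: b0; rewrite -mb mnmDE mnm1E eqxx addn1.
Qed.

Lemma mcoeff_filter (P : pred 'X_{1..n}) f b :
  (\sum_(m <- msupp f | P m) f@_m *: 'X_[m])@_b = if P b then f@_b else 0.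
Proof.
rewrite raddf_sum /=; under eq_bigr do rewrite mcoeffZ mcoeffX.
case: (boolP (b \in msupp f)) => bf; last first.
  rewrite big1_seq => [|m /andP[_ mf]].
    by move: bf; rewrite -mcoeff_eq0 => /eqP ->; rewrite if_same.
  by case: eqP => [mb|_]; rewrite ?mulr0 //; move: bf; rewrite -mb mf.
rewrite big_mkcond (bigD1_seq b) ?msupp_uniq //= eqxx mulr1.
rewrite big1_seq ?addr0 // => m /andP[mb _].
by rewrite (negPf mb) mulr0 if_same.
Qed.

Lemma dhomog_coeffP a f :
  reflect (forall b, mdeg b != a -> f@_b = 0) (f \is (a).-homog).
Proof.
apply: (iffP idP) => [h b|h]; first exact: dhomog_nemf_coeff.
by apply/dhomogP => b; rewrite mcoeff_msupp; apply: contra_neq_eq => /h.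
Qed.

Lemma msup_sub v b : msup (b - U_(v))%MM \subset msup b.
Proof.
by apply/fintype.subsetP => w; rewrite !inE mnmBE; apply: contra => /eqP ->.
Qed.

Lemma linform_homog c : linform c \is 1.-homog.
Proof.
by apply: rpred_sum => v _; apply: rpredZ; rewrite dhomogX /= mdeg1.
Qed.

Lemma subsp_homog a : subsp (fun f => f \is (a).-homog).
Proof. by split=> [|c f h hf hh]; [apply: rpred0|apply: rpredD => //;
  apply: rpredZ]. Qed.

Lemma linform_mul_homog c a f : f \is (a).-homog -> linform c * f \is (a.+1).-homog.
Proof. by move=> hf; rewrite -add1n; apply: dhomogM => //; apply: linform_homog. Qed.

Lemma XU_mul_homog v a f : f \is (a).-homog -> 'X_v * f \is (a.+1).-homog.
Proof. by move=> hf; rewrite -add1n; apply: dhomogM => //;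
  rewrite dhomogX /= mdeg1. Qed.

Variable G : {set {set 'I_n}}.
Hypothesis Gsub : forall s t, s \in G -> t \subset s -> t \in G.

(* The Stanley-Reisner ideal of the star of s in G. *)
Definition SRI s f : Prop := forall b, msup b :|: s \in G -> f@_b = 0.

Definition SRIh s a f : Prop := f \is (a).-homog /\ SRI s f.

Lemma SRI_0 s : SRI s 0.
Proof. by move=> b _; rewrite mcoeff0. Qed.

Lemma SRI_P s c f h : SRI s f -> SRI s h -> SRI s (c *: f + h).
Proof. by move=> hf hh b hb; rewrite mcoeffD mcoeffZ hf // hh // mulr0 addr0. Qed.

Lemma subsp_SRI s : subsp (SRI s).
Proof. by split=> *; [exact: SRI_0|exact: SRI_P]. Qed.

Lemma subsp_SRIh s a : subsp (SRIh s a).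
Proof.
split=> [|c f h [f1 f2] [h1 h2]]; first by split; [apply: rpred0|exact: SRI_0].
by split; [exact: (subspP c (subsp_homog a))|exact: SRI_P].
Qed.

Lemma SRI_XU s v f : SRI s f -> SRI s ('X_v * f).
Proof.
move=> hf b hb; rewrite mcoeffXM; case: eqP => // _; apply: hf.
by apply: (Gsub hb); apply: setSU; apply: msup_sub.
Qed.

(** A monomial of x_v f contains v, so adjoining v to s does not change the union of its support
    with s. *)
Lemma SRI_XU_add s v f : SRI (v |: s) f -> SRI s ('X_v * f).
Proof.
move=> hf b hb; rewrite mcoeffXM; case: eqP => // /eqP bv; apply: hf.
apply: (Gsub hb); rewrite setUA finset.subUset subsetUr andbT.
rewrite finset.subUset (fintype.subset_trans (msup_sub v b) (finset.subsetUl _ _)) /=.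
by rewrite sub1set !inE bv.
Qed.

Lemma SRI_mono s t f : s \subset t -> SRI s f -> SRI t f.
Proof. by move=> st hf b hb; apply: hf; apply: (Gsub hb); apply: setUS. Qed.

Lemma SRI_linform s c f : SRI s f -> SRI s (linform c * f).
Proof.
move=> hf; rewrite mulr_suml; apply: (@subsp_sum K {mpoly K[n]} (SRI s) _ _ xpredT)
  => [|v _]; first exact: subsp_SRI.
by rewrite -scalerAl; apply: (subspZ _ (subsp_SRI s)); apply: SRI_XU.
Qed.

Lemma SRIh_linform s c a f : SRIh s a f -> SRIh s a.+1 (linform c * f).
Proof. by move=> [h1 h2]; split; [exact: linform_mul_homog|exact: SRI_linform]. Qed.

Lemma SRI_nonface s f : s \notin G -> SRI s f.
Proof.
by move=> sG b hb; case/negP: sG; apply: (Gsub hb); apply: finset.subsetUr.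
Qed.

Variable c : nat -> 'I_n -> K.

Definition Hpiece a f : Prop := f \is (a).-homog.

Definition lmul (r : nat) f : {mpoly K[n]} := linform (c r) * f.

(* The degree-a part of the ideal of the quotient of the star of s by the
   first r linear forms. *)
Definition Jst s r a f : Prop := gensub Hpiece (SRIh s) lmul r a f.

Lemma lmulP r (a : K) f h : lmul r (a *: f + h) = a *: lmul r f + lmul r h.
Proof. by rewrite /lmul mulrDr scalerAr. Qed.

Lemma lmulX r a f : Hpiece a f -> Hpiece a.+1 (lmul r f).
Proof. exact: linform_mul_homog. Qed.

Lemma lmulC r k f : lmul r (lmul k f) = lmul k (lmul r f).
Proof. by rewrite /lmul mulrCA. Qed.

Lemma lmulI r s a f : SRIh s a f -> SRIh s a.+1 (lmul r f).
Proof. exact: SRIh_linform. Qed.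

Lemma SRIh_H s a f : SRIh s a f -> Hpiece a f.
Proof. by case. Qed.

Lemma subsp_Jst s r a : subsp (Jst s r a).
Proof.
apply: subsp_gensub; [exact: subsp_homog|exact: subsp_SRIh|exact: lmulP].
Qed.

Lemma Jst_H s r a f : Jst s r a f -> Hpiece a f.
Proof.
apply: gensub_X; [exact: subsp_homog|exact: SRIh_H|exact: lmulP|exact: lmulX].
Qed.

Lemma Jst_XU_add s v r a f : Jst (v |: s) r a f -> Jst s r a.+1 ('X_v * f).
Proof.
elim: r f => [|r IH] f /=.
  by move=> [h1 h2]; split; [exact: XU_mul_homog|exact: SRI_XU_add].
move=> [u [w [Ju pw ->]]]; exists ('X_v * u), ('X_v * w).
split; [exact: IH| |by rewrite mulrDr /lmul mulrCA].
by case: a pw {IH Ju} => [|a] /=; [move=> ->; rewrite mulr0;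
  apply: rpred0|exact: XU_mul_homog].
Qed.

Lemma Jst_nonface s r a f : s \notin G -> Hpiece a f -> Jst s r a f.
Proof.
move=> sG hf; apply: gensub_I; [exact: subsp_homog|exact: lmulP|].
by split=> //; apply: SRI_nonface.
Qed.

End Polynomials.

Section Families.
Variables (K : fieldType) (n : nat).
Implicit Types (b : 'X_{1..n}) (s t : {set 'I_n}) (u v : 'I_n).

(** The index runs over all subsets, not only faces: at a nonface the ideal [SRI] is everything, so
    the entry vanishes modulo it, while [fdl] and [contr] become the operators of the full simplex,
    without side conditions. *)
Definition fam : Type := {ffun {set 'I_n} -> {mpoly K[n]}}.
HB.instance Definition _ := GRing.Lmodule.on fam.
Implicit Types F H : fam.

Lemma famP F H : (forall s, F s = H s) -> F = H.
Proof. by move=> h; apply/ffunP. Qed.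

Lemma famDE F H s : (F + H) s = F s + H s. Proof. by rewrite ffunE. Qed.
Lemma famZE (a : K) F s : (a *: F) s = a *: F s. Proof. by rewrite ffunE. Qed.
Lemma fam0E s : (0 : fam) s = 0. Proof. by rewrite ffunE. Qed.
Lemma famNE F s : (- F) s = - F s. Proof. by rewrite ffunE. Qed.

Definition pos v t : nat := #|[set u in t | (u < v)%N]|.

Definition fdl F : fam :=
  [ffun t : {set 'I_n} => \sum_(v in t) ((-1) ^+ pos v t : K) *: F (t :\ v)].

Definition contr v F : fam :=
  [ffun t : {set 'I_n} => if v \in t then 0 else ((-1) ^+ pos v t : K) *: F (v |: t)].

Lemma fdlP (a : K) F H : fdl (a *: F + H) = a *: fdl F + fdl H.
Proof.
apply: famP => t; rewrite famDE famZE !ffunE scaler_sumr -big_split /=.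
apply: eq_bigr => v _; rewrite famDE famZE scalerDr !scalerA; congr (_ *: _ + _).
exact: mulrC.
Qed.

Lemma posU u v t : v \notin t -> pos u (v |: t) = ((v < u) + pos u t)%N.
Proof.
move=> vt; rewrite /pos.
case: (boolP (v < u)%N) => vu.
  rewrite (_ : [set _ in _ | _] = v |: [set w in t | (w < u)%N]).
    by rewrite cardsU1 inE (negPf vt).
  apply/setP => w; rewrite !inE; case: eqP => [->|] //=.
congr #|pred_of_set _|; apply/setP => w; rewrite !inE; case: eqP => [->|] //=.
by rewrite (negPf vu) andbF.
Qed.

Lemma posD u v t : v \in t -> pos u t = ((v < u) + pos u (t :\ v))%N.
Proof. by move=> vt; rewrite -{1}(setD1K vt) posU // !inE eqxx. Qed.

Lemma posU1 v t : v \notin t -> pos v (v |: t) = pos v t.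
Proof. by move=> vt; rewrite posU // ltnn. Qed.

Lemma fdlK F : fdl (fdl F) = 0.
Proof.
apply: famP => t; rewrite fam0E ffunE.
pose T u v : {mpoly K[n]} :=
  ((-1) ^+ (pos v t + pos u (t :\ v)) : K) *: F (t :\ v :\ u).
have -> : \sum_(v in t) ((-1) ^+ pos v t : K) *: fdl F (t :\ v) =
    \sum_(v in t) \sum_(u in t | u != v) T u v.
  apply: eq_bigr => v vt; rewrite ffunE scaler_sumr; apply: eq_big => [u|u _].
    by rewrite !inE andbC.
  by rewrite scalerA -exprD.
rewrite (eq_bigr (fun v => \sum_(u in t | (u < v)%N) T u v +
  \sum_(u in t | (v < u)%N) T u v)); last first.
  move=> v vt; rewrite (bigID (fun u => (u < v)%N)) /=; congr (_ + _).
    apply: eq_bigl => u; rewrite -andbA; congr (_ && _).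
    by case: eqP => [->|]; rewrite ?ltnn.
  apply: eq_bigl => u; rewrite -leqNgt leq_eqVlt (inj_eq val_inj) eq_sym.
  by case: eqP => [->|]; rewrite ?ltnn ?andbF ?andbT.
rewrite big_split /= [X in X + _](exchange_big_dep (fun u => u \in t)) /=; last first.
  by move=> u v _ /andP[].
rewrite -big_split /= big1 // => v vt.
rewrite (eq_bigl (fun u => (u \in t) && (v < u)%N)); last by move=> u; rewrite vt.
rewrite -big_split /= big1 // => u /andP[ut vu].
rewrite /T (_ : t :\ u :\ v = t :\ v :\ u); last by rewrite setDDl setUC -setDDl.
rewrite -scalerDl; apply/eqP; rewrite scaler_eq0; apply/orP; left.
rewrite (posD u vt) vu (posD v ut) [(u < v)%N]ltnNge (ltnW vu) /= add0n.
by rewrite -addnA exprD expr1 mulN1r [(pos v _ + _)%N]addnC addNr.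
Qed.

(** The full simplex is a cone with apex v. For t avoiding v, the terms deleting some u of t cancel,
    because inserting v and deleting u in the two orders gives opposite signs. *)
Lemma contr_homotopy v F : fdl (contr v F) + contr v (fdl F) = F.
Proof.
apply: famP => t; rewrite famDE !ffunE; case: ifPn => vt.
  rewrite addr0 (bigD1 v) //= big1 => [|u /andP[ut uv]]; last first.
    by rewrite ffunE !inE vt eq_sym uv scaler0.
  rewrite ffunE !inE eqxx /= (posD v vt) ltnn setD1K // scalerA.
  by rewrite addr0 -expr2 sqrr_sign scale1r.
rewrite [X in _ + _ *: X](bigD1 v) ?setU11 //= scalerDr addrC scalerA posU1 //.
rewrite -expr2 sqrr_sign scale1r setU1K // -addrA.
rewrite [X in _ + X](_ : _ = 0) ?addr0 //.
rewrite [X in _ *: X](eq_bigl (fun u => u \in t)); last first.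
  move=> u; rewrite !inE; case: eqP => [->|]; first by rewrite (negPf vt) ?andbF.
  by rewrite andbT.
rewrite scaler_sumr -big_split /= big1 // => u ut.
have uv : u != v by apply: contraNneq vt => <-.
have vtu : v \notin t :\ u by rewrite !inE negb_and vt orbT.
rewrite ffunE (negPf vtu) !scalerA -!exprD posU //.
have -> : (v |: t) :\ u = v |: t :\ u.
  apply/setP => w; rewrite !inE; case: (eqVneq w v) => [->|] //=.
  by rewrite eq_sym uv.
rewrite -scalerDl; apply/eqP; rewrite scaler_eq0; apply/orP; left.
rewrite (posD v ut) -![(-1) ^+ (_ + _)]signr_odd !oddD.
have -> : odd (v < u)%N = ~~ odd (u < v)%N.
  by case: ltngtP (uv) => // /val_inj ->; rewrite eqxx.
case: (odd (u < v)); case: (odd _); case: (odd _);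
  by rewrite /= ?expr0 ?expr1 ?addNr ?subrr.
Qed.

Variable c : nat -> 'I_n -> K.

Definition fmul (r : nat) F : fam := [ffun s => linform (c r) * F s].

Lemma fmulE r F s : fmul r F s = lmul c r (F s).
Proof. by rewrite ffunE. Qed.

Lemma fmulP r (a : K) F H : fmul r (a *: F + H) = a *: fmul r F + fmul r H.
Proof.
by apply: famP => s; rewrite famDE famZE !fmulE famDE famZE lmulP.
Qed.

Lemma fmulC r k F : fmul r (fmul k F) = fmul k (fmul r F).
Proof. by apply: famP => s; rewrite !fmulE lmulC. Qed.

Lemma fdl_fmul r F : fdl (fmul r F) = fmul r (fdl F).
Proof.
apply: famP => t; rewrite fmulE !ffunE /lmul mulr_sumr; apply: eq_bigr => v _.
by rewrite fmulE /lmul scalerAr.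
Qed.

Definition fcontr (r : nat) F : fam :=
  [ffun t : {set 'I_n} => \sum_v c r v *: ('X_v * contr v F t)].

(* The homotopy fcontr r preserves the ideals of the stars, whereas contr alone
   does not: x_v maps the ideal of the star of s + v into that of the star of
   s. *)
Lemma fcontr_homotopy r F : fdl (fcontr r F) + fcontr r (fdl F) = fmul r F.
Proof.
apply: famP => t; rewrite famDE fmulE /lmul /linform mulr_suml !ffunE.
under eq_bigr do rewrite ffunE scaler_sumr.
rewrite exchange_big -big_split /=; apply: eq_bigr => v _.
rewrite -scalerAl -[in RHS](contr_homotopy v F) famDE mulrDr scalerDr.
congr (_ + _); rewrite [in RHS]ffunE mulr_sumr scaler_sumr.
by apply: eq_bigr => u _; rewrite -scalerAr !scalerA mulrC.
Qed.

Definition Xfam (j a : nat) F : Prop :=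
  forall s, F s \is (a).-homog /\ (#|s| != j -> F s = 0).

Lemma subsp_Xfam j a : subsp (Xfam j a).
Proof.
split=> [s|x F H hF hH s]; first by rewrite fam0E; split=> //; apply: rpred0.
have [f1 f2] := hF s; have [h1 h2] := hH s; rewrite famDE famZE; split.
  by apply: (subspP x (subsp_homog K n a)).
by move=> sj; rewrite f2 // h2 // scaler0 addr0.
Qed.

Lemma fdl_X j a F : Xfam j a F -> Xfam j.+1 a (fdl F).
Proof.
move=> hF t; rewrite ffunE; split.
  by apply: rpred_sum => v _; apply: rpredZ; have [] := hF (t :\ v).
move=> tj; rewrite big1 // => v vt; have [_ ->] := hF (t :\ v);
  first by rewrite scaler0.
by move: tj; rewrite (cardsD1 v t) vt add1n eqSS.
Qed.

Lemma fmul_X r j a F : Xfam j a F -> Xfam j a.+1 (fmul r F).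
Proof.
move=> hF s; have [h1 h2] := hF s; rewrite fmulE; split; first exact: lmulX.
by move=> /h2 ->; rewrite /lmul mulr0.
Qed.

Lemma contr_X v j a F : Xfam j.+1 a F -> Xfam j a (contr v F).
Proof.
move=> hF t; rewrite ffunE; case: ifPn => vt; first by split=> //; apply: rpred0.
have [h1 h2] := hF (v |: t); split; first exact: rpredZ.
by move=> tj; rewrite h2 ?scaler0 // cardsU1 vt add1n eqSS.
Qed.

Lemma contr_X0 v a F : Xfam 0 a F -> contr v F = 0.
Proof.
move=> hF; apply: famP => t; rewrite fam0E ffunE; case: ifPn => // vt.
have [_ ->] := hF (v |: t); first by rewrite scaler0.
by rewrite cardsU1 vt.
Qed.

Variable G : {set {set 'I_n}}.
Hypothesis Gsub : forall s t, s \in G -> t \subset s -> t \in G.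

Definition Ifam (j a : nat) F : Prop := Xfam j a F /\ forall s, SRI G s (F s).

Definition Jfam r j a F : Prop := gensub (Xfam j) (Ifam j) fmul r a F.

Lemma subsp_Ifam j a : subsp (Ifam j a).
Proof.
split=> [|x F H [F1 F2] [H1 H2]].
  split; first exact: (subsp0 (subsp_Xfam j a)).
  by move=> s; rewrite fam0E; apply: SRI_0.
split; first exact: (subspP x (subsp_Xfam j a)).
by move=> s; rewrite famDE famZE; apply: SRI_P.
Qed.

Lemma Ifam_X j a F : Ifam j a F -> Xfam j a F. Proof. by case. Qed.

Lemma fmul_I r j a F : Ifam j a F -> Ifam j a.+1 (fmul r F).
Proof.
move=> [h1 h2]; split; first exact: fmul_X.
by move=> s; rewrite fmulE; apply: SRI_linform.
Qed.

Lemma fdl_I j a F : Ifam j a F -> Ifam j.+1 a (fdl F).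
Proof.
move=> [h1 h2]; split; first exact: fdl_X.
move=> t; rewrite ffunE.
apply: (@subsp_sum K {mpoly K[n]} (SRI G t)) => [|v vt]; first exact: subsp_SRI.
apply: (@subspZ K {mpoly K[n]} (SRI G t)); first exact: subsp_SRI.
by apply: SRI_mono (h2 _) => //; apply: subD1set.
Qed.

Lemma JfamP r j a F :
  Jfam r j a F <-> Xfam j a F /\ forall s, Jst G c s r a (F s).
Proof.
split.
  elim: r F => [|r IH] F /=.
    by move=> [h1 h2]; split=> // s; split=> //; have [] := h1 s.
  move=> [U [W [/IH[XU JU] pW ->]]]; split.
    apply: (subspD (subsp_Xfam j a)) => //.
    apply: th_prev pW; [exact: subsp_Xfam|exact: fmulP|by move=> *; apply: fmul_X].
  move=> s; rewrite famDE fmulE; exists (U s), (W s); split=> //.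
  case: a pW {IH XU JU} => [|a] /=; first by move=> ->; rewrite fam0E.
  by move=> /(_ s)[].
elim: r F => [|r IH] F /=.
  by move=> [h1 h2]; split=> // s; case: (h2 s).
move=> [XF JF].
(* Witnesses are chosen for each s separately, and as 0 off size j, so that the assembled families
   stay in [Xfam]. *)
have /choice[uw huw] : forall s, exists uw : {mpoly K[n]} * {mpoly K[n]},
    (#|s| != j -> uw = (0, 0)) /\ [/\ Jst G c s r a uw.1,
    prev (@Hpiece K n) a uw.2 & F s = uw.1 + lmul c r uw.2].
  move=> s; case: (eqVneq #|s| j) => sj.
    by have [u [w h]] := JF s; exists (u, w).
  exists (0, 0); split=> //; split; first exact: (subsp0 (subsp_Jst G c s r a)).
    exact: (subsp0 (subsp_prev (@subsp_homog K n) a)).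
  by rewrite (XF s).2 // /lmul mulr0 addr0.
exists ([ffun s => (uw s).1] : fam), ([ffun s => (uw s).2] : fam).
split.
- apply: IH; split=> s; rewrite ffunE; have [h1 [h2 h3 h4]] := huw s => //.
  by split; [apply: Jst_H h2|move=> /h1 ->].
- case: a {IH XF JF} huw => [|a] huw /=.
    by apply: famP => s; rewrite fam0E ffunE; have [_ []] := huw s.
  move=> s; rewrite ffunE; have [h1 [h2 h3 h4]] := huw s; split=> //.
  by move=> /h1 ->.
- by apply: famP => s; rewrite famDE fmulE !ffunE; have [_ []] := huw s.
Qed.

Lemma fcontr_J r k j a F : Jfam k j.+1 a F -> Jfam k j a.+1 (fcontr r F).
Proof.
move=> /JfamP[XF JF]; apply/JfamP; split.
  move=> t; rewrite ffunE; split.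
    apply: rpred_sum => v _; apply: rpredZ; apply: XU_mul_homog.
    by have [] := contr_X v XF t.
  move=> tj; rewrite big1 // => v _.
  by have [_ ->] := contr_X v XF t; rewrite // mulr0 scaler0.
move=> t; rewrite ffunE.
apply: (@subsp_sum K {mpoly K[n]} (Jst G c t k a.+1)) => [|v _];
  first exact: subsp_Jst.
apply: (@subspZ K {mpoly K[n]} (Jst G c t k a.+1)); first exact: subsp_Jst.
rewrite ffunE; case: ifPn => vt.
  by rewrite mulr0; exact: (subsp0 (subsp_Jst G c t k a.+1)).
rewrite -scalerAr; apply: (@subspZ K {mpoly K[n]} (Jst G c t k a.+1)).
  exact: subsp_Jst.
exact: Jst_XU_add.
Qed.

Lemma fcontr_X r j a F : Xfam j.+1 a F -> Xfam j a.+1 (fcontr r F).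
Proof.
move=> XF t; rewrite ffunE; split.
  apply: rpred_sum => v _; apply: rpredZ; apply: XU_mul_homog.
  by have [] := contr_X v XF t.
move=> tj; rewrite big1 // => v _.
by have [_ ->] := contr_X v XF t; rewrite // mulr0 scaler0.
Qed.

Lemma fcontr_X0 r a F : Xfam 0 a F -> fcontr r F = 0.
Proof.
move=> XF; apply: famP => t; rewrite ffunE fam0E big1 // => v _.
by rewrite (contr_X0 v XF) fam0E mulr0 scaler0.
Qed.

Local Notation cycF := (cyc Xfam Ifam fmul fdl).
Local Notation bndF := (bnd Xfam Ifam fmul fdl).

Lemma fam_null_homotopic r k j a F : cycF k j a F -> bndF k j a.+1 (fmul r F).
Proof.
move=> [XF JF]; exists (fcontr r F); split.
  by case: j XF {JF} => [|j] XF /=; [apply: fcontr_X0 XF|apply: fcontr_X].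
rewrite -(fcontr_homotopy r F) addrC addKr.
exact: (fcontr_J r JF).
Qed.

(** In a term j + 1 only nonempty s carry an entry, and nonfaces contribute nothing, so regularity
    is required at nonempty faces alone. *)
Lemma fam_regular e :
  (forall s r a f, s \in G -> s != finset.set0 -> (r < e)%N ->
     thker (@Hpiece K n) (SRIh G s) (lmul c) r a f -> Jst G c s r a f) ->
  forall r j a F, (r < e)%N -> Xfam j.+1 a F -> Jfam r j.+1 a.+1 (fmul r F) ->
    Jfam r j.+1 a F.
Proof.
move=> reg r j a F re XF /JfamP[_ JF]; apply/JfamP; split=> // s.
have [Fh F0] := XF s.
case: (boolP (s \in G)) => sG; last exact: Jst_nonface.
case: (eqVneq #|s| j.+1) => sj; last first.
  by rewrite F0 //; exact: (subsp0 (subsp_Jst G c s r a)).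
apply: reg => //; first by rewrite -cards_eq0 sj.
by split=> //; have := JF s; rewrite fmulE.
Qed.

(* The contraction is done monomial by monomial, along a vertex of the
   support. *)
Lemma fam_exact_pos j a F : cycF 0 j a.+1 F -> bndF 0 j a.+1 F.
Proof.
move=> [XF /= [_ IF]].
(* Adjoining [top b] to t leaves [msup b :|: t] unchanged, so contracting the coefficient of b along
   [top b] respects the ideals of the stars. *)
pose top b := [pick v | v \in msup b].
pose P v (f : {mpoly K[n]}) : {mpoly K[n]} :=
  \sum_(b <- msupp f | top b == Some v) f@_b *: 'X_[b].
have PE v f b : (P v f)@_b = if top b == Some v then f@_b else 0.
  exact: mcoeff_filter.
pose W : fam := [ffun t => \sum_v P v (contr v F t)].
have Pdl v H t : P v (fdl H t) = fdl ([ffun s => P v (H s)] : fam) t.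
  apply/mpolyP => b; rewrite PE !ffunE !raddf_sum /=.
  case: ifP => tb; last first.
    by rewrite big1 // => u _; rewrite mcoeffZ ffunE PE tb mulr0.
  by apply: eq_bigr => u _; rewrite !mcoeffZ ffunE PE tb.
have FE t : F t - fdl W t = \sum_v P v (contr v (fdl F) t).
  have -> : fdl W t = \sum_v P v (fdl (contr v F) t).
    under [RHS]eq_bigr do rewrite Pdl ffunE.
    rewrite exchange_big ffunE; apply: eq_bigr => u _ /=.
    rewrite ffunE scaler_sumr; apply: eq_bigr => v _.
    by rewrite [in RHS]ffunE.
  (* Only the monomial 1 has no [top], and it does not occur in degree a + 1. *)
  have -> : F t = \sum_v P v (F t).
    apply/mpolyP => b; rewrite raddf_sum /=; under eq_bigr do rewrite PE.
    case tb : (top b) => [v|].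
      rewrite (bigD1 v) //= eqxx big1 ?addr0 // => u uv.
      by case: eqP => // -[vu]; rewrite vu eqxx in uv.
    rewrite big1 //; have [+ _] := XF t.
    move=> /dhomog_coeffP; apply; apply/eqP => bdeg.
    move: tb; rewrite /top; case: pickP => // h _.
    suff b0 : b = 0%MM by rewrite b0 mdeg0 in bdeg.
    apply/mnmP => u; rewrite mnm0E.
    by have := h u; rewrite inE => /negbFE/eqP.
  rewrite -sumrB; apply: eq_bigr => v _; apply/mpolyP => b.
  rewrite mcoeffB !PE; case: ifP => _; last by rewrite subr0.
  by rewrite -{1}(contr_homotopy v F) famDE mcoeffD addrC addKr.
have PX v i H t : Xfam i a.+1 H -> P v (H t) \is (a.+1).-homog.
  move=> XH; apply/dhomog_coeffP => b hb; rewrite PE.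
  by have [/dhomog_coeffP -> // _] := XH t; rewrite if_same.
have P0 v : P v 0 = 0 by apply/mpolyP => b; rewrite PE !mcoeff0 if_same.
exists W; split.
  case: j XF {IF} => [|j] XF /=.
    apply: famP => t; rewrite ffunE fam0E big1 // => v _.
    by rewrite (contr_X0 v XF) fam0E P0.
  move=> t; rewrite ffunE; split.
    by apply: rpred_sum => v _; apply: PX; apply: contr_X.
  move=> tj; rewrite big1 // => v _.
  by have [_ ->] := contr_X v XF t; rewrite ?P0.
split.
  apply: (subspB (subsp_Xfam j a.+1)) => //.
  case: j XF {IF} => [|j] XF.
    suff -> : W = 0 by rewrite (dl_0 fdlP); exact: (subsp0 (subsp_Xfam _ _)).
    apply: famP => t; rewrite ffunE fam0E big1 // => v _.
    by rewrite (contr_X0 v XF) fam0E P0.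
  apply: fdl_X => t; rewrite ffunE; split.
    by apply: rpred_sum => v _; apply: PX; apply: contr_X.
  move=> tj; rewrite big1 // => v _.
  by have [_ ->] := contr_X v XF t; rewrite ?P0.
move=> t b hb; rewrite famDE famNE FE raddf_sum big1 //= => v _.
rewrite PE /top; case: pickP => [u ub|]; last by [].
case: eqP => // -[<-]; rewrite ffunE; case: ifP => // _; first exact: mcoeff0.
rewrite mcoeffZ IF ?mulr0 // setUCA (_ : u |: _ = msup b :|: t) //.
by apply/setUidPr; rewrite sub1set inE ub.
Qed.

End Families.

(** * Regularity on face rings of stars *)

Section FiniteDimension.
Variable K : fieldType.

Lemma has_rd_finmap (V : lmodType K) (X U : V -> Prop) (T : finType)
    (phi : T -> V -> K) :
  subsp X -> subsp U -> (forall v, U v -> X v) ->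
  (forall t (a : K) u v, phi t (a *: u + v) = a * phi t u + phi t v) ->
  (forall v, X v -> (forall t, phi t v = 0) -> U v) ->
  exists r, has_rd X U r.
Proof.
move=> sX sU UX phiP inj.
have phi0 t : phi t 0 = 0.
  by have := phiP t (-1) 0 0; rewrite scaler0 addr0 mulN1r addNr.
suff [r _ h] : exists2 r, (r <= #|T|)%N & has_rd X U r by exists r.
apply: has_rd_bound => // m v Xv iv.
pose M : 'M[K]_(m, #|T|) := \matrix_(i, j) phi (enum_val j) (v i).
suff : row_free M by rewrite -row_leq_rank => /leq_trans; apply; exact: rank_leq_col.
rewrite -kermx_eq0; apply/rowV0P => u /sub_kermxP uM.
apply/rowP => i; rewrite mxE; apply: (iv (fun i => u 0 i)).
apply: inj; first by apply: (subsp_sum _ sX) => j _; apply: subspZ.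
move=> t; have := congr1 (fun A : 'rV_#|T| => A 0 (enum_rank t)) uM.
rewrite !mxE => <-.
have -> : phi t (\sum_j u 0 j *: v j) = \sum_j u 0 j * phi t (v j).
  by elim/big_rec2: _ => // j y x _ <-; rewrite phiP.
by apply: eq_bigr => j _; rewrite mxE enum_rankK.
Qed.

Variable n : nat.

Lemma has_rd_monomials a (Q : pred 'X_{1..n}) :
  has_rd (@Hpiece K n a)
    (fun f => Hpiece a f /\ forall b, Q b -> f@_b = 0)
    #|[set b : 'X_{1..n < a.+1} | (mdeg b == a) && Q b]|.
Proof.
set B := [set _ | _].
pose ev (i : 'I_#|B|) : 'X_{1..n} := bmnm (enum_val i).
pose bas (i : 'I_#|B|) : {mpoly K[n]} := 'X_[ev i].
have basE (c : 'I_#|B| -> K) i : (\sum_j c j *: bas j)@_(ev i) = c i.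
  rewrite raddf_sum (bigD1 i) //= mcoeffZ mcoeffX eqxx mulr1 big1 ?addr0 // => j ji.
  rewrite mcoeffZ mcoeffX; case: eqP => [/val_inj/enum_val_inj h|];
    last by rewrite mulr0.
  by rewrite h eqxx in ji.
have basB i : (mdeg (ev i) == a) && Q (ev i).
  by have := enum_valP i; rewrite inE.
exists bas; split.
- by move=> i; rewrite /Hpiece dhomogX; have /andP[] := basB i.
- by move=> c [_ hc] i; rewrite -(basE c) hc //; have /andP[] := basB i.
- move=> f hf; exists (fun i => f@_(ev i)); split.
    apply: rpredB => //; apply: rpred_sum => i _; apply: rpredZ.
    by rewrite dhomogX; have /andP[] := basB i.
  move=> b Qb; rewrite mcoeffB.
  case: (eqVneq (mdeg b) a) => ba; last first.
    rewrite (dhomog_nemf_coeff hf ba) raddf_sum big1 ?subr0 //= => i _.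
    rewrite mcoeffZ mcoeffX; case: eqP => [h|]; last by rewrite mulr0.
    by move: ba; rewrite -h; have /andP[-> _] := basB i.
  have bB : BMultinom (eq_leq (congr1 succn ba) : (mdeg b < a.+1)%N) \in B.
    by rewrite inE /= ba eqxx.
  have -> : b = ev (enum_rank_in bB (BMultinom (eq_leq (congr1 succn ba)))).
    by rewrite /ev enum_rankK_in.
  by rewrite (basE (fun i => f@_(ev i))) subrr.
Qed.

Lemma homog_fin a (s : {set 'I_n}) (G : {set {set 'I_n}}) :
  has_rd (@Hpiece K n a) (SRIh G s a)
    #|[set b : 'X_{1..n < a.+1} | (mdeg b == a) && (msup b :|: s \in G)]|.
Proof. exact: (has_rd_monomials a (fun b => msup b :|: s \in G)). Qed.

End FiniteDimension.

(** * Links of faces *)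

Section Links.
Variable n : nat.
Implicit Types (G : {set {set 'I_n}}) (s t : {set 'I_n}).

Definition closed_complex G : Prop :=
  finset.set0 \in G /\ forall s t, s \in G -> t \subset s -> t \in G.

Lemma in_link G s t : closed_complex G ->
  (t \in link G s) = (s :|: t \in G) && [disjoint s & t].
Proof.
move=> [_ Gs]; rewrite inE; case: (boolP (s :|: t \in G)) => //= h;
  last by rewrite andbF.
by rewrite (Gs _ _ h) // finset.subsetUr.
Qed.

Lemma link0 G : closed_complex G -> link G finset.set0 = G.
Proof.
by move=> cG; apply/setP => t; rewrite in_link // finset.set0U -setI_eq0 set0I eqxx
  andbT.
Qed.

Lemma closed_link G s : closed_complex G -> s \in G -> closed_complex (link G s).
Proof.
move=> cG sG; split.
  by rewrite in_link // finset.setU0 sG -setI_eq0 setI0 eqxx.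
move=> t u; rewrite !in_link // => /andP[st dst] ut; apply/andP; split.
  by apply: cG.2 st _; apply: setUS.
by apply: disjointWr dst.
Qed.

Lemma link_link G s t : closed_complex G -> s \in G -> t \in link G s ->
  link (link G s) t = link G (s :|: t).
Proof.
move=> cG sG tL; have cL := closed_link cG sG.
have dst : [disjoint s & t] by move: tL; rewrite in_link // => /andP[].
apply/setP => u; rewrite !in_link // finset.setUA -andbA; congr (_ && _).
by rewrite -!setI_eq0 setIUr setIUl !setU_eq0 (eqP (_ : s :&: t == finset.set0))
  ?setI_eq0 // eqxx.
Qed.

Lemma card_link G s t : closed_complex G -> t \in link G s ->
  #|s :|: t| = (#|s| + #|t|)%N.
Proof.
by move=> cG; rewrite in_link // => /andP[_ ?]; apply/eqP;
  rewrite (leq_card_setU s t).2.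
Qed.

End Links.

Section Star.
Variables (K : fieldType) (n : nat).
Implicit Types (b : 'X_{1..n}) (f h : {mpoly K[n]}) (s t : {set 'I_n}) (v : 'I_n).
Variable G : {set {set 'I_n}}.
Hypothesis cG : closed_complex G.
Let Gsub : forall s t, s \in G -> t \subset s -> t \in G := cG.2.

(* The face ring of the star of s is a polynomial ring, in the variables of s,
   over the face ring of the link. *)
Lemma hilb_star_link s (D E : nat -> nat) : s \in G ->
  (forall a, has_rd (@Hpiece K n a) (SRIh G s a) (D a)) ->
  (forall a, has_rd (@Hpiece K n a) (SRIh (link G s) finset.set0 a) (E a)) ->
  D =1 iter #|s| psum E.
Proof.
move=> sG hD hE.
(* The variables of s form a regular sequence on the ring of the star, with quotient the ring of the
   link, so [hilb_of_reg] applies to them. *)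
pose sv (r : nat) : {mpoly K[n]} :=
  if insub r is Some i then 'X_(enum_val (i : 'I_#|s|)) else 0.
pose thx (r : nat) (f : {mpoly K[n]}) := sv r * f.
pose free (r : nat) b := [forall i : 'I_#|s|, (i < r)%N ==> (b (enum_val i) == 0%N)].
pose Js := gensub (@Hpiece K n) (SRIh G s) thx.
have thxP r (x : K) f h : thx r (x *: f + h) = x *: thx r f + thx r h.
  by rewrite /thx mulrDr scalerAr.
have svE r (rs : (r < #|s|)%N) : sv r = 'X_(enum_val (Ordinal rs)).
  by rewrite /sv insubT.
have thxX r a f : Hpiece a f -> Hpiece a.+1 (thx r f).
  rewrite /thx /sv; case: insubP => [i _ _|_] hf; last by rewrite mul0r;
    apply: rpred0.
  exact: XU_mul_homog.
have thxI r a f : SRIh G s a f -> SRIh G s a.+1 (thx r f).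
  move=> [h1 h2]; split; first exact: thxX.
  rewrite /thx /sv; case: insubP => [i _ _|_]; last by rewrite mul0r; apply: SRI_0.
  exact: SRI_XU.
have thxC r k f : thx r (thx k f) = thx k (thx r f) by rewrite /thx mulrCA.
have freeS r (rs : (r < #|s|)%N) b :
    free r.+1 b = free r b && (b (enum_val (Ordinal rs)) == 0%N).
  apply/forallP/andP => [h|[/forallP h1 h2] i].
    split; last by have := h (Ordinal rs); rewrite ltnSn.
    by apply/forallP => i; apply/implyP => ir; have /implyP := h i; apply;
      apply: leqW.
  apply/implyP; rewrite ltnS leq_eqVlt => /orP[/eqP ir|ir];
    last by have /implyP := h1 i; apply.
  by rewrite (_ : i = Ordinal rs) //; apply: val_inj.
have JsP r a f : (r <= #|s|)%N -> Js r a f <->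
    (Hpiece a f /\ forall b, msup b :|: s \in G -> free r b -> f@_b = 0).
  elim: r f => [|r IH] f rs.
    split=> [[h1 h2]|[h1 h2]]; split=> // b bG; [by move=> _; apply: h2|].
    by apply: h2 => //; apply/forallP.
  have {}IH f' := IH f' (ltnW rs).
  split=> [[u [w [/IH[h1 h2] pw ->]]]|[h1 h2]].
    split.
      apply: rpredD => //; have := th_prev (@subsp_homog K n) thxP thxX r pw; exact.
    move=> b bG; rewrite (freeS _ rs) => /andP[fb b0].
    by rewrite mcoeffD h2 // /thx (svE _ rs) mcoeffXM b0 addr0.
  pose v := enum_val (Ordinal rs).
  case: a h1 h2 IH => [|a] h1 h2 IH.
    exists f, 0; split=> //; last by rewrite (th_0 thxP) addr0.
    apply/IH.
    split=> // b bG fb; case: (eqVneq (mdeg b) 0%N) => b0;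
      last exact: (dhomog_nemf_coeff h1).
    apply: h2 => //; rewrite (freeS _ rs) fb /=.
    by move/eqP: b0; rewrite mdeg_eq0 => /eqP ->; rewrite mnm0E.
  (* [w] is the part of f divisible by x_v, divided by x_v; the monomials left in f - x_v w are free
     of x_v. *)
  pose w : {mpoly K[n]} := \sum_(b <- msupp f | b v != 0%N) f@_b *: 'X_[b - U_(v)].
  have wE b : (w)@_b = f@_(U_(v) + b).
    rewrite raddf_sum /=; under eq_bigr do rewrite mcoeffZ mcoeffX.
    have key (m : 'X_{1..n}) : m v != 0%N -> ((m - U_(v))%MM == b) =
      (m == (U_(v) + b)%MM).
      move=> mv; apply/eqP/eqP => [<-|->]; apply/mnmP => x;
        rewrite !(mnmDE,mnmBE,mnm1E).
        by case: eqVneq => [<-|_] /=; rewrite ?subn0 // subnKC // lt0n.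
      by rewrite addKn.
    under eq_bigr => m mv do rewrite key //.
    case: (boolP ((U_(v) + b)%MM \in msupp f)) => bf; last first.
      rewrite big1_seq => [|m /andP[_ mf]].
        by move: bf; rewrite -mcoeff_eq0 => /eqP ->.
      by case: eqP => [mb|_]; rewrite ?mulr0 //; move: bf; rewrite -mb mf.
    rewrite big_mkcond (bigD1_seq (U_(v) + b)%MM) ?msupp_uniq //= eqxx mulr1.
    rewrite mnmDE mnm1E eqxx /= big1_seq ?addr0 // => m /andP[mb _].
    by rewrite (negPf mb) mulr0 if_same.
  have wh : Hpiece a w.
    apply/dhomog_coeffP => b hb; rewrite wE (dhomog_nemf_coeff h1) //=.
    by rewrite mdegD mdeg1 add1n eqSS.
  exists (f - thx r w), w; split=> //=; last by rewrite subrK.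
  apply/IH.
  split; first by apply: rpredB => //; apply: thxX.
  move=> b bG fb; rewrite mcoeffB /thx (svE _ rs) mcoeffXM -/v.
  case: eqP => bv; first by rewrite subr0; apply: h2 => //;
    rewrite (freeS _ rs) fb; apply/eqP.
  by rewrite wE addUBm ?subrr //; apply/eqP.
have sJs : forall a, subsp (@SRIh K n G s a) by move=> a; apply: subsp_SRIh.
have IX : forall a (f : {mpoly K[n]}), SRIh G s a f -> Hpiece a f by move=> a f [].
have [Dx hDx] := hilb_exists (@subsp_homog K n) sJs IX thxP thxX
   (fun a => ex_intro _ _ (hD a)).
(* Multiplying a monomial by a variable of s changes neither [msup b :|: s] nor its freeness in the
   earlier variables. *)
have reg r a f : (r < #|s|)%N -> thker (@Hpiece K n) (SRIh G s) thx r a f -> Js r a f.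
  move=> rs [hf /(JsP _ _ _ (ltnW rs))[_ h2]]; apply/(JsP _ _ _ (ltnW rs));
    split=> // b bG fb.
  pose v := enum_val (Ordinal rs).
  have := h2 (U_(v) + b)%MM; rewrite /thx (svE _ rs) mcoeffXM mnmDE mnm1E eqxx /=.
  have -> : (U_(v) + b - U_(v))%MM = b by apply/mnmP => x; rewrite mnmBE mnmDE addKn.
  apply.
    rewrite (_ : msup _ = v |: msup b); last first.
      by apply/setP => x; rewrite !inE mnmDE mnm1E addn_eq0 negb_and eqb0 negbK [v
        == x]eq_sym.
    rewrite -finset.setUA setUCA (_ : v |: s = s) //.
    by apply/setUidPr; rewrite sub1set enum_valP.
  apply/forallP => i; apply/implyP => ir; rewrite mnmDE mnm1E addn_eq0.
  have /forallP/(_ i)/implyP-> // := fb; rewrite andbT eqb0.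
  apply/eqP => /enum_val_inj iE; by rewrite -iE ltnn in ir.
have DxD : Dx 0%N =1 D.
  by move=> a; apply: (has_rd_uniq (sJs a)) (hDx 0%N a) (hD a).
have DxE : Dx #|s| =1 E.
  move=> a; apply: (has_rd_uniq (subsp_SRIh K (link G s) finset.set0 a) _ (hE a)).
  apply: eq_has_rd (hDx #|s| a) => // f; rewrite -/(Js #|s| a f) JsP //.
  have key b : (msup b :|: finset.set0 \in link G s) =
    (msup b :|: s \in G) && free #|s| b.
    rewrite finset.setU0 in_link // finset.setUC; congr (_ && _).
    apply/idP/forallP => [dj i|fb].
      apply/implyP => _; have := disjointFr dj (enum_valP i).
      by rewrite inE => /negbFE.
    rewrite disjoint_subset; apply/fintype.subsetP => x xs; rewrite !inE negbK.
    have /implyP := fb (enum_rank_in xs x).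
    by rewrite ltn_ord enum_rankK_in //; apply.
  split=> -[h1 h2]; split=> // b; first by rewrite key => /andP[]; apply: h2.
  by move=> b1 b2; apply: h2; rewrite key b1 b2.
move=> a; rewrite -DxD -(eq_iter_psum _ DxE).
exact: (hilb_of_reg (@subsp_homog K n) sJs IX thxP thxX thxI thxC (fun a =>
  ex_intro _ _ (hD a)) hDx reg).
Qed.

End Star.

(** * Linear systems of parameters adapted to a face *)

Section AdaptedForms.
Variables (K : fieldType) (n : nat).
Implicit Types (s t : {set 'I_n}) (v w : 'I_n) (c : nat -> 'I_n -> K).

(** The zero set of the Stanley-Reisner ideal is the union of the coordinate subspaces of the faces;
    the forms are to meet its K-points only at the origin. In this form the condition passes to
    links by linear algebra. *)
Definition no_common_zero (G : {set {set 'I_n}}) (e : nat) c : Prop :=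
  forall x : 'I_n -> K, [set v | x v != 0] \in G ->
    (forall r, (r < e)%N -> \sum_v c r v * x v = 0) -> forall v, x v = 0.

(** Restricted to the coordinates of s, the forms give a matrix [T] of full column rank. Its left
    kernel supplies e - #|s| combinations without variables of s, and a left inverse supplies
    combinations dual to the variables of s. *)
Lemma adapted_forms (G : {set {set 'I_n}}) s e c :
  closed_complex G -> s \in G -> no_common_zero G e c ->
  exists c' : nat -> 'I_n -> K,
  [/\ (#|s| <= e)%N,
      forall r v, v \in s -> c' r v = 0,
      forall r, exists B : 'I_e -> K, forall v, c' r v = \sum_l B l * c l v,
      forall v, v \in s -> exists B : 'I_e -> K,
        forall w, w \in s -> \sum_l B l * c l w = (v == w)%:R
    & no_common_zero (link G s) (e - #|s|) c'].
Proof.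
move=> cG sG nz.
pose ev (i : 'I_#|s|) : 'I_n := enum_val i.
pose T : 'M[K]_(e, #|s|) := \matrix_(l, i) c l (ev i).
pose xs (u : 'rV[K]_#|s|) v : K := \sum_i u 0 i * (v == ev i)%:R.
have xsE u l : \sum_v c l v * xs u v = \sum_i u 0 i * c l (ev i).
  under eq_bigr do rewrite mulr_sumr.
  rewrite exchange_big; apply: eq_bigr => i _ /=.
  rewrite (bigD1 (ev i)) //= eqxx mulr1 mulrC big1 ?addr0 // => v vi.
  by rewrite (negPf vi) !mulr0.
have xs_ev u i : xs u (ev i) = u 0 i.
  rewrite /xs (bigD1 i) //= eqxx mulr1 big1 ?addr0 // => j ji.
  by rewrite (inj_eq enum_val_inj) eq_sym (negPf ji) mulr0.
have xs_out u v : v \notin s -> xs u v = 0.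
  move=> vs; rewrite /xs big1 // => i _; case: eqP => [vi|]; last by rewrite mulr0.
  by rewrite vi enum_valP in vs.
(* A relation between the columns of [T] is a common zero [xs u] supported on s. *)
have fT : row_free T^T.
  rewrite -kermx_eq0; apply/rowV0P => u /sub_kermxP uT; apply/rowP => i.
  rewrite mxE -xs_ev; apply: nz.
    apply: cG.2 sG _; apply/fintype.subsetP => v; rewrite inE.
    by apply: contraR => /xs_out ->.
  move=> r re; rewrite xsE; have := congr1 (fun A : 'rV_e => A 0 (Ordinal re)) uT.
  by rewrite !mxE => h; rewrite -[RHS]h; apply: eq_bigr => j _; rewrite !mxE.
have rT : \rank T = #|s| by rewrite -mxrank_tr; apply/eqP.
have se : (#|s| <= e)%N by rewrite -{1}rT; exact: rank_leq_row.
pose N := kermx T; pose B0 := row_base N.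
have rN : \rank N = (e - #|s|)%N by rewrite mxrank_ker rT.
have NT : B0 *m T = 0 by apply/sub_kermxP; rewrite eq_row_base.
pose c' (r : nat) v : K :=
  if insub r is Some i then \sum_l B0 (i : 'I_(\rank N)) l * c l v else 0.
exists c'; split=> //.
- move=> r v vs; rewrite /c'; case: insubP => // i _ _.
  have := congr1 (fun A : 'M_(_, _) => A i (enum_rank_in vs v)) NT.
  rewrite !mxE => h; rewrite -[RHS]h; apply: eq_bigr => l _.
  by rewrite !mxE /ev enum_rankK_in.
- move=> r; rewrite /c'; case: insubP => [i _ _|_]; first by exists (fun l => B0 i l).
  by exists (fun=> 0) => v; rewrite big1 // => l _; rewrite mul0r.
- move=> v vs; have /row_freeP[L TL] := fT.
  exists (fun l => L l (enum_rank_in vs v)) => w ws.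
  have := congr1 (fun A : 'M_(_, _) => A (enum_rank_in vs w) (enum_rank_in vs v)) TL.
  rewrite !mxE; under eq_bigr do rewrite !mxE /ev enum_rankK_in // mulrC.
  move=> ->; congr (_%:R); rewrite eq_sym -(inj_eq enum_val_inj).
  by rewrite !enum_rankK_in.
move=> x xL hx v.
have dsx : [disjoint s & [set v | x v != 0]] by move: xL;
  rewrite in_link // => /andP[].
(* [Y] lists the values of the forms at x. As the left kernel of [T] kills it, it lies in the column
   space, so it is also the list of values at some [xs u]. Then x - xs u is a common zero supported
   on the union of s with the support of x, which is a face. *)
pose Y : 'rV[K]_e := \row_l \sum_v c l v * x v.
have BY : B0 *m Y^T = 0.
  apply/matrixP => i j; rewrite ord1 !mxE.
  have := hx i; rewrite -rN ltn_ord /c' => /(_ isT).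
  case: insubP => [i' _ /val_inj -> h|]; last by rewrite ltn_ord.
  rewrite -[RHS]h; under [RHS]eq_bigr do rewrite mulr_suml.
  rewrite exchange_big; apply: eq_bigr => l _; rewrite !mxE mulr_sumr.
  by apply: eq_bigr => w _; rewrite mulrA.
have NY : N *m Y^T = 0.
  have /submxP[A ->] : (N <= B0)%MS by rewrite eq_row_base.
  by rewrite -mulmxA BY mulmx0.
have /submxP[u Yu] : (Y <= T^T)%MS.
  rewrite submxE; have /submxP[A hA] : ((cokermx T^T)^T <= N)%MS.
    apply/sub_kermxP; apply: trmx_inj.
    by rewrite trmx_mul trmxK mulmx_coker trmx0.
  rewrite -[cokermx _]trmxK hA trmx_mul -[Y]trmxK mulmxA -trmx_mul NY.
  by rewrite trmx0 mul0mx.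
have x0 : forall w, x w - xs u w = 0.
  apply: nz => [|r re].
    have : s :|: [set v | x v != 0] \in G by move: xL; rewrite in_link // => /andP[].
    move/cG.2; apply; apply/fintype.subsetP => w; rewrite !inE.
    case: (boolP (w \in s)) => //= ws; rewrite xs_out // subr0 //.
  under eq_bigr do rewrite mulrBr.
  rewrite sumrB xsE; apply/eqP; rewrite subr_eq0; apply/eqP.
  have := congr1 (fun A : 'rV_e => A 0 (Ordinal re)) Yu.
  by rewrite !mxE => ->; apply: eq_bigr => i _; rewrite !mxE.
case: (boolP (v \in s)) => vs.
  by have := disjointFr dsx vs; rewrite inE => /negbFE/eqP.
by have := x0 v; rewrite xs_out // subr0.
Qed.

End AdaptedForms.

(** * Comparison of the quotients of the star and of the link *)

Section StarRegular.
Variables (K : fieldType) (n : nat).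
Implicit Types (b : 'X_{1..n}) (f h : {mpoly K[n]}) (s t : {set 'I_n}) (v w : 'I_n).
Variable G : {set {set 'I_n}}.
Hypothesis cG : closed_complex G.
Let Gsub : forall s t, s \in G -> t \subset s -> t \in G := cG.2.
Variables (s : {set 'I_n}) (e : nat) (c c' : nat -> 'I_n -> K).
Hypothesis sG : s \in G.
Hypothesis c's : forall r v, v \in s -> c' r v = 0.
Hypothesis c'c : forall r, exists B : 'I_e -> K, forall v, c' r v =
  \sum_l B l * c l v.
Hypothesis cs : forall v, v \in s -> exists B : 'I_e -> K,
  forall w, w \in s -> \sum_l B l * c l w = (v == w)%:R.

Let L := link G s.
Let cL : closed_complex L. Proof. exact: closed_link. Qed.

(** Choosing the representative with support in the link embeds the ring of the link, as a vector
    space, into polynomials, and from there it is mapped to the ring of the star. *)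
Definition ltrunc f : {mpoly K[n]} :=
  \sum_(b <- msupp f | msup b \in L) f@_b *: 'X_[b].

Lemma ltruncE f b : (ltrunc f)@_b = if msup b \in L then f@_b else 0.
Proof. exact: (mcoeff_filter (fun b => msup b \in L)). Qed.

Lemma ltruncP (x : K) f h : ltrunc (x *: f + h) = x *: ltrunc f + ltrunc h.
Proof.
apply/mpolyP => b; rewrite mcoeffD mcoeffZ !ltruncE mcoeffD mcoeffZ.
by case: ifP => // _; rewrite mulr0 addr0.
Qed.

Lemma ltrunc_D f h : ltrunc (f + h) = ltrunc f + ltrunc h.
Proof. by rewrite -[f]scale1r ltruncP !scale1r. Qed.

Lemma ltrunc0 : ltrunc 0 = 0.
Proof. by apply/mpolyP => b; rewrite ltruncE mcoeff0 if_same. Qed.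

Lemma ltrunc_homog a f : Hpiece a f -> Hpiece a (ltrunc f).
Proof.
move=> hf; apply/dhomog_coeffP => b hb; rewrite ltruncE.
by rewrite (dhomog_nemf_coeff hf hb) if_same.
Qed.

Local Notation J := (Jst G c s e).

Lemma Jst_lmul l a f : (l < e)%N -> Hpiece a f -> J a.+1 (lmul c l f).
Proof.
move=> le hf; apply: (gensub_le (@subsp_homog K n) (lmulP c) le).
exact: (th_gensubS (@subsp_homog K n) (subsp_SRIh K G s) (lmulP c)).
Qed.

Lemma Jst_comb (B : 'I_e -> K) a f : Hpiece a f ->
  J a.+1 (linform (fun v => \sum_l B l * c l v) * f).
Proof.
move=> hf; have -> : linform (fun v => \sum_l B l * c l v) * f
    = \sum_l B l *: lmul c l f.
  rewrite /linform mulr_suml.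
  under eq_bigr do rewrite scaler_suml mulr_suml.
  rewrite exchange_big; apply: eq_bigr => l _ /=.
  rewrite /lmul /linform mulr_suml scaler_sumr; apply: eq_bigr => v _.
  by rewrite -!scalerAl scalerA.
apply: (@subsp_sum K {mpoly K[n]} (J a.+1)) => [|l _]; first exact: subsp_Jst.
apply: (@subspZ K {mpoly K[n]} (J a.+1)); first exact: subsp_Jst.
exact: Jst_lmul.
Qed.

Lemma Jst_lmul' r a f : Hpiece a f -> J a.+1 (lmul c' r f).
Proof.
move=> hf; have [B hB] := c'c r.
rewrite /lmul (_ : linform _ = linform (fun v => \sum_l B l * c l v)).
  exact: Jst_comb.
by apply: eq_bigr => v _; rewrite hB.
Qed.

(** Truncation commutes with [c' r] modulo the ideal of the star: [c' r] has no variable in s, and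
    dividing by a variable outside s does not change whether a monomial meets s. *)
Lemma ltrunc_lmul' r a f : Hpiece a f -> J a.+1 (ltrunc (lmul c' r f)).
Proof.
move=> hf; rewrite -(subrK (lmul c' r (ltrunc f)) (ltrunc _)).
apply: (subspD (subsp_Jst G c s e a.+1)); last first.
  by apply: Jst_lmul'; apply: ltrunc_homog.
apply: (gensub_I (@subsp_homog K n) (lmulP c)); split.
  by apply: rpredB; [apply/ltrunc_homog/lmulX|apply/lmulX/ltrunc_homog].
move=> b bG; rewrite mcoeffB ltruncE /lmul /linform !mulr_suml !raddf_sum /=.
have -> : (if msup b \in L then \sum_v (c' r v *: 'X_v * f)@_b else 0)
   = \sum_v (if msup b \in L then (c' r v *: 'X_v * f)@_b else 0).
  by case: ifP => // _; rewrite big1.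
rewrite -big_split /= big1 // => v _; rewrite -!scalerAl !mcoeffZ !mcoeffXM.
case: (boolP (v \in s)) => vs; first by rewrite c's // !mul0r if_same subrr.
case: (eqVneq (b v) 0%N) => bv; first by rewrite mulr0 if_same subrr.
rewrite ltruncE (_ : (msup (b - U_(v))%MM \in L) = (msup b \in L)).
  by case: ifP => _; rewrite ?mulr0 subrr.
rewrite !in_link // !(finset.setUC s) bG.
have -> : msup (b - U_(v))%MM :|: s \in G.
  by apply: Gsub bG _; apply: setSU; apply: msup_sub.
rewrite /= !disjoint_subset; apply/fintype.subsetP/fintype.subsetP => h x xs.
  have := h x xs; rewrite !inE mnmBE mnm1E.
  by case: (eqVneq v x) => [vx|_]; [rewrite vx xs in vs|rewrite subn0].
by have := h x xs; rewrite !inE !negbK mnmBE => /eqP ->.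
Qed.

Lemma ltrunc_Jst r a f : Jst L c' finset.set0 r a f -> J a (ltrunc f).
Proof.
elim: r f => [|r IH] f /=.
  move=> [h1 h2]; rewrite (_ : ltrunc f = 0); first exact: (subsp0 (subsp_Jst G c s
    e a)).
  apply/mpolyP => b; rewrite ltruncE mcoeff0; case: ifP => // bL.
  by apply: h2; rewrite finset.setU0.
move=> [u [w [/IH Ju pw ->]]]; rewrite ltrunc_D.
apply: (subspD (subsp_Jst G c s e a)) => //.
case: a pw {IH Ju} => [|a] /= pw; last exact: ltrunc_lmul'.
rewrite pw /lmul mulr0 ltrunc0; exact: (subsp0 (subsp_Jst G c s e 0)).
Qed.

Definition has_trunc a h : Prop := exists2 f, Hpiece a f & J a (h - ltrunc f).

Lemma has_truncP a (x : K) f h : has_trunc a f -> has_trunc a h ->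
  has_trunc a (x *: f + h).
Proof.
move=> [f' f1 f2] [h' h1 h2]; exists (x *: f' + h').
  exact: (subspP x (subsp_homog K n a)).
rewrite ltruncP opprD addrACA -scalerBr.
exact: (subspP x (subsp_Jst G c s e a)).
Qed.

Lemma subsp_has_trunc a : subsp (has_trunc a).
Proof.
split=> [|x f h]; last exact: has_truncP.
exists 0; first exact: (subsp0 (subsp_homog K n a)).
by rewrite ltrunc0 subrr; exact: (subsp0 (subsp_Jst G c s e a)).
Qed.

Lemma has_trunc_J a f : J a f -> has_trunc a f.
Proof.
move=> h; exists 0; first exact: (subsp0 (subsp_homog K n a)).
by rewrite ltrunc0 subr0.
Qed.

(** Induction on the degree in the variables of s: modulo the forms, the combination dual to v
    trades one factor x_v for variables outside s. *)
Lemma has_trunc_mon N b : (\sum_(v in s) b v <= N)%N -> has_trunc (mdeg b) 'X_[b].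
Proof.
elim: N b => [|N IH] b bN.
  have bs v : v \in s -> b v = 0%N.
    by move=> vs; apply/eqP; move: bN; rewrite leqn0 sum_nat_eq0 =>
      /forallP/(_ v)/implyP; apply.
  case: (boolP (msup b :|: s \in G)) => bG; last first.
    apply: has_trunc_J; apply: (gensub_I (@subsp_homog K n) (lmulP c)); split.
      by rewrite /Hpiece dhomogX.
    by move=> m; rewrite mcoeffX; case: eqP => // <-; rewrite (negPf bG).
  exists 'X_[b]; first by rewrite /Hpiece dhomogX.
  rewrite (_ : ltrunc _ = 'X_[b]); first by rewrite subrr;
    exact: (subsp0 (subsp_Jst G c s e _)).
  apply/mpolyP => m; rewrite ltruncE mcoeffX; case: eqP => [<-|];
    last by rewrite if_same.
  rewrite in_link // finset.setUC bG disjoint_subset.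
  by case: fintype.subsetP => // -[] x xs; rewrite !inE bs.
case: (leqP (\sum_(v in s) b v) N) => [/IH //|bN'].
have [v vs bv] : exists2 v, v \in s & b v != 0%N.
  apply/exists_inP; apply: contraTT bN' => /exists_inPn h.
  rewrite -leqNgt big1 // => v vs; apply/eqP.
  by have := h v vs; rewrite negbK.
have [B hB] := cs vs.
pose b' := (b - U_(v))%MM.
have bE : b = (U_(v) + b')%MM by rewrite addUBm.
have dE : mdeg b = (mdeg b').+1 by rewrite {1}bE mdegD mdeg1.
pose y v := \sum_l B l * c l v.
have -> : 'X_[b] = linform y * 'X_[b'] - \sum_(w | w \notin s) y w *: 'X_[U_(w) + b'].
  rewrite /linform mulr_suml (bigID (fun w => w \in s)) /=.
  rewrite (bigD1 v) //= {1}/y hB // eqxx scale1r -mpolyXD -bE big1 ?addr0; last first.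
    by move=> w /andP[ws wv]; rewrite /y hB // eq_sym (negPf wv) scale0r mul0r.
  under [X in _ + X - _]eq_bigr do rewrite -scalerAl -mpolyXD.
  by rewrite addrK.
have sT := subsp_has_trunc (mdeg b).
apply: (subspB sT).
  by rewrite dE; apply/has_trunc_J/Jst_comb; rewrite /Hpiece dhomogX.
apply: (subsp_sum _ sT) => w ws; apply: (subspZ _ sT).
have -> : mdeg b = mdeg (U_(w) + b')%MM by rewrite dE mdegD mdeg1.
apply: IH; rewrite -ltnS; apply: leq_trans bN.
rewrite (bigD1 v) //= [X in (_ < X)%N](bigD1 v) //= bE !mnmDE !mnm1E eqxx add1n.
rewrite (_ : (w == v) = false); last by apply: contraNF ws => /eqP ->.
rewrite add0n addSn ltnS leq_add2l; apply: leq_sum => x /andP[xs xv].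
rewrite !mnmDE !mnm1E (_ : (w == x) = false) ?leq_addl //.
by apply: contraNF ws => /eqP ->.
Qed.

Lemma has_trunc_all a h : Hpiece a h -> has_trunc a h.
Proof.
move=> hh; rewrite [h]mpolyE big_seq.
apply: (subsp_sum _ (subsp_has_trunc a)) => b bh;
  apply: (subspZ _ (subsp_has_trunc a)).
have -> : a = mdeg b by apply/esym; apply: (dhomogP _ _ _ hh).
exact: has_trunc_mon (leqnn _).
Qed.

(** Truncation maps the quotient for the link onto the quotient for the star; the resulting
    inequality is the input that [reg_of_hilb] asks for. *)
Lemma star_hilb_le r a x : has_rd (@Hpiece K n a) (Jst L c' finset.set0 r a) x ->
  exists2 y, (y <= x)%N & has_rd (@Hpiece K n a) (J a) y.
Proof.
apply: (@has_rd_corr_le K _ _ (fun f h => J a (h - ltrunc f))).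
- by rewrite ltrunc0 subrr; exact: (subsp0 (subsp_Jst G c s e a)).
- move=> y u v u' v' h1 h2; rewrite ltruncP opprD addrACA -scalerBr.
  exact: (subspP y (subsp_Jst G c s e a)).
- exact: subsp_homog.
- exact: subsp_Jst.
- exact: subsp_Jst.
- by move=> f; apply: Jst_H.
- move=> f hf; exists (ltrunc f); first exact: ltrunc_homog.
  by rewrite subrr; exact: (subsp0 (subsp_Jst G c s e a)).
- by move=> h /has_trunc_all[f f1 f2]; exists f.
- move=> f h Jh /ltrunc_Jst Jf; rewrite -(subrK (ltrunc f) h).
  exact: (subspD (subsp_Jst G c s e a)).
Qed.

End StarRegular.

(** * Reisner's criterion and regularity on stars *)

Section CohenMacaulay.
Variables (K : fieldType) (n : nat).
Implicit Types (G : {set {set 'I_n}}) (s t : {set 'I_n}) (c : nat -> 'I_n -> K).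

(* The first e forms of c are a regular sequence on the face ring of the star
   of s in G. *)
Definition star_regular G c e s : Prop :=
  forall r a (f : {mpoly K[n]}), (r < e)%N ->
    thker (@Hpiece K n) (SRIh G s) (lmul c) r a f -> Jst G c s r a f.

(** In polynomial degree 0 this is the vanishing of reduced cohomology in degree j - 1, as j counts
    vertices. *)
Definition acyclic_in G j : Prop :=
  forall F : fam K n, cyc (@Xfam K n) (Ifam G) (fmul (fun _ _ =>
    0)) (@fdl K n) 0 j 0 F ->
    bnd (@Xfam K n) (Ifam G) (fmul (fun _ _ => 0)) (@fdl K n) 0 j 0 F.

Lemma SRIh_fin G s a : exists r, has_rd (@Hpiece K n a) (SRIh G s a) r.
Proof. by eexists; apply: homog_fin. Qed.

(** The Hilbert function of the star is a #|s|-fold partial sum of that of the link, itself an (e -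
    #|s|)-fold partial sum of that of its quotient by c'. The latter bounds the quotient of the star
    by c, so the e-fold chain closes for c although the forms c' are different ones. *)
Lemma star_reg_of_link G c e s : closed_complex G -> s \in G ->
  no_common_zero G e c ->
  (forall c', no_common_zero (link G s) (e - #|s|) c' ->
     star_regular (link G s) c' (e - #|s|) finset.set0) ->
  star_regular G c e s.
Proof.
move=> cG sG nz hL.
have [c' [se c's c'c cs nz']] := adapted_forms cG sG nz.
have cL := closed_link cG sG.
have [D hD] := hilb_exists (@subsp_homog K n) (subsp_SRIh K G s) (@SRIh_H K n G s)
  (lmulP c) (lmulX c) (SRIh_fin G s).
have [E hE] := hilb_exists (@subsp_homog K n) (subsp_SRIh K (link G s) finset.set0)
  (@SRIh_H K n (link G s) finset.set0) (lmulP c') (lmulX c')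
  (SRIh_fin (link G s) finset.set0).
have EE := hilb_of_reg (@subsp_homog K n) (subsp_SRIh K (link G s) finset.set0)
  (@SRIh_H K n (link G s) finset.set0) (lmulP c') (lmulX c') (@lmulI K n _ cL.2 c'
    ^~ finset.set0)
  (lmulC c') (SRIh_fin (link G s) finset.set0) hE (hL c' nz').
have DE := hilb_star_link cG sG (hD 0%N) (hE 0%N).
have DeE a : (D e a <= E (e - #|s|)%N a)%N.
  have [y yx hy] := star_hilb_le cG c's c'c cs (hE (e - #|s|)%N a).
  by rewrite (has_rd_uniq (subsp_Jst G c s e a) (hD e a) hy).
move=> r a f re.
apply: (reg_of_hilb (@subsp_homog K n) (subsp_SRIh K G s) (@SRIh_H K n G s)
  (lmulP c) (lmulX c) (@lmulI K n G cG.2 c ^~ s) (lmulC c) (SRIh_fin G s) hD _ re).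
move=> b; rewrite DE (eq_iter_psum _ EE) -iterD subnKC //.
exact: leq_iter_psum.
Qed.

Section ComplexHilb.
Variables (G : {set {set 'I_n}}) (c : nat -> 'I_n -> K) (e : nat).
Hypothesis cG : closed_complex G.
Hypothesis reg : forall s, s \in G -> s != finset.set0 -> star_regular G c e s.

Local Notation X := (@Xfam K n).
Local Notation I := (@Ifam K n G).
Local Notation th := (@fmul K n c).
Local Notation dl := (@fdl K n).

Lemma fam_fin j a (W U : fam K n -> Prop) : subsp W -> subsp U ->
  (forall F, U F -> W F) -> (forall F, W F -> X j a F) ->
  exists r, has_rd W U r.
Proof.
move=> sW sU UW WX.
pose phi (t : ({set 'I_n} * 'X_{1..n < a.+1})%type) (F : fam K n) : K := (F
  t.1)@_(t.2).
apply: (has_rd_finmap (phi := phi) sW sU UW).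
  by move=> t x F H; rewrite /phi famDE famZE mcoeffD mcoeffZ.
move=> F /WX XF h; suff -> : F = 0 by apply: subsp0.
apply: famP => s; apply/mpolyP => b; rewrite fam0E mcoeff0.
case: (eqVneq (mdeg b) a) => ba; last first.
  by have [hF _] := XF s; exact: (dhomog_nemf_coeff hF ba).
exact: (h (s, BMultinom (eq_leq (congr1 succn ba)))).
Qed.

Lemma fam_REG r j a F : (r < e)%N -> X j.+1 a F ->
  Jfam c G r j.+1 a.+1 (th r F) -> Jfam c G r j.+1 a F.
Proof.
move=> re; apply: (fam_regular cG.2 _ re) => s k b f sG s0 ke.
exact: reg.
Qed.

Lemma Xfam0_emb a f : Hpiece a f ->
  X 0 a ([ffun s => if s == finset.set0 then f else 0] : fam K n).
Proof.
move=> hf s; rewrite ffunE; case: eqVneq => [->|_]; last by split=> //; apply: rpred0.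
by split=> //; rewrite cards0.
Qed.

Lemma Jfam0_emb r a f :
  Jst G c finset.set0 r a f <->
  Jfam c G r 0 a ([ffun s => if s == finset.set0 then f else 0] : fam K n).
Proof.
rewrite JfamP; split=> [h|[_ /(_ finset.set0)]]; last by rewrite ffunE eqxx.
split; first exact: Xfam0_emb (Jst_H h).
move=> s; rewrite ffunE; case: eqVneq => [->|_] //.
exact: (subsp0 (subsp_Jst G c s r a)).
Qed.

Lemma fam_NH r j a F : cyc X I th dl r j a F -> bnd X I th dl r j a.+1 (th r F).
Proof. by apply: fam_null_homotopic; exact: cG.2. Qed.

Lemma cyc_fin j a : exists r, has_rd (cyc X I th dl 0 j a) (bnd X I th dl 0 j a) r.
Proof.
apply: (@fam_fin j a).
- apply: subsp_cyc; [exact: subsp_Xfam|exact: subsp_Ifam|exact: fmulP|exact: fdlP].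
- apply: subsp_bnd; [exact: subsp_Xfam|exact: subsp_Ifam|exact: fmulP|exact: fdlP].
- move=> F; apply: bnd_cyc; [exact: subsp_Xfam|exact: Ifam_X|exact: fmulP
    |by move=> *; apply: fmul_X|exact: fdlP|exact: fdl_X
    |by move=> *; apply: fdl_I => //; exact: cG.2|exact: fdlK|exact: fdl_fmul].
- by move=> F [].
Qed.

(** The kernel of [th r] in degree a has dimension C(r, a) h a. The binomial vanishes for a > r, and
    h a vanishes for a <= r < e. *)
Lemma face_ring_regular : (forall j, (j < e)%N -> acyclic_in G j) ->
  star_regular G c e finset.set0.
Proof.
move=> acy r a f re [hf Jf].
have [h hh] := choice (fun j => cyc_fin j 0).
have h0 j : (j < e)%N -> h j = 0%N.
  move=> je; apply: (has_rd_uniq _ (hh j)).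
    apply: subsp_bnd; [exact: subsp_Xfam|exact: subsp_Ifam|exact: fmulP|exact: fdlP].
  by apply: has_rd0 => F; apply: acy.
have IX j' a' F : I j' a' F -> X j' a' F by case.
have thX r' j' a' F : X j' a' F -> X j' a'.+1 (th r' F) by apply: fmul_X.
have thI r' j' a' F : I j' a' F -> I j' a'.+1 (th r' F) by apply: fmul_I; exact: cG.2.
have dlI j' a' F : I j' a' F -> I j'.+1 a' (dl F) by apply: fdl_I; exact: cG.2.
have NH r' j' a' F : (r' < e)%N -> cyc X I th dl r' j' a' F ->
  bnd X I th dl r' j' a'.+1 (th r' F) by move=> _; apply: fam_NH.
have REG r' j' a' F := @fam_REG r' j' a' F.
have hS j' a' F : cyc X I th dl 0 j' a'.+1 F -> bnd X I th dl 0 j' a'.+1 F.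
  exact: fam_exact_pos.
have := coh_dim (@subsp_Xfam K n) (subsp_Ifam K G) IX (fmulP c) thX thI
  (fmulC c) (@fdlP K n) (@fdl_X K n) dlI (@fdlK K n) (fdl_fmul c) NH REG hh hS 0%N
    a (ltnW re).
rewrite (_ : ('C(r, a) * h (0 + a) = 0)%N) => [hc|]; last first.
  case: (leqP a r) => ar; last by rewrite bin_small.
  by rewrite add0n h0 ?muln0 // (leq_ltn_trans ar re).
apply/Jfam0_emb.
apply/(bnd0 I th (@subsp_Xfam K n) (@fdlP K n) r a).
apply: (has_rd0P hc).
apply/(thker_cyc (@subsp_Xfam K n) (@fdlP K n) (@fdl_X K n) dlI (fdl_fmul c) NH REG
  a _ re).
split; first exact: Xfam0_emb.
have -> : th r [ffun s => if s == finset.set0 then f else 0] =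
    [ffun s => if s == finset.set0 then lmul c r f else 0] :> fam K n.
  apply: famP => s; rewrite fmulE !ffunE; case: ifP => // _.
  by rewrite /lmul mulr0.
exact/Jfam0_emb.
Qed.

End ComplexHilb.

(** Strong induction on e: a nonempty face s leads to its link with e - #|s| forms, and links in the
    link are again links in G. *)
Lemma face_ring_CM e G c : closed_complex G -> no_common_zero G e c ->
  (forall s j, s \in G -> (j + #|s| < e)%N -> acyclic_in (link G s) j) ->
  star_regular G c e finset.set0.
Proof.
have [N] := ubnP e; elim: N e G c => // N IH e G c eN cG nz acy.
apply: face_ring_regular => //; last first.
  move=> j je; have := acy finset.set0 j cG.1; rewrite cards0 addn0 link0 //.
  exact.
move=> s sG s0; apply: star_reg_of_link => // c' nz'.
have s1 : (0 < #|s|)%N by rewrite card_gt0.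
have [_ [se _ _ _ _]] := adapted_forms cG sG nz.
apply: IH => //.
- by rewrite ltnS in eN; apply: leq_trans eN; rewrite ltn_subrL s1 (leq_trans s1 se).
- exact: closed_link.
- move=> t j tL je; rewrite link_link //; apply: acy.
    by move: tL; rewrite in_link // => /andP[].
  by rewrite (card_link cG tL); move: je se; lia.
Qed.

(** For a face t of the link of s, possibly empty, the union of s and t is nonempty, so the link of
    s satisfies Reisner's condition at all of its faces. *)
Lemma star_regular_Buchsbaum e G c s : closed_complex G -> no_common_zero G e c ->
  (forall s j, s \in G -> s != finset.set0 -> (j + #|s| < e)%N -> acyclic_in (link
    G s) j) ->
  s \in G -> s != finset.set0 -> star_regular G c e s.
Proof.
move=> cG nz acy sG s0; apply: star_reg_of_link => // c' nz'.
have [_ [se _ _ _ _]] := adapted_forms cG sG nz.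
apply: face_ring_CM => //; first exact: closed_link.
move=> t j tL je; rewrite link_link //; apply: acy.
- by move: tL; rewrite in_link // => /andP[].
- by rewrite -card_gt0 (card_link cG tL); have := s0; rewrite -card_gt0; lia.
- by rewrite (card_link cG tL); move: je se; lia.
Qed.

End CohenMacaulay.

(** * The group action *)

Section Orientation.
Variables (K : fieldType) (n : nat).
Implicit Types (s t : {set 'I_n}) (u v w : 'I_n) (g h : {perm 'I_n}).

(** The inversion sign as a product over pairs, so that composing permutations and deleting a vertex
    become identities factor by factor. *)
Definition osign g t : K :=
  \prod_(u in t) \prod_(w in t | (u < w)%N) (-1) ^+ (g w < g u)%N.

Lemma osignE g t : (-1) ^+ inversions g t = osign g t.
Proof.
rewrite /inversions -sum1_card expr_sum /osign pair_big_dep /=.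
rewrite [RHS](bigID (fun p : 'I_n * 'I_n => (g p.2 < g p.1)%N)) /=.
rewrite [X in _ = _ * X]big1; last by move=> p /andP[_ /negPf ->].
rewrite mulr1; apply: eq_big => [p|p]; first by rewrite inE !andbA.
by rewrite inE => /and4P[_ _ _ ->].
Qed.

Lemma signb_neq u v : u != v -> (-1) ^+ (v < u)%N = - (-1) ^+ (u < v)%N :> K.
Proof. by case: ltngtP => [_|_|/val_inj->]; rewrite ?eqxx ?expr0 ?expr1 ?opprK. Qed.

(** A product over ordered pairs of distinct elements can be reindexed by g, which a product over u
    < w cannot, as g does not preserve the order. *)
Lemma prod_pairs (f : 'I_n -> 'I_n -> K) t :
  \prod_(u in t) \prod_(w in t | u != w) f u w =
  \prod_(u in t) \prod_(w in t | (u < w)%N) (f u w * f w u).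
Proof.
transitivity (\prod_(u in t) ((\prod_(w in t | (u < w)%N) f u w) *
   \prod_(w in t | (w < u)%N) f u w)).
  apply: eq_bigr => u ut; rewrite (bigID (fun w => (u < w)%N)) /=; congr (_ * _).
    apply: eq_bigl => w; rewrite -andbA; congr (_ && _).
    by case: eqP => [->|] //=; rewrite ltnn.
  apply: eq_bigl => w; rewrite -andbA; congr (_ && _).
  by rewrite -leqNgt leq_eqVlt (inj_eq val_inj) eq_sym; case: eqP => [->|] //=;
    rewrite ltnn.
rewrite big_split /= [X in _ * X](exchange_big_dep (fun w => w \in t)) /=; last first.
  by move=> u w _ /andP[].
rewrite -big_split; apply: eq_bigr => u ut /=; rewrite big_split /=; congr (_ * _).
by apply: eq_bigl => w; rewrite ut.
Qed.

Lemma osignM g h t : osign (g * h)%g t = osign g t * osign h [set g u | u in t].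
Proof.
have -> : osign h [set g u | u in t] =
  \prod_(u in t) \prod_(w in t | (u < w)%N)
    ((if (g u < g w)%N then (-1) ^+ (h (g w) < h (g u))%N else 1) *
     (if (g w < g u)%N then (-1) ^+ (h (g u) < h (g w))%N else 1)).
  rewrite -(prod_pairs (fun u w => if (g u < g w)%N then (-1) ^+ (h (g w) < h (g
    u))%N else 1)).
  rewrite /osign big_imset /=; last by move=> x y _ _; apply: perm_inj.
  apply: eq_bigr => u ut.
  rewrite -big_mkcondr /= (eq_bigl (fun w => (w \in [set g u | u in t]) && (g u <
    w)%N)) //.
  rewrite big_imset_cond /=; last by move=> x y _ _; apply: perm_inj.
  apply: eq_bigl => w; rewrite -andbA; congr (_ && _).
  by case: eqP => [->|]; rewrite ?ltnn.
rewrite /osign -big_split /=; apply: eq_bigr => u ut.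
rewrite -big_split /=; apply: eq_bigr => w /andP[wt uw].
have uNw : g u != g w by rewrite (inj_eq perm_inj); apply: contraTneq uw => ->;
  rewrite ltnn.
rewrite !permM; case: (ltngtP (g u) (g w)) => [|_|/val_inj/eqP];
  last by rewrite (negPf uNw).
  by rewrite mulr1 expr0 mul1r.
rewrite mul1r expr1 mulN1r; apply: signb_neq.
by rewrite (inj_eq perm_inj).
Qed.

Lemma osign1 t : osign 1%g t = 1.
Proof.
rewrite /osign big1 // => u ut; rewrite big1 // => w /andP[_ uw].
by rewrite !perm1 ltnNge (ltnW uw) expr0.
Qed.

Lemma osign0 g : osign g finset.set0 = 1.
Proof. by rewrite /osign big_pred0 // => u; rewrite inE. Qed.

Lemma pos_sign v t : (-1) ^+ pos v t = \prod_(u in t) (-1) ^+ (u < v)%N :> K.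
Proof.
rewrite /pos -sum1_card expr_sum [RHS](bigID (fun u : 'I_n => (u < v)%N)) /=.
rewrite [X in _ = _ * X]big1; last by move=> u /andP[_ /negPf->].
by rewrite mulr1; apply: eq_big => [u|u]; rewrite inE // => /andP[_ ->].
Qed.

(** A pair of v with u is inverted when exactly one of u < v and g u < g v holds. This compatibility
    of signs makes [psi] commute with [fdl]. *)
Lemma osign_pos g v t : v \in t ->
  osign g t * (-1) ^+ pos (g v) [set g u | u in t] =
  (-1) ^+ pos v t * osign g (t :\ v).
Proof.
move=> vt.
have -> : osign g t = osign g (t :\ v) *
    \prod_(u in t :\ v) (-1) ^+ ((u < v) (+) (g u < g v))%N.
  rewrite {1}/osign (big_setD1 v) //=.
  have -> : \prod_(u in t :\ v) \prod_(w in t | (u < w)%N) (-1) ^+ (g w < g u)%N =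
      (\prod_(u in t :\ v) \prod_(w in t :\ v | (u < w)%N) (-1) ^+ (g w < g u)%N) *
      \prod_(u in t :\ v) (if (u < v)%N then (-1) ^+ (g v < g u)%N else 1) :> K.
    rewrite -big_split /=; apply: eq_bigr => u ut.
    case: ifP => uv.
      rewrite (bigD1 v) /=; last by rewrite vt uv.
      rewrite mulrC; congr (_ * _); apply: eq_bigl => w.
      by rewrite !inE andbAC [(w \in t) && _]andbC.
    rewrite mulr1; apply: eq_bigl => w; rewrite !inE.
    by case: eqP => [->|]; rewrite ?uv ?andbF.
  rewrite mulrCA; congr (_ * _).
  have -> : \prod_(w in t | (v < w)%N) (-1) ^+ (g w < g v)%N =
     \prod_(u in t :\ v) (if (v < u)%N then (-1) ^+ (g u < g v)%N else 1) :> K.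
    rewrite -big_mkcondr; apply: eq_bigl => w; rewrite !inE.
    by case: eqP => [->|]; rewrite ?ltnn ?andbF.
  rewrite -big_split /=; apply: eq_bigr => u; rewrite !inE => /andP[uv ut].
  case: (ltngtP u v) => [|_|/val_inj h]; last by rewrite h eqxx in uv.
    rewrite mul1r /=; case: (ltngtP (g u) (g v)) => //= /val_inj/perm_inj h.
    by rewrite h eqxx in uv.
  by rewrite mulr1 addFb.
rewrite !pos_sign (big_setD1 v vt) /= ltnn expr0 mul1r.
rewrite [X in _ * X]big_imset /=; last by move=> x y _ _; apply: perm_inj.
rewrite (big_setD1 v vt) /= ltnn expr0 mul1r -mulrA -big_split /= mulrC.
congr (_ * _); apply: eq_bigr => u _.
by case: (u < v)%N; case: (g u < g v)%N; rewrite /= ?expr1 ?expr0 ?mulr1 ?mul1r //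
  mulrNN mulr1.
Qed.

(* The pullback on cochains, hence the inverse of g on polynomials. *)
Definition psi g (F : fam K n) : fam K n :=
  [ffun t : {set 'I_n} => osign g t *: msym g^-1%g (F [set g v | v in t])].

Lemma psiE g (F : fam K n) t :
  psi g F t = osign g t *: msym g^-1%g (F [set g v | v in t]).
Proof. by rewrite ffunE. Qed.

Lemma psiP g (x : K) F H : psi g (x *: F + H) = x *: psi g F + psi g H.
Proof.
apply: famP => t; rewrite famDE famZE !psiE famDE famZE msymD msymZ.
by rewrite scalerDr !scalerA mulrC.
Qed.

Lemma psi_comp g h F : psi g (psi h F) = psi (g * h)%g F.
Proof.
apply: famP => t; rewrite !psiE msymZ scalerA osignM -msymMm invMg;
  congr (_ *: msym _ (F _)).
by rewrite -imset_comp; apply: eq_imset => u; rewrite /= permM.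
Qed.

Lemma psi1 F : psi 1%g F = F.
Proof.
apply: famP => t; rewrite psiE osign1 scale1r invg1 msym1m; congr (F _).
by rewrite -[RHS]imset_id; apply: eq_imset => u; rewrite perm1.
Qed.

Lemma iter_psi k g F : iter k (psi g) F = psi (g ^+ k)%g F.
Proof.
elim: k => [|k IH]; first by rewrite expg0 psi1.
by rewrite iterS IH psi_comp expgS.
Qed.

Lemma psi_fdl g F : psi g (fdl F) = fdl (psi g F).
Proof.
apply: famP => t; rewrite psiE !ffunE.
rewrite big_imset /=; last by move=> x y _ _; apply: perm_inj.
rewrite (raddf_sum (msym g^-1%g)) scaler_sumr; apply: eq_bigr => v vt /=.
rewrite psiE msymZ !scalerA osign_pos //; congr (_ *: msym _ (F _)).
by apply/setP => w; rewrite !inE -[w](permKV g) !(mem_imset _ _ perm_inj) !inE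
  (inj_eq perm_inj).
Qed.

Lemma msym_homog g a (f : {mpoly K[n]}) : Hpiece a f -> Hpiece a (msym g f).
Proof.
move=> hf; apply/dhomog_coeffP => b hb; rewrite mcoeff_sym.
by apply: (dhomog_nemf_coeff hf); rewrite /= mdeg_mperm.
Qed.

Lemma psi_X g j a F : Xfam j a F -> Xfam j a (psi g F).
Proof.
move=> XF t; have [h1 h2] := XF [set g v | v in t]; rewrite psiE; split.
  by apply: rpredZ; apply: msym_homog.
move: h2; rewrite card_imset; last exact: perm_inj.
by move=> h2 /h2 ->; rewrite msym0 scaler0.
Qed.

Lemma msup_perm g (b : 'X_{1..n}) : msup [multinom b ((g^-1)%g i) | i < n] =
  [set g v | v in msup b].
Proof.
apply/setP => w; rewrite -{2}[w](permKV g) (mem_imset _ _ perm_inj) !inE.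
by rewrite mnmE.
Qed.

Lemma psi_I (G : {set {set 'I_n}}) g j a F :
  (forall s, s \in G -> [set g v | v in s] \in G) ->
  Ifam G j a F -> Ifam G j a (psi g F).
Proof.
move=> Gg [XF hF]; split; first exact: psi_X.
move=> t b bG; rewrite psiE mcoeffZ mcoeff_sym hF ?mulr0 //.
by rewrite msup_perm -imsetU; apply: Gg.
Qed.

Lemma psi_fmul (c : nat -> 'I_n -> K) (mu : K) g r F :
  (forall v, c r (g v) = mu * c r v) ->
  psi g (fmul c r F) = mu *: fmul c r (psi g F).
Proof.
move=> cg; apply: famP => t; rewrite famZE fmulE !psiE fmulE /lmul msymM.
have -> : msym g^-1%g (linform (c r)) = mu *: linform (c r).
  rewrite /linform raddf_sum scaler_sumr [LHS](reindex_inj (@perm_inj _ g)).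
  apply: eq_bigr => v _ /=; rewrite msymZ cg scalerA; congr (_ *: _).
  rewrite msymX invgK; congr 'X_[_]; apply/mnmP => w.
  by rewrite mnmE !mnm1E (inj_eq perm_inj).
by rewrite -!scalerAl scalerA mulrC -scalerA scalerAr.
Qed.

End Orientation.

(** * Hilbert functions of eigenspaces *)

Section Equivariant.
Variables (K : fieldType) (n p : nat) (G : {set {set 'I_n}}).
Variables (c : nat -> 'I_n -> K) (e : nat) (g : {perm 'I_n}) (chi mu : K).
Hypothesis pK : p%:R != 0 :> K.
Hypothesis cG : closed_complex G.
Hypothesis reg : forall s, s \in G -> s != finset.set0 -> star_regular G c e s.
Hypothesis Gg : forall s, s \in G -> [set g v | v in s] \in G.
Hypothesis gp : (g ^+ p = 1)%g.
Hypothesis chi_p : chi ^+ p = 1.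
Hypothesis mu_p : mu ^+ p = 1.
Hypothesis cg : forall r v, c r (g v) = mu * c r v.

Local Notation X := (@Xfam K n).
Local Notation I := (@Ifam K n G).
Local Notation th := (@fmul K n c).
Local Notation dl := (@fdl K n).
Local Notation eigp := (eig (@psi K n g) chi mu).
Let Xe j := eigp (X j).
Let Ie j := eigp (I j).

Let psi_p F : iter p (@psi K n g) F = F.
Proof. by rewrite iter_psi gp psi1. Qed.

Let psi_th r F : psi g (th r F) = mu *: th r (psi g F).
Proof. by apply: psi_fmul. Qed.

Let psiX j a F : X j a F -> X j a (psi g F). Proof. exact: psi_X. Qed.
Let psiI j a F : I j a F -> I j a (psi g F). Proof. by apply: psi_I. Qed.

Lemma eig_Jfam r j a F : gensub (Xe j) (Ie j) th r a F <-> eigp (Jfam c G r j) a F.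
Proof.
exact: (eig_gensub pK (psiP g) psi_p chi_p mu_p (subsp_Xfam K n j) (subsp_Ifam K G j)
  (psiX (j := j)) (psiI (j := j)) (fmulP c) psi_th).
Qed.

Lemma eig_cycF r j a F : cyc Xe Ie th dl r j a F <-> eigp (cyc X I th dl r j) a F.
Proof.
exact: (eig_cyc pK (psiP g) psi_p chi_p mu_p (@subsp_Xfam K n) (subsp_Ifam K G)
  psiX psiI (fmulP c) psi_th (@fdlP K n) (psi_fdl g)).
Qed.

Lemma eig_bndF r j a F : bnd Xe Ie th dl r j a F <-> eigp (bnd X I th dl r j) a F.
Proof.
exact: (eig_bnd pK (psiP g) psi_p chi_p mu_p (@subsp_Xfam K n) (subsp_Ifam K G)
  psiX psiI (fmulP c) psi_th (@fdlP K n) (psi_fdl g)).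
Qed.

Variables D h : nat -> nat.
Hypothesis hD : forall a, has_rd (Xe 0 a) (Ie 0 a) (D a).
Hypothesis hh : forall j,
  has_rd (eigp (cyc X I th dl 0 j) 0) (eigp (bnd X I th dl 0 j) 0) (h j).

(** Null-homotopy, regularity and exactness are taken from the full complex; [eig_bndF] and
    [eig_Jfam] bring them down to the eigenspaces by projecting witnesses. *)
Lemma equivariant_hilb i : exists2 x : nat,
  has_rd (Xe 0 i) (eigp (Jfam c G e 0) i) x &
  x%:Z = \sum_(l < i.+1) (-1) ^+ l * ('C(e, l) * D (i - l))%:Z
     + 'C(e, i)%:Z * \sum_(j < i) (-1) ^+ (i - j - 1) * (h j)%:Z.
Proof.
have sXe j a : subsp (Xe j a) by apply: subsp_eig (subsp_Xfam K n j a); exact: psiP.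
have sIe j a : subsp (Ie j a) by apply: subsp_eig (subsp_Ifam K G j a); exact: psiP.
have IXe j a F : Ie j a F -> Xe j a F by case=> -[].
have wth r a F : psi g F = (chi * mu ^+ a) *: F ->
    psi g (th r F) = (chi * mu ^+ a.+1) *: th r F.
  move=> pF; rewrite psi_th pF -[_ *: F]addr0 fmulP (th_0 (fmulP c)) addr0 scalerA.
  by rewrite exprS mulrCA.
have thX r j a F : Xe j a F -> Xe j a.+1 (th r F).
  by move=> [XF pF]; split; [exact: fmul_X|exact: wth].
have thI r j a F : Ie j a F -> Ie j a.+1 (th r F).
  by move=> [XF pF]; split; [apply: fmul_I => //; exact: cG.2|exact: wth].
have wdl a F : psi g F = (chi * mu ^+ a) *: F -> psi g (dl F) =
  (chi * mu ^+ a) *: dl F.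
  by move=> pF; rewrite psi_fdl pF -[_ *: F]addr0 fdlP (dl_0 (@fdlP K n)) addr0.
have dlX j a F : Xe j a F -> Xe j.+1 a (dl F).
  by move=> [XF pF]; split; [exact: fdl_X|exact: wdl].
have dlI j a F : Ie j a F -> Ie j.+1 a (dl F).
  by move=> [XF pF]; split; [apply: fdl_I => //; exact: cG.2|exact: wdl].
have NH r j a F : (r < e)%N -> cyc Xe Ie th dl r j a F -> bnd Xe Ie th dl r j a.+1
  (th r F).
  move=> re /eig_cycF[zF pF]; apply/eig_bndF; split; last exact: wth.
  exact: fam_NH.
have REG r j a F : (r < e)%N -> Xe j.+1 a F ->
    gensub (Xe j.+1) (Ie j.+1) th r a.+1 (th r F) -> gensub (Xe j.+1) (Ie j.+1) th
      r a F.
  move=> re [XF pF] /eig_Jfam[hF _]; apply/eig_Jfam; split=> //.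
  exact: (fam_REG cG reg re XF).
have hS j a F : cyc Xe Ie th dl 0 j a.+1 F -> bnd Xe Ie th dl 0 j a.+1 F.
  move=> /eig_cycF[zF pF]; apply/eig_bndF; split=> //.
  exact: fam_exact_pos.
have hh' j : has_rd (cyc Xe Ie th dl 0 j 0) (bnd Xe Ie th dl 0 j 0) (h j).
  by apply: eq_has_rd (hh j) => F; [rewrite eig_cycF|rewrite eig_bndF].
have [E hE] := hilb_exists (sXe 0%N) (sIe 0%N) (IXe 0%N) (fmulP c) (fun r a F =>
  thX r 0%N a F)
  (fun a => ex_intro _ _ (hD a)).
have := hilb_formula sXe sIe IXe (fmulP c) thX thI (fmulC c) (@fdlP K n) dlX dlI
  (@fdlK K n) (fdl_fmul c) NH REG hh' hS hE i (leqnn e).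
have DE a : E 0%N a = D a by exact: (has_rd_uniq (sIe 0%N a)) (hE 0%N a) (hD a).
move=> xE; exists (E e i); first by apply: eq_has_rd (hE e i) => // F;
  exact: eig_Jfam.
by rewrite xE; congr (_ + _); apply: eq_bigr => l _; rewrite DE.
Qed.

End Equivariant.

(** * Counting monomials *)

Section FreeOrbits.

Lemma iter_modn (T : Type) (f : T -> T) p x k :
  (forall y, iter p f y = y) -> iter k f x = iter (k %% p) f x.
Proof.
move=> fp; rewrite {1}(divn_eq k p) addnC iterD; congr (iter _ _ _).
by elim: (k %/ p)%N => //= m IH; rewrite mulSn iterD IH fp.
Qed.

(** [froot] selects one representative per orbit, and freeness gives each orbit exactly p points. *)
Lemma free_orbits (T : finType) (f : T -> T) (p : nat) (B : {set T}) :
  (0 < p)%N -> injective f -> (forall x, iter p f x = x) ->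
  (forall x, x \in B -> f x \in B) ->
  (forall x k, x \in B -> (0 < k < p)%N -> iter k f x != x) ->
  exists R : {set T},
  [/\ (#|R| * p = #|B|)%N, {subset R <= B},
      forall x, x \in B -> exists r k, [/\ r \in R, (k < p)%N & x = iter k f r]
    & forall r r' k, r \in R -> r' \in R -> (k < p)%N -> r' = iter k f r ->
        r = r' /\ k = 0%N].
Proof.
move=> p0 fI fp fB ffree.
have sym := fconnect_sym fI.
have iB x k : x \in B -> iter k f x \in B by move=> xB; elim: k => //= k; apply: fB.
pose R := [set x in B | froot f x == x].
have RB : {subset R <= B} by move=> x; rewrite inE => /andP[].
have cov x : x \in B -> exists r k, [/\ r \in R, (k < p)%N & x = iter k f r].
  move=> xB; have xr := connect_root (frel f) x.
  have rE : froot f (froot f x) = froot f x.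
    by apply/eqP; rewrite (root_connect sym) sym.
  have rx : fconnect f (froot f x) x by rewrite sym.
  exists (froot f x), (findex f (froot f x) x %% p)%N; split.
  - by rewrite inE rE eqxx andbT -(iter_findex xr) iB.
  - by rewrite ltn_mod.
  - by rewrite -iter_modn // iter_findex.
have sep r r' k : r \in R -> r' \in R -> (k < p)%N -> r' = iter k f r ->
    r = r' /\ k = 0%N.
  move=> rR r'R kp r'E.
  have rr' : r = r'.
    move: (rR) (r'R); rewrite !inE => /andP[_ /eqP <-] /andP[_ /eqP <-].
    by apply/eqP; rewrite (root_connect sym) r'E fconnect_iter.
  split=> //; case: k kp r'E => // k kp r'E.
  have := ffree r k.+1 (RB _ rR); rewrite kp -r'E rr' eqxx => /(_ isT).
  by [].
have iI k x y : iter k f x = iter k f y -> x = y by elim: k => //= k IH /fI.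
exists R; split=> //.
pose m (q : T * 'I_p) := iter q.2 f q.1.
have mI : {in finset.setX R [set: 'I_p] &, injective m}.
  move=> [r k] [r' k']; rewrite !finset.in_setX !finset.in_setT !andbT /= =>
    rR r'R; rewrite /m /=.
  wlog kk : r k r' k' rR r'R / (k <= k')%N.
    move=> W E; case: (leqP k k') => h; first exact: W.
    by apply/esym/W => //; apply: ltnW.
  move=> E; have E' : r = iter (k' - k) f r'.
    have : iter k f r = iter k f (iter (k' - k) f r') by rewrite -iterD subnKC.
    exact: iI.
  have [rE kE] := sep _ _ _ r'R rR (leq_ltn_trans (leq_subr _ _) (ltn_ord k')) E'.
  by rewrite rE; congr (_, _); apply/val_inj/eqP;
    rewrite eqn_leq kk -subn_eq0 kE eqxx.
have mB : m @: (finset.setX R [set: 'I_p]) = B.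
  apply/setP => x; apply/imsetP/idP => [[[r k]]|xB].
    by rewrite finset.in_setX finset.in_setT andbT /m /= => rR ->; apply/iB/RB.
  have [r [k [rR kp xE]]] := cov x xB.
  by exists (r, Ordinal kp) => //; rewrite finset.in_setX finset.in_setT andbT.
by rewrite -mB card_in_imset // cardsX cardsT card_ord.
Qed.

End FreeOrbits.

Section WeightCount.
Variables (K : fieldType) (n p : nat) (G : {set {set 'I_n}}) (g : {perm 'I_n}).
Hypothesis pK : p%:R != 0 :> K.
Hypothesis Gg : forall s, s \in G -> [set g v | v in s] \in G.
Hypothesis gp : (g ^+ p = 1)%g.
Hypothesis gfree : forall k s, (0 < k < p)%N -> s \in G -> s != finset.set0 ->
  [set (g ^+ k)%g v | v in s] != s.

Definition facecount a : nat :=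
  #|[set b : 'X_{1..n < a.+1} | (mdeg b == a) && (msup b \in G)]|.

Let p0 : (0 < p)%N. Proof. by case: (p) pK => //; rewrite eqxx. Qed.

Let tau (b : 'X_{1..n}) : 'X_{1..n} := [multinom b ((g^-1)%g i) | i < n].

Let tauE k b : iter k tau b = [multinom b ((g ^- k)%g i) | i < n].
Proof.
elim: k => [|k IH] /=; apply/mnmP => v; first by rewrite mnmE invg1 perm1.
by rewrite mnmE IH !mnmE expgSr invMg permM.
Qed.

Let tau_p b : iter p tau b = b.
Proof. by rewrite tauE gp; apply/mnmP => v; rewrite mnmE invg1 perm1. Qed.

Let mdeg_tau b : mdeg (tau b) = mdeg b.
Proof. exact: mdeg_mperm. Qed.

Let msup_tau b k : msup (iter k tau b) = [set (g ^+ k)%g v | v in msup b].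
Proof. by rewrite tauE msup_perm. Qed.

Let coef_tau k (f : {mpoly K[n]}) b :
  (iter k (msym g^-1%g) f)@_b = f@_(iter k tau b).
Proof.
elim: k f b => [|k IH] f b //=; rewrite mcoeff_sym IH -iterSr //.
Qed.

Lemma weight_count a (w : K) : (0 < a)%N -> w ^+ p = 1 -> exists2 N,
  has_rd (fun f : {mpoly K[n]} => Hpiece a f /\ msym g^-1%g f = w *: f)
    (fun f => SRIh G finset.set0 a f /\ msym g^-1%g f = w *: f) N &
  (N * p = facecount a)%N.
Proof.
move=> a0 wp.
have w0 : w != 0.
  apply: contra_eq_neq wp => ->; rewrite expr0n eq_sym.
  by rewrite (gtn_eqF p0) oner_eq0.
pose bm := 'X_{1..n < a.+1}.
pose bt (b : bm) : bm := BMultinom (eq_ind_r (fun x =>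
  (x < a.+1)%N) (bmdeg b) (mdeg_tau b)).
have btE k (b : bm) : bmnm (iter k bt b) = iter k tau b.
  by elim: k => //= k <-.
pose B := [set b : bm | (mdeg b == a) && (msup b \in G)].
have [] := @free_orbits bm bt p B p0.
- move=> b b' /(congr1 (fun b : bm => bmnm (iter p.-1 bt b))).
  rewrite !btE /= -!(iterSr p.-1 tau) prednK // !tau_p => h; exact: val_inj.
- by move=> b; apply: val_inj; rewrite /= btE tau_p.
- move=> b; rewrite !inE mdeg_tau => /andP[-> h] /=.
  by rewrite (msup_tau b 1) expg1; apply: Gg.
- move=> b k; rewrite inE => /andP[/eqP ba bG] kp.
  apply/eqP => /(congr1 (fun b : bm => msup b)); rewrite btE msup_tau => /eqP.
  apply/negP; apply: gfree => //; apply: contraTneq a0 => b0.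
  rewrite -ba lt0n negbK mdeg_eq0; apply/eqP/mnmP => v; rewrite mnm0E.
  by move/setP/(_ v): b0; rewrite !inE => /negbFE/eqP.
move=> R [cR RB cov sep]; exists #|R| => //.
have psiP (x : K) (u v : {mpoly K[n]}) : msym g^-1%g (x *: u + v) =
  x *: msym g^-1%g u + msym g^-1%g v.
  by rewrite msymD msymZ.
have psi_p (f : {mpoly K[n]}) : iter p (msym g^-1%g) f = f.
  by apply/mpolyP => b; rewrite coef_tau tau_p.
pose ev (i : 'I_#|R|) : bm := enum_val i.
have evR i : ev i \in R by exact: enum_valP.
(* One vector per orbit: the projection of the representative, scaled by p so that its coefficient
   there is 1. *)
pose bas i : {mpoly K[n]} := p%:R *: eproj p (msym g^-1%g) w 'X_[ev i].
have basE i b : (bas i)@_b = \sum_(k < p) w ^- k * (bmnm (ev i) == iter k tau b)%:R.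
  rewrite /bas /eproj scalerA divff // scale1r raddf_sum; apply: eq_bigr => k _ /=.
  by rewrite mcoeffZ coef_tau mcoeffX.
have bas_ev i j : (bas i)@_(ev j) = (i == j)%:R.
  rewrite basE; case: (eqVneq i j) => [<-|ij].
    rewrite (bigD1 (Ordinal p0)) //= expr0 invr1 mul1r eqxx big1 ?addr0 // => k k0.
    rewrite -btE; case: eqP => [/val_inj h|]; last by rewrite mulr0.
    have [_ k0'] := sep _ _ _ (evR i) (evR i) (ltn_ord k) h.
    by case/eqP: k0; apply: val_inj.
  rewrite big1 // => k _; rewrite -btE; case: eqP => [/val_inj h|];
    last by rewrite mulr0.
  have [ji _] := sep _ _ _ (evR j) (evR i) (ltn_ord k) h.
  by move: ij; rewrite -(inj_eq enum_val_inj) -/(ev i) -/(ev j) ji eqxx.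
have sum_ev (c : 'I_#|R| -> K) j : (\sum_i c i *: bas i)@_(ev j) = c j.
  rewrite raddf_sum (bigD1 j) //= mcoeffZ bas_ev eqxx mulr1 big1 ?addr0 // => i ij.
  by rewrite mcoeffZ bas_ev (negPf ij) mulr0.
have sW : subsp (fun f : {mpoly K[n]} => Hpiece a f /\ msym g^-1%g f = w *: f).
  split; first by split; [apply: rpred0|rewrite msym0 scaler0].
  move=> x u v [u1 u2] [v1 v2]; split; first exact: (subspP x (subsp_homog K n a)).
  by rewrite psiP u2 v2 scalerDr !scalerA mulrC.
have bas_W i : Hpiece a (bas i) /\ msym g^-1%g (bas i) = w *: bas i.
  split; last by rewrite /bas msymZ (eproj_eigen pK psiP wp (psi_p _)) scalerA
    [RHS]scalerA mulrC.
  apply: rpredZ; apply: (@eproj_stable K p {mpoly K[n]} _ w (@Hpiece K n a) _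
    (subsp_homog K n a)).
    exact: msym_homog.
  by rewrite /Hpiece dhomogX; have := RB _ (evR i); rewrite inE => /andP[].
exists bas; split=> //.
  move=> c [[_ hc] _] j; rewrite -(sum_ev c) hc // finset.setU0.
  by have := RB _ (evR j); rewrite inE => /andP[].
move=> f hf; exists (fun i => f@_(ev i)).
set f' := f - _.
have [h1 h2] : Hpiece a f' /\ msym g^-1%g f' = w *: f'.
  by apply: (subspB sW) => //; apply: (subsp_sum _ sW) => i _; apply: (subspZ _ sW).
split=> //; split=> // b; rewrite finset.setU0 => bG.
case: (eqVneq (mdeg b) a) => ba; last exact: (dhomog_nemf_coeff h1 ba).
have bB : BMultinom (eq_leq (congr1 succn ba) : (mdeg b < a.+1)%N) \in B.
  by rewrite inE /= ba eqxx.
have [r [k [rR kp bE]]] := cov _ bB.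
have -> : b = iter k tau r by rewrite -btE -bE.
(* The coefficients of an eigenvector along an orbit are powers of w times the one at r, and the
   latter has been subtracted. *)
rewrite -coef_tau.
have -> : iter k (msym g^-1%g) f' = w ^+ k *: f'.
  elim: (k) => [|i /= ->]; first by rewrite expr0 scale1r.
  by rewrite msymZ h2 scalerA exprSr.
rewrite mcoeffZ (_ : f'@_r = 0) ?mulr0 //.
have -> : r = ev (enum_rank_in rR r) by rewrite /ev enum_rankK_in.
by rewrite mcoeffB sum_ev subrr.
Qed.

Lemma weight_count0 (w : K) : finset.set0 \in G ->
  has_rd (fun f : {mpoly K[n]} => Hpiece 0 f /\ msym g^-1%g f = w *: f)
    (fun f => SRIh G finset.set0 0 f /\ msym g^-1%g f = w *: f) (w == 1).
Proof.
move=> G0.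
have cst (f : {mpoly K[n]}) : Hpiece 0 f -> f = (f@_0%MM)%:MP.
  move=> hf; apply/mpolyP => b; rewrite mcoeffC.
  case: (eqVneq b 0%MM) => [->|b0]; first by rewrite mulr1.
  by rewrite mulr0 (dhomog_nemf_coeff hf) //= mdeg_eq0.
have c0 (x : K) : Hpiece 0 (x%:MP_[n]).
  apply/dhomog_coeffP => b b0; rewrite mcoeffC; case: eqP => [b0'|];
    last by rewrite mulr0.
  by rewrite b0' mdeg0 eqxx in b0.
have sc (x : K) : msym g^-1%g x%:MP_[n] = x%:MP_[n].
  apply/mpolyP => b; rewrite mcoeff_sym !mcoeffC; congr (_ * _%:R).
  by rewrite -!mdeg_eq0 mdeg_mperm.
case: (eqVneq w 1) => [->|w1] /=.
  exists (fun=> 1); split.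
  - by move=> _; split; [rewrite -mpolyC1; exact: c0|rewrite scale1r msym1].
  - move=> x [[_ /(_ 0%MM)]]; rewrite big_ord1 mcoeffZ mcoeff1 eqxx mulr1.
    have -> : msup (0%MM : 'X_{1..n}) = finset.set0 by apply/setP => v;
      rewrite !inE mnm0E.
    by rewrite finset.setU0 => h _ i; rewrite ord1 h.
  - move=> f [/cst -> _]; exists (fun=> f@_0%MM); rewrite big_ord1.
    rewrite -mul_mpolyC mulr1 subrr; split; last by rewrite msym0 scaler0.
    by split; [apply: rpred0|exact: SRI_0].
apply: has_rd0 => f [h1 h2].
suff -> : f = 0 by split; [split; [apply: rpred0|exact: SRI_0]|rewrite msym0 scaler0].
rewrite (cst f h1); move: h2; rewrite {1}(cst f h1) sc => /(congr1 (mcoeff 0%MM)).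
rewrite mcoeffZ mcoeffC eqxx mulr1 -[LHS]mul1r => /eqP.
rewrite -subr_eq0 -mulrBl mulf_eq0 subr_eq0 eq_sym (negPf w1) /= => /eqP ->.
by rewrite mpolyC0.
Qed.

End WeightCount.

(** * Monomial counts and the h-vector *)

Section HVector.

(* The number of monomials of degree a with a given support of size j. *)
Fixpoint nmon (j a : nat) : nat :=
  match j with
  | 0 => (a == 0)%N
  | j'.+1 => (fix rec a := if a is a'.+1 then (rec a' + nmon j' a')%N else 0%N) a
  end.

Arguments nmon : simpl never.

(** Divide by one variable of the support: its exponent was at least 2 in the first summand and 1 in
    the second. *)
Lemma nmonSS j a : nmon j.+1 a.+1 = (nmon j.+1 a + nmon j a)%N.
Proof. by []. Qed.

Lemma card_support n (s : {set 'I_n}) a :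
  #|[set b : 'X_{1..n < a.+1} | (mdeg b == a) && (msup b == s)]| = nmon #|s| a.
Proof.
have [j sj] : exists j, #|s| = j by exists #|s|.
rewrite sj; elim: j a s sj => [|j IH] a s sj.
  move/eqP: sj; rewrite cards_eq0 => /eqP ->.
  have m0 (b : 'X_{1..n}) : (msup b == finset.set0) = (b == 0%MM).
    apply/eqP/eqP => [h|->]; last by apply/setP => v; rewrite !inE mnm0E.
    by apply/mnmP => v; rewrite mnm0E; move/setP/(_ v): h;
      rewrite !inE => /negbFE/eqP.
  case: a => [|a] /=.
    have z0 : (mdeg (0%MM : 'X_{1..n}) < 1)%N by rewrite mdeg0.
    rewrite (_ : [set _ | _] = [set BMultinom z0]) ?cards1 //.
    apply/setP => b; rewrite !inE m0 bmeqP /=.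
    by case: (eqVneq (bmnm b) 0%MM) => [->|]; rewrite ?andbF // mdeg0.
  rewrite (_ : [set _ | _] = finset.set0) ?cards0 //.
  by apply/setP => b; rewrite !inE m0; case: (eqVneq (bmnm b) 0%MM) => [->|];
    rewrite ?andbF // mdeg0.
elim: a => [|a IHa].
  rewrite (_ : [set _ | _] = finset.set0) ?cards0 //.
  apply/setP => b; rewrite !inE; apply/negP => /andP[];
    rewrite mdeg_eq0 => /eqP -> /eqP h.
  move: sj; rewrite -h; rewrite (_ : msup 0%MM = finset.set0) ?cards0 //.
  by apply/setP => v; rewrite !inE mnm0E.
have [v vs] : exists v, v \in s by apply/set0Pn; rewrite -card_gt0 sj.
have pinc (b : 'X_{1..n < a.+1}) : (mdeg (U_(v) + b)%MM < a.+2)%N.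
  by rewrite mdegD mdeg1 add1n ltnS bmdeg.
pose inc b : 'X_{1..n < a.+2} := BMultinom (pinc b).
have incI : injective inc.
  move=> b b' /(congr1 (fun b : 'X_{1..n < a.+2} => bmnm b)) /= h.
  by apply: val_inj; apply/mnmP => x; move/mnmP/(_ x): h; rewrite !mnmDE => /addnI.
have minc (b : 'X_{1..n}) : msup (U_(v) + b)%MM = v |: msup b.
  by apply/setP => x; rewrite !inE mnmDE mnm1E addn_eq0 negb_and eqb0 negbK [v ==
    x]eq_sym.
pose N t := [set b : 'X_{1..n < a.+1} | (mdeg b == a) && (msup b == t)].
have -> : [set b : 'X_{1..n < a.+2} | (mdeg b == a.+1) && (msup b == s)] =
    inc @: (N s :|: N (s :\ v)).
  apply/setP => b; apply/idP/imsetP => [|[b']].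
    rewrite inE => /andP[/eqP ba /eqP bs].
    have bv : b v != 0%N by move: vs; rewrite -bs inE.
    have bE := addUBm bv.
    have dE : mdeg (b - U_(v))%MM = a.
      by have := congr1 (@mdeg n) bE; rewrite mdegD mdeg1 ba add1n => -[].
    exists (BMultinom (eq_leq (congr1 succn dE))); last by apply: val_inj;
      rewrite /= bE.
    rewrite !inE /= dE eqxx /=.
    have := minc (b - U_(v))%MM; rewrite bE bs => sE.
    case: (boolP (v \in msup (b - U_(v))%MM)) => h.
      suff -> : msup (b - U_(v))%MM = s by rewrite eqxx.
      by rewrite sE; apply/esym/setUidPr; rewrite sub1set.
    by rewrite [s :\ v](_ : _ = msup (b - U_(v))%MM) ?eqxx ?orbT // sE setU1K.
  rewrite !inE -andb_orr => /andP[/eqP b'a b's] ->.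
  rewrite /= mdegD mdeg1 b'a add1n eqxx minc /=.
  case/orP: b's => /eqP ->; last by rewrite setD1K.
  by apply/eqP/setUidPr; rewrite sub1set.
rewrite card_imset // cardsU.
rewrite (_ : _ :&: _ = finset.set0) ?cards0 ?subn0.
  rewrite /N IHa IH //; last by move: sj; rewrite (cardsD1 v) vs add1n => -[].
apply/setP => b; rewrite !inE; apply/negP => /andP[/andP[_ /eqP ->] /andP[_ /eqP h]].
by move/setP/(_ v): h; rewrite vs !inE eqxx.
Qed.

Lemma facecount_sum n (G : {set {set 'I_n}}) a :
  facecount G a = (\sum_(s in G) nmon #|s| a)%N.
Proof.
rewrite /facecount -sum1_card (partition_big (fun b : 'X_{1..n < a.+1} =>
  msup b) (fun s => s \in G)) /=; last first.
  by move=> b; rewrite inE => /andP[].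
apply: eq_bigr => s sG; rewrite -card_support -sum1_card; apply: eq_bigl => b.
by rewrite !inE -andbA; congr (_ && _); case: eqP => [->|]; rewrite ?sG ?andbF ?andbT.
Qed.

(** Coefficients of (1 - lambda)^d (lambda / (1 - lambda))^j = lambda^j (1 - lambda)^(d - j). *)
Lemma alt_nmon d j i : (j <= d)%N ->
  \sum_(l < i.+1) (-1) ^+ l * ('C(d, l) * nmon j (i - l))%:Z =
  if (j <= i)%N then (-1) ^+ (i - j) * 'C(d - j, i - j)%:Z else 0.
Proof.
elim: j d i => [|j IH] d i jd.
  rewrite big_ord_recr /= subnn muln1 big1 ?add0r ?subn0 // => l _.
  by rewrite /nmon subn_eq0 leqNgt ltn_ord muln0 mulr0.
case: d jd => // d jd; case: i => [|i].
  by rewrite big_ord1 muln0 mulr0.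
rewrite ltnS !subSS -IH //.
rewrite big_ord_recl mul1r bin0 mul1n subn0.
rewrite (eq_bigr (fun l : 'I_i.+1 =>
  - ((-1) ^+ l * ('C(d, l) * nmon j.+1 (i - l))%:Z) +
  (-1) ^+ l.+1 * ('C(d, l.+1) * nmon j.+1 (i.+1 - l.+1))%:Z)); last first.
  by move=> l _; rewrite /bump /= subSS binS mulnDl exprS PoszD mulrDr; ring.
rewrite big_split /= addrCA.
have -> : (nmon j.+1 i.+1)%:Z + \sum_(l < i.+1) (-1) ^+ l.+1 * ('C(d, l.+1) * nmon
  j.+1 (i.+1 - l.+1))%:Z
   = \sum_(l < i.+2) (-1) ^+ l * ('C(d, l) * nmon j.+1 (i.+1 - l))%:Z.
  by rewrite [RHS]big_ord_recl mul1r bin0 mul1n subn0.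
rewrite [X in _ + X]big_ord_recr /= subnn muln0 mulr0 addr0 -big_split /=.
apply: eq_bigr => l _; rewrite subSn; last by rewrite -ltnS.
by rewrite nmonSS mulnDr PoszD mulrDr; ring.
Qed.

Lemma f_number_card n (G : {set {set 'I_n}}) j :
  f_number G (j%:Z - 1) = #|[set s in G | #|s| == j]|.
Proof.
rewrite /f_number /face_dim; apply: eq_card => s; rewrite !inE; congr (_ && _).
by rewrite (inj_eq (addIr _)).
Qed.

(** The h-polynomial is (1 - lambda)^d times the Hilbert series of the face ring; [alt_nmon] is the
    share of a single face. *)
Lemma h_number_facecount n (G : {set {set 'I_n}}) d i :
  (forall s, s \in G -> (#|s| <= d)%N) ->
  \sum_(l < i.+1) (-1) ^+ l * ('C(d, l) * facecount G (i - l))%:Z = h_number G d i.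
Proof.
move=> Gd; rewrite /h_number big_mkord.
transitivity (\sum_(l < i.+1) \sum_(s in G)
    ((-1) ^+ l * ('C(d, l) * nmon #|s| (i - l))%:Z)).
  apply: eq_bigr => l _; rewrite facecount_sum big_distrr /=.
  by rewrite (big_morph Posz PoszD (erefl _)) mulr_sumr.
rewrite exchange_big /=; under eq_bigr => s sG do rewrite alt_nmon ?Gd //.
transitivity (\sum_(j < i.+1) \sum_(s in G | #|s| == j)
    (-1) ^+ (i - j) * 'C(d - j, i - j)%:Z); last first.
  apply: eq_bigr => j _; rewrite f_number_card PoszM mulrA sumr_const.
  rewrite -mulr_natr natz; congr (_ * Posz _); apply: eq_card => s.
  by rewrite !inE.
rewrite -big_mkcondr /= (exchange_big_dep (fun s => s \in G)) /=; last first.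
  by move=> j s _ /andP[].
rewrite big_mkcondr; apply: eq_bigr => s sG; case: ifP => si.
  rewrite (big_pred1 (Ordinal (si : (#|s| < i.+1)%N))) // => j.
  by rewrite sG /= eq_sym.
by rewrite big_pred0 // => j; rewrite sG /=; apply/eqP => sj;
  rewrite sj -ltnS ltn_ord in si.
Qed.

Lemma h_number_out n (G : {set {set 'I_n}}) d i :
  (forall s, s \in G -> (#|s| <= d)%N) -> (d < i)%N -> h_number G d i = 0.
Proof.
move=> Gd di; rewrite /h_number big_mkord big1 // => j _.
(* For j > d the truncated difference d - j is 0 and the binomial is 1 at j = i, so there the
   absence of faces is used instead. *)
case: (leqP j d) => jd; first by rewrite bin_small ?mul0n ?mulr0 //; lia.
rewrite f_number_card (_ : [set _ in _ | _] = finset.set0) ?cards0 ?muln0 ?mulr0 //.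
apply/setP => s; rewrite !inE; apply/negP => /andP[/Gd sd /eqP sj].
by rewrite sj leqNgt jd in sd.
Qed.

End HVector.

(** * Cohomology and the Stanley-Reisner ring *)

Section QuotientDimension.
Variable K : fieldType.

Lemma has_dim_rd (V : lmodType K) (S : set V) r :
  has_dim S r <-> has_rd S (fun v => v = 0) r.
Proof.
split=> -[b [Sb ib sb]]; exists b; split=> // v /sb[c].
  by move=> ->; exists c; rewrite subrr.
by move=> h; exists c; apply/eqP; rewrite -subr_eq0 h.
Qed.

Lemma has_dim_dim (V : lmodType K) (S : set V) r : has_dim S r -> Defs.dim S = r.
Proof.
move=> h; apply: xget_unique => // r' /has_dim_rd h'.
move/has_dim_rd: h => h; apply: has_rd_uniq h' h.
by split=> // a u v -> ->; rewrite scaler0 addr0.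
Qed.

Variables (V : lmodType K) (S W : set V) (f : V -> V) (p : nat) (w : K).
Hypothesis pK : p%:R != 0 :> K.
Hypothesis fP : forall (c : K) u v, f (c *: u + v) = c *: f u + f v.
Hypothesis f_p : forall v, iter p f v = v.
Hypothesis wp : w ^+ p = 1.
Hypothesis sW : subsp W.
Hypothesis fW : forall v, W v -> W (f v).
Hypothesis fS : forall v, v \in lspan S -> f v \in lspan S.

Lemma subsp_lspan : subsp (fun v => v \in lspan S).
Proof. by split=> [|c u v Su Sv]; [exact: lspan0|exact/lspanD/Sv/lspanZ]. Qed.

Lemma lproj_eq0 v : (lproj S v == 0) = (v \in lspan S).
Proof.
have -> : (0 : lquot S) = lproj S 0 by apply: (addrI (lproj S 0));
  rewrite -lprojD !addr0.
by rewrite lproj_eq subr0.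
Qed.

Lemma lprojZ a v : a *: lproj S v = lproj S (a *: v).
Proof. exact: lquot_scale_pi. Qed.

Lemma lproj_sum m (c : 'I_m -> K) (b : 'I_m -> V) :
  \sum_i c i *: lproj S (b i) = lproj S (\sum_i c i *: b i).
Proof.
under eq_bigr do rewrite lprojZ.
have p0 : lproj S 0 = 0 by apply/eqP; rewrite lproj_eq0 lspan0.
by rewrite (big_morph (lproj S) (@lprojD K V S) p0).
Qed.

Lemma lquot_map_pi v : lquot_map f (lproj S v) = lproj S (f v).
Proof.
apply/eqP; rewrite lproj_eq.
have -> : f (repr (lproj S v)) - f v = f (repr (lproj S v) - v).
  by rewrite addrC -scaleN1r -fP scaleN1r addrC.
by apply: fS; rewrite -lproj_eq lreprK.
Qed.

(** A representative of an eigenvector of the quotient need not be an eigenvector of f, but its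
    projection by [eproj] is one and represents the same class. *)
Lemma has_dim_eigen r :
  has_rd (fun v => W v /\ f v = w *: v)
    (fun v => [/\ W v, f v = w *: v & v \in lspan S]) r ->
  has_dim (eigenpart (@lquot_map K V S f) w [set lproj S x | x in W]%classic) r.
Proof.
have sE : subsp (fun v => W v /\ f v = w *: v).
  split=> [|a u v [u1 u2] [v1 v2]].
    by split; [exact: subsp0|rewrite (psi_0 fP) scaler0].
  by split; [exact: subspP|rewrite fP u2 v2 scalerDr !scalerA mulrC].
move=> [b [Wb ib sb]]; exists (fun i => lproj S (b i)); split.
- move=> i; have [Wi fi] := Wb i; split; first by exists (b i).
  by rewrite lquot_map_pi fi lprojZ.
- move=> c; rewrite lproj_sum => /eqP; rewrite lproj_eq0 => h; apply: ib.
  have [h1 h2] : W (\sum_i c i *: b i) /\ f (\sum_i c i *: b i) =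
    w *: \sum_i c i *: b i.
    by apply: (subsp_sum _ sE) => i _; apply: (subspZ _ sE).
  by split.
- move=> x [[v Wv <-]]; rewrite lquot_map_pi lprojZ => /eqP.
  rewrite lproj_eq => hv.
  pose v' := eproj p f w v.
  have Wv' : W v' by apply: eproj_stable.
  have fv' : f v' = w *: v' by apply: eproj_eigen.
  have vv' : v' - v \in lspan S.
    exact: (eproj_mod pK fP wp subsp_lspan (fun v => @fS v)).
  have [c [_ _ hc]] := sb v' (conj Wv' fv'); exists c.
  apply/eqP; rewrite lproj_sum lproj_eq.
  rewrite -(subrK v' v) -addrA; apply: lspanD => //.
  by rewrite -opprB -scaleN1r; apply: lspanZ.
Qed.

End QuotientDimension.

Section Cohomology.
Variables (K : fieldType) (n p : nat) (G : {set {set 'I_n}}) (g : {perm 'I_n}) (chi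
  mu : K).
Hypothesis pK : p%:R != 0 :> K.
Hypothesis cG : closed_complex G.
Hypothesis Gg : forall s : {set 'I_n}, ([set g v | v in s] \in G) = (s \in G).
Hypothesis gp : (g ^+ p = 1)%g.
Hypothesis chi_p : chi ^+ p = 1.

Local Notation coch := (cochains K n).
Implicit Types (x y : coch) (s t : {set 'I_n}).

Definition cfam x : fam K n := [ffun s : {set 'I_n} => (x s : K)%:MP].

Lemma cfamE x s : cfam x s = (x s : K)%:MP. Proof. by rewrite ffunE. Qed.

Lemma cochP x y : (forall s, x s = y s) -> x = y.
Proof. by move=> h; apply/ffunP. Qed.

Lemma cfam_inj x y : cfam x = cfam y -> x = y.
Proof.
move=> h; apply: cochP => s; have := congr1 (fun F : fam K n => (F s)@_0%MM) h.
by rewrite !cfamE !mcoeffC eqxx !mulr1.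
Qed.

Lemma cochDE x y s : (x + y) s = x s + y s. Proof. by rewrite ffunE. Qed.
Lemma cochZE (a : K) x s : (a *: x) s = a * x s. Proof. by rewrite ffunE. Qed.
Lemma coch0E s : (0 : coch) s = 0. Proof. by rewrite ffunE. Qed.

Lemma pullbackE x s : pullback g x s = osign K g s * x [set g v | v in s].
Proof. by rewrite ffunE -osignE. Qed.

Lemma pullbackP (a : K) x y : pullback g (a *: x + y) =
  a *: pullback g x + pullback g y.
Proof.
by apply: cochP => s; rewrite cochDE cochZE !pullbackE cochDE cochZE mulrDr mulrCA.
Qed.

Lemma cfamP (a : K) x y : cfam (a *: x + y) = a *: cfam x + cfam y.
Proof.
apply: famP => s; rewrite famDE famZE !cfamE cochDE cochZE mpolyCD mpolyCM.
by rewrite mul_mpolyC.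
Qed.

Lemma cfam0 : cfam 0 = 0.
Proof. by apply: famP => s; rewrite cfamE coch0E fam0E mpolyC0. Qed.

Lemma msymC h (a : K) : msym h a%:MP_[n] = a%:MP_[n].
Proof.
apply/mpolyP => b; rewrite mcoeff_sym !mcoeffC; congr (_ * _%:R).
by rewrite -!mdeg_eq0 mdeg_mperm.
Qed.

Lemma psi_cfam x : psi g (cfam x) = cfam (pullback g x).
Proof.
apply: famP => s; rewrite psiE !cfamE msymC pullbackE mpolyCM.
by rewrite mul_mpolyC.
Qed.

Lemma pullback_p x : iter p (pullback g) x = x.
Proof.
apply: cfam_inj; have -> : cfam (iter p (pullback g) x) =
  iter p (@psi K n g) (cfam x).
  by elim: (p) => //= k <-; rewrite psi_cfam.
by rewrite iter_psi gp psi1.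
Qed.

Lemma coboundaryP (a : K) x y :
  coboundary G (a *: x + y) = a *: coboundary G x + coboundary G y.
Proof.
apply: cochP => t; rewrite cochDE cochZE !ffunE; case: ifP => _;
  last by rewrite mulr0 addr0.
rewrite mulr_sumr -big_split; apply: eq_bigr => v _ /=.
by rewrite cochDE cochZE mulrDr mulrCA.
Qed.

Lemma coboundary_fdl x t : t \in G -> (fdl (cfam x) t)@_0%MM = coboundary G x t.
Proof.
move=> tG; rewrite !ffunE tG raddf_sum; apply: eq_bigr => v _ /=.
by rewrite mcoeffZ cfamE mcoeffC eqxx mulr1.
Qed.

Lemma pullback_coboundary x :
  pullback g (coboundary G x) = coboundary G (pullback g x).
Proof.
apply: cochP => t; case: (boolP (t \in G)) => tG; last first.
  by rewrite pullbackE !ffunE Gg (negPf tG) mulr0.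
rewrite -coboundary_fdl // -psi_cfam -psi_fdl psiE mcoeffZ mcoeff_sym pullbackE.
rewrite -coboundary_fdl ?Gg //; congr (_ * _@_ _).
by apply/mnmP => v; rewrite mnmE !mnm0E.
Qed.

Lemma subsp_cochain i : subsp (cochain (K := K) G i).
Proof.
split=> [s|a x y hx hy s]; first by rewrite coch0E eqxx.
rewrite cochDE cochZE => h; case: (eqVneq (x s) 0) => [x0|/hx //].
by apply: hy; apply: contra_neq h => ->; rewrite x0 mulr0 addr0.
Qed.

Lemma coboundary0 : coboundary G (0 : coch) = 0.
Proof. exact: (psi_0 coboundaryP). Qed.

Lemma subsp_cocycle i : subsp (cocycle (K := K) G i).
Proof.
split=> [|a x y [x1 x2] [y1 y2]].
  by split; [exact: (subsp0 (subsp_cochain i))|exact: coboundary0].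
split; first exact: (subspP a (subsp_cochain i)).
by rewrite coboundaryP x2 y2 scaler0 addr0.
Qed.

Lemma face_dim_set s : face_dim [set g v | v in s] = face_dim s.
Proof. by rewrite /face_dim card_imset //; apply: perm_inj. Qed.

Lemma pullback_cochain i x : cochain G i x -> cochain G i (pullback g x).
Proof.
move=> hx s; rewrite pullbackE mulf_eq0 negb_or => /andP[_ /hx[]].
by rewrite Gg face_dim_set.
Qed.

Lemma pullback_cocycle i x : cocycle G i x -> cocycle G i (pullback g x).
Proof.
move=> [h1 h2]; split; first exact: pullback_cochain.
by rewrite -pullback_coboundary h2 (psi_0 pullbackP).
Qed.

Lemma lspan_coboundaries i x :
  x \in lspan (coboundaries (K := K) G i) <-> coboundaries (K := K) G i x.
Proof.
split; last exact: mem_lspan.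
move=> /asboolP[r [c [s [Ss ->]]]].
have sB : subsp (coboundaries (K := K) G i).
  split; first by exists 0; [exact: (subsp0 (subsp_cochain _))|exact: coboundary0].
  move=> a u v [u' hu <-] [v' hv <-]; exists (a *: u' + v'); last exact: coboundaryP.
  exact: (subspP a (subsp_cochain _)).
by apply: (subsp_sum _ sB) => k _; apply: subspZ.
Qed.

Local Notation X := (@Xfam K n).
Local Notation I := (@Ifam K n G).
Local Notation dl := (@fdl K n).
Local Notation eigp := (eig (@psi K n g) chi mu).

Lemma cfam_X j x : cochain G (j%:Z - 1) x -> X j 0 (cfam x).
Proof.
move=> hx s; rewrite cfamE; split.
  apply/dhomog_coeffP => b b0; rewrite mcoeffC; case: eqP => [b0'|];
    last by rewrite mulr0.
  by rewrite b0' mdeg0 eqxx in b0.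
move=> sj; rewrite (_ : x s = 0) ?mpolyC0 //; apply/eqP; apply: contraTT sj.
move=> /hx[_]; rewrite /face_dim => /(addIr _) [<-]; by rewrite negbK.
Qed.

Lemma X0_coef j F s b : X j 0 F -> b != 0%MM -> (F s)@_b = 0.
Proof.
move=> XF b0; have [hF _] := XF s; apply: (dhomog_nemf_coeff hF).
by rewrite /= mdeg_eq0.
Qed.

Lemma I0P j F : X j 0 F -> (forall s, s \in G -> (F s)@_0%MM = 0) -> I j 0 F.
Proof.
move=> XF h; split=> // s b bG; case: (eqVneq b 0%MM) => [->|];
  last exact: (X0_coef _ XF).
by apply: h; apply: cG.2 bG _; apply: finset.subsetUr.
Qed.

Lemma I0_coef j F s : I j 0 F -> s \in G -> (F s)@_0%MM = 0.
Proof.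
move=> [_ IF] sG; apply: IF.
by rewrite (_ : msup 0%MM = finset.set0) ?finset.set0U //; apply/setP => v;
  rewrite !inE mnm0E.
Qed.

(** Constant families modulo [Ifam] are cochains: only the coefficients at faces with j vertices are
    read. At degree 0 the weight chi mu^0 is chi itself. *)
Lemma cohomology_fam j th r :
  has_rd (eigp (cyc X I th dl 0 j) 0) (eigp (bnd X I th dl 0 j) 0) r ->
  has_dim (eigenpart (lquot_map (pullback g)) chi (red_cohomology K G (j%:Z - 1))) r.
Proof.
move=> h.
apply: (has_dim_eigen pK pullbackP pullback_p chi_p (subsp_cocycle _)).
- by move=> x; apply: pullback_cocycle.
- move=> x /lspan_coboundaries[y hy <-]; apply/lspan_coboundaries.
  by rewrite pullback_coboundary; exists (pullback g y) => //;
    apply: pullback_cochain.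
pose T (F : fam K n) (x : coch) := eigp (cyc X I th dl 0 j) 0 F /\
  (forall s, x s = if (s \in G) && (#|s| == j) then (F s)@_0%MM else 0).
have sC : subsp (eigp (cyc X I th dl 0 j) 0).
  apply: subsp_eig; first exact: psiP.
  by split=> [|a F H [F1 F2] [H1 H2]]; (split; [|rewrite /=]);
    rewrite ?fdlP ?(dl_0 (@fdlP K n));
    [exact: (subsp0 (subsp_Xfam _ _ _ _))|exact: (subsp0 (subsp_Ifam _ _ _ _))
    |exact: (subspP a (subsp_Xfam _ _ _ _))|exact: (subspP a (subsp_Ifam _ _ _ _))].
have Tcoch F x : T F x -> cochain G (j%:Z - 1) x.
  move=> [_ h2] s; rewrite h2; case: ifP => [/andP[sG /eqP sj] _|];
    last by rewrite eqxx.
  by rewrite /face_dim sj.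
have Tcoc F x : T F x -> coboundary G x = 0.
  move=> [[[XF /= IF] _] h2]; apply: cochP => t; rewrite coch0E ffunE;
    case: ifP => // tG.
  case: (eqVneq #|t| j.+1) => tj; last first.
    rewrite big1 // => v vt; rewrite h2 [_ == j](_ : _ = false) ?andbF ?mulr0 //.
    by apply: contraNF tj => /eqP <-; rewrite (cardsD1 v t) vt.
  rewrite -[RHS](I0_coef IF tG) ffunE raddf_sum; apply: eq_bigr => v vt /=.
  rewrite mcoeffZ h2 (cG.2 _ _ tG (subD1set _ _)) /=.
  by rewrite (_ : #|t :\ v| == j) //; move: tj;
    rewrite (cardsD1 v t) vt add1n => -[->].
have Tpull F x : T F x -> pullback g x = chi *: x.
  move=> [[_ pF] h2]; apply: cochP => s; rewrite pullbackE cochZE !h2 Gg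
    card_imset; last exact: perm_inj.
  case: ifP => _; last by rewrite !mulr0.
  have := congr1 (fun F : fam K n => (F s)@_0%MM) pF.
  rewrite famZE psiE !mcoeffZ mcoeff_sym expr0 mulr1 => <-; congr (_ * _@_ _).
  by apply/mnmP => v; rewrite mnmE !mnm0E.
apply: (@has_rd_corr K _ _ T _ _ _ _ _ _ _ _ _ _ h).
- by split; [exact: subsp0|move=> s; rewrite coch0E fam0E mcoeff0 if_same].
- move=> a F x F' x' [F1 F2] [F1' F2']; split; first exact: subspP.
  move=> s; rewrite cochDE cochZE F2 F2' famDE famZE mcoeffD mcoeffZ.
  by case: ifP => // _; rewrite mulr0 addr0.
- move=> F zF.
  pose x : coch := [ffun s => if (s \in G) && (#|s| == j) then (F s)@_0%MM else 0].
  have TFx : T F x by split=> // s; rewrite ffunE.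
  by exists x => //; split; [split; [exact: Tcoch TFx|exact: Tcoc TFx]|exact: Tpull
    TFx].
- move=> x [[x1 x2] x3].
  have zx : eigp (cyc X I th dl 0 j) 0 (cfam x).
    split; last first.
      by rewrite psi_cfam x3 expr0 mulr1 -[_ *: x]addr0 cfamP cfam0 addr0.
    split; first exact: cfam_X.
    apply: I0P; first exact/fdl_X/cfam_X.
    by move=> s sG; rewrite coboundary_fdl // x2 coch0E.
  exists (cfam x) => //; split=> // s; rewrite cfamE mcoeffC eqxx mulr1.
  case: ifP => // /negP nh; apply/eqP; apply/negPn/negP => /x1[sG sj]; apply: nh.
  by rewrite sG /=; move: sj; rewrite /face_dim => /(addIr _) [->].
- move=> F x TFx; have [[[XF IF] pF] h2] := TFx.
  have xE s : s \in G -> #|s| = j -> x s = (F s)@_0%MM by move=> sG sj;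
    rewrite h2 sG sj eqxx.
  split=> [[[y [py Iy]] _]|[_ _ /lspan_coboundaries[y hy xy]]].
    split; [by split; [exact: Tcoch TFx|exact: Tcoc TFx]|exact: Tpull TFx|].
    apply/lspan_coboundaries.
    case: j h sC @T Tcoch Tcoc Tpull TFx XF IF py Iy h2 xE =>
      [|j] h sC T Tcoch Tcoc Tpull TFx XF IF py Iy h2 xE.
      exists 0; first exact: (subsp0 (subsp_cochain _)).
      rewrite coboundary0; apply: cochP => s; rewrite coch0E h2;
        case: ifP => // /andP[sG _].
      move: Iy; rewrite /= in py; rewrite py (dl_0 (@fdlP K n)) subr0 =>
        /I0_coef/(_ sG) <-.
      by [].
    pose z : coch := [ffun s => if (s \in G) && (#|s| == j) then (y s)@_0%MM else 0].
    exists z.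
      move=> s; rewrite ffunE; case: ifP => [/andP[sG /eqP sj] _|];
        last by rewrite eqxx.
      by split=> //; rewrite /face_dim sj -addn1 PoszD addrK.
    apply: cochP => t; rewrite ffunE h2; case: (boolP (t \in G)) => //= tG.
    case: eqP => [tj|tj]; last first.
      rewrite big1 // => v vt; rewrite ffunE [_ == j](_ : _ = false) ?andbF ?mulr0 //.
      by apply/eqP => tj'; apply: tj; rewrite (cardsD1 v t) vt tj'.
    have := I0_coef Iy tG; rewrite famDE famNE mcoeffB => /eqP;
      rewrite subr_eq0 => /eqP ->.
    rewrite ffunE raddf_sum; apply: eq_bigr => v vt /=.
    rewrite mcoeffZ ffunE (cG.2 _ _ tG (subD1set _ _)) /=.
    by rewrite (_ : #|t :\ v| == j) //; move: tj;
      rewrite (cardsD1 v t) vt add1n => -[->].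
  split=> //; case: j h sC @T Tcoch Tcoc Tpull TFx XF IF hy xy h2 xE =>
    [|j] h sC T Tcoch Tcoc Tpull TFx XF IF hy xy h2 xE.
    (* No face has dimension -2, so there is no nonzero coboundary in degree -1. *)
    have y0 : y = 0.
      apply: cochP => s; rewrite coch0E; apply/eqP/negPn/negP => /hy[_].
      rewrite /face_dim; lia.
    exists 0; split=> //; rewrite (dl_0 (@fdlP K n)) subr0; apply: I0P => // s sG.
    case: (eqVneq #|s| 0%N) => sj; last by have [_ ->] := XF s; rewrite ?mcoeff0.
    by rewrite -xE // -xy y0 coboundary0 coch0E.
  have hy' : cochain G (j%:Z - 1) y by move: hy; rewrite -addn1 PoszD addrK.
  exists (cfam y); split; first exact: cfam_X.
  have Xd : X j.+1 0 (dl (cfam y)) by apply/fdl_X/cfam_X.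
  apply: I0P; first exact: (subspB (subsp_Xfam _ _ _ _)).
  move=> s sG; rewrite famDE famNE mcoeffB; case: (eqVneq #|s| j.+1) => sj.
    by rewrite coboundary_fdl // xy xE // subrr.
  have E : (dl (cfam y) s)@_0%MM = 0 by have [_ /(_ sj)->] := Xd s; rewrite mcoeff0.
  by have [_ /(_ sj)->] := XF s; rewrite [X in _ - X]E mcoeff0 subrr.
Qed.

End Cohomology.

(** * Acyclicity of links from the Buchsbaum condition *)

Section BuchsbaumAcyclic.
Variables (K : fieldType) (n d : nat) (D : {set {set 'I_n}}).
Hypothesis cD : closed_complex D.
Hypothesis D_dim : complex_dim D = d%:Z - 1.

Lemma max_face : (\max_(s in D) #|s| = d)%N.
Proof. by move: D_dim; rewrite /complex_dim => /(addIr _) [->]. Qed.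

Lemma face_le (s : {set 'I_n}) : s \in D -> (#|s| <= d)%N.
Proof. by move=> sD; rewrite -max_face (leq_bigmax_cond (F := fun s : {set 'I_n} =>
  #|s|)). Qed.

Lemma Buchsbaum_acyclic (s : {set 'I_n}) j : Buchsbaum K D ->
  s \in D -> s != finset.set0 -> (j + #|s| < d)%N -> acyclic_in K (link D s) j.
Proof.
move=> [pD bD] sD s0 js.
have cL := closed_link cD sD.
(* Purity: a facet containing s has d vertices, so the link contains a face with d - #|s| > j
   vertices and j - 1 lies below its dimension. *)
have [f fm sf] := maxset_exists (P := [pred t : {set 'I_n} | t \in D]) (sD : [pred
  t : {set 'I_n} | t \in D] s).
have fD : f \in D by have /maxsetP[] := fm.
have fd : #|f| = d.
  by have := pD f fm; rewrite D_dim /face_dim => /(addIr _) [].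
have fL : f :\: s \in link D s.
  rewrite in_link // disjoint_subset; apply/andP; split.
    rewrite (_ : s :|: f :\: s = f) //; apply/setP => x; rewrite !inE.
    by case: (boolP (x \in s)) => //= /(fintype.subsetP sf) ->.
  by apply/fintype.subsetP => x xs; rewrite !inE xs.
have jL : (j%:Z - 1 : int) < complex_dim (link D s).
  rewrite /complex_dim ltrD2r ltz_nat.
  apply: leq_trans (leq_bigmax_cond (F := fun t : {set 'I_n} => #|t|) _ fL).
  by rewrite cardsD (setIidPr sf) fd; lia.
(* The equivariant comparison is specialized to the trivial group, with p, g and chi all 1. *)
have one_p : (1%:R : K) != 0 by exact: oner_neq0.
have id_stable (t : {set 'I_n}) : [set (1 : {perm 'I_n})%g v | v in t] = t.
  by rewrite (eq_imset (g := id)) ?imset_id // => v; rewrite perm1.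
have Lg (t : {set 'I_n}) : ([set (1 : {perm 'I_n})%g v | v in t] \in link D s) =
  (t \in link D s).
  by rewrite id_stable.
have g1 : ((1 : {perm 'I_n}) ^+ 1 = 1)%g by rewrite expg1.
have chi1 : (1 : K) ^+ 1 = 1 by rewrite expr1.
pose th := @fmul K n (fun _ _ => 0).
have sC : subsp (cyc (@Xfam K n) (Ifam (link D s)) th (@fdl K n) 0 j 0).
  apply: subsp_cyc; [exact: subsp_Xfam|exact: subsp_Ifam|exact: fmulP|exact: fdlP].
have sB : subsp (bnd (@Xfam K n) (Ifam (link D s)) th (@fdl K n) 0 j 0).
  apply: subsp_bnd; [exact: subsp_Xfam|exact: subsp_Ifam|exact: fmulP|exact: fdlP].
(* [betti] takes the value 0 on an infinite-dimensional space by default, so finite dimension is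
   secured before 0 is read as vanishing. *)
have [r hr] := cyc_fin (K := K) (fun _ _ => 0) cL j 0.
have eE (W : nat -> fam K n -> Prop) F : eig (@psi K n 1%g) 1 1 W 0 F <-> W 0%N F.
  by rewrite /eig psi1 expr0 mulr1 scale1r; split=> [[]|].
have hr' : has_rd (eig (@psi K n 1%g) 1 1 (cyc (@Xfam K n) (Ifam (link D s)) th
  (@fdl K n) 0 j) 0)
    (eig (@psi K n 1%g) 1 1 (bnd (@Xfam K n) (Ifam (link D s)) th (@fdl K n) 0 j)
      0) r.
  by apply: eq_has_rd hr => F; rewrite eE.
have := cohomology_fam one_p cL Lg g1 chi1 hr'.
rewrite (_ : eigenpart _ _ _ = red_cohomology K (link D s) (j%:Z - 1)).
  move=> /has_dim_dim; rewrite -/(betti K (link D s) (j%:Z - 1)) bD // => r0.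
  by move: hr; rewrite -r0 => hr F zF; apply: (has_rd0P hr).
apply/seteqP; split=> x [] //.
move=> y hy <-; split; first by exists y.
rewrite scale1r /lquot_map -[RHS]lreprK; congr (lproj _ _).
exact: (pullback_p g1).
Qed.

End BuchsbaumAcyclic.

(** * The Stanley-Reisner ideal in terms of coefficients *)

Section SRIdeal.
Variables (K : fieldType) (n : nat) (D : scomplex n).
Implicit Types (b : 'X_{1..n}) (f h : {mpoly K[n]}) (s t : {set 'I_n}) (v : 'I_n).

Lemma scomplex_closed : closed_complex D.
Proof. by split; [exact: scomplex_face0|exact: scomplex_sub]. Qed.

(** Every monomial is a multiple of the square-free monomial of its support, so the ideal is spanned
    by the monomials whose support is not a face. *)
Lemma SR_idealP f : f \in SR_ideal (K := K) D <-> SRI D finset.set0 f.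
Proof.
split.
  move=> /asboolP[r [c [h [Sh ->]]]] b; rewrite finset.setU0 => bD.
  rewrite raddf_sum big1 //= => i _; rewrite mcoeffZ.
  have [f' [s [sD ->]]] := Sh i.
  have [v vs vb] : exists2 v, v \in s & v \notin msup b.
    apply/subsetPn; apply: contra sD => sb; exact: (scomplex_sub bD sb).
  rewrite [f' * _]mulrC (bigD1 v) //= -mulrA mcoeffXM.
  by move: vb; rewrite inE negbK => ->; rewrite mulr0.
move=> hf; rewrite [f]mpolyE big_seq; apply: rpred_sum => b bf; apply: lspanZ.
have bD : msup b \notin D.
  by apply: contraTN bf => bD; rewrite -mcoeff_eq0; apply/eqP/hf;
    rewrite finset.setU0.
apply: mem_lspan; exists (\prod_(v in msup b) 'X_v ^+ (b v).-1), (msup b); split=> //.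
rewrite -big_split /= mpolyXE_id (bigID (fun v =>
  v \in msup b)) /= [X in _ * X]big1 ?mulr1.
  by apply: eq_bigr => v; rewrite inE -exprSr => bv; rewrite prednK // lt0n.
by move=> v; rewrite inE negbK => /eqP ->; rewrite expr0.
Qed.

Lemma SR_proj_eq f h : (SR_proj D f == SR_proj D h) = (f - h \in SR_ideal (K := K) D).
Proof. by rewrite /SR_proj piE. Qed.

Lemma SR_proj_eqP f h : SR_proj D f = SR_proj D h <-> SRI D finset.set0 (f - h).
Proof. by rewrite -SR_idealP -SR_proj_eq; split=> /eqP. Qed.

Lemma SR_projZ (a : K) f : SR_proj D (a *: f) = a *: SR_proj D f.
Proof. by rewrite -mul_mpolyC rmorphM. Qed.

Lemma SR_reprK (x : SR_ring K D) : SR_proj D (repr x) = x.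
Proof. exact: reprK. Qed.

Variables (g : {perm 'I_n}).
Hypothesis Dg : forall s : {set 'I_n}, ([set g v | v in s] \in D) = (s \in D).

Lemma poly_act_msym f : poly_act g f = msym g f.
Proof.
apply: eq_bigr => m _; congr (_ * _); apply: eq_bigr => i _.
by rewrite tnth_mktuple.
Qed.

Lemma SRI_msym f : SRI D finset.set0 f -> SRI D finset.set0 (msym g f).
Proof.
move=> hf b; rewrite finset.setU0 => bD; rewrite mcoeff_sym; apply: hf.
have := msup_perm g^-1%g b; rewrite invgK => ->; rewrite finset.setU0.
by rewrite -Dg -imset_comp (eq_imset (g := id)) ?imset_id // => v; rewrite /= permKV.
Qed.

Lemma SR_act_pi f : SR_act g (SR_proj D f) = SR_proj D (msym g f).
Proof.
rewrite /SR_act poly_act_msym; apply/SR_proj_eqP; rewrite -msymB; apply: SRI_msym.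
by apply/SR_proj_eqP; rewrite SR_reprK.
Qed.

Lemma SR_actP (a : K) (x y : SR_ring K D) :
  SR_act g (a *: x + y) = a *: SR_act g x + SR_act g y.
Proof.
rewrite -[x]SR_reprK -[y]SR_reprK -SR_projZ -rmorphD /= !SR_act_pi.
by rewrite msymD msymZ rmorphD /= SR_projZ.
Qed.

Lemma SR_actM (x y : SR_ring K D) : SR_act g (x * y) = SR_act g x * SR_act g y.
Proof.
by rewrite -[x]SR_reprK -[y]SR_reprK -rmorphM /= !SR_act_pi msymM rmorphM.
Qed.

Lemma SR_act_iter k f : iter k (SR_act g) (SR_proj D f) =
  SR_proj D (iter k (msym g) f).
Proof. by elim: k => //= k ->; rewrite SR_act_pi. Qed.

Lemma iter_msym k f : iter k (msym g) f = msym (g ^+ k)%g f.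
Proof. by elim: k => [|k IH]; rewrite ?expg0 ?msym1m //= IH expgSr msymMm. Qed.

Variable p : nat.
Hypothesis gp : (g ^+ p = 1)%g.

Lemma SR_act_p (x : SR_ring K D) : iter p (SR_act g) x = x.
Proof. by rewrite -[x]SR_reprK SR_act_iter iter_msym gp msym1m. Qed.

Lemma subsp_SR_piece i : subsp (SR_piece (K := K) (D := D) i).
Proof.
split; first by exists 0; [exact: rpred0|exact: rmorph0].
move=> a x y [f hf <-] [h hh <-]; exists (a *: f + h).
  exact: (subspP a (subsp_homog K n i)).
by rewrite rmorphD /= SR_projZ.
Qed.

Lemma SR_act_piece i x : SR_piece (K := K) (D := D) i x -> SR_piece i (SR_act g x).
Proof.
move=> [f hf <-]; rewrite SR_act_pi; exists (msym g f) => //.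
exact: msym_homog.
Qed.

End SRIdeal.

Section ThetaIdeal.
Variables (K : fieldType) (n d : nat) (D : scomplex n) (theta : 'I_d -> SR_ring K D).
Implicit Types (b : 'X_{1..n}) (f h : {mpoly K[n]}) (v : 'I_n).

Lemma lspan_theta (x : SR_ring K D) : x \in lspan (theta_multiples theta) <->
  exists Y : 'I_d -> {mpoly K[n]}, x = \sum_r SR_proj D (Y r) * theta r.
Proof.
split; last first.
  move=> [Y ->]; apply: rpred_sum => r _; apply: mem_lspan.
  by exists (SR_proj D (Y r)), r.
have sP : subsp (fun x : SR_ring K D => exists Y : 'I_d -> {mpoly K[n]},
    x = \sum_r SR_proj D (Y r) * theta r).
  split; first by exists (fun=> 0); rewrite big1 // => r _; rewrite rmorph0 mul0r.
  move=> a u v [Y ->] [Z ->]; exists (fun r => a *: Y r + Z r).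
  rewrite scaler_sumr -big_split; apply: eq_bigr => r _ /=.
  by rewrite rmorphD /= SR_projZ mulrDl scalerAl.
move=> /asboolP[r [a [s [Ss ->]]]]; apply: (subsp_sum _ sP) => i _;
  apply: (subspZ _ sP).
have [y [k ->]] := Ss i; exists (fun r => if r == k then repr y else 0).
rewrite (bigD1 k) //= eqxx SR_reprK big1 ?addr0 // => l lk.
by rewrite (negPf lk) rmorph0 mul0r.
Qed.

Variable c : nat -> 'I_n -> K.
Hypothesis hc : forall r : 'I_d, SR_proj D (linform (c r)) = theta r.

Lemma mcoeff_pihomog i f b :
  (pihomog mdeg i f)@_b = if mdeg b == i then f@_b else 0.
Proof. by rewrite pihomogE (mcoeff_filter (fun b => mdeg b == i)). Qed.

Lemma pihomog_lin i (x : 'I_n -> K) f :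
  pihomog mdeg i.+1 (linform x * f) = linform x * pihomog mdeg i f.
Proof.
apply/mpolyP => b; rewrite mcoeff_pihomog /linform !mulr_suml !raddf_sum /=.
have -> : (if mdeg b == i.+1 then \sum_v (x v *: 'X_v * f)@_b else 0)
   = \sum_v (if mdeg b == i.+1 then (x v *: 'X_v * f)@_b else 0).
  by case: ifP => // _; rewrite big1.
apply: eq_bigr => v _; rewrite -!scalerAl !mcoeffZ !mcoeffXM mcoeff_pihomog.
case: (eqVneq (b v) 0%N) => bv; first by rewrite mulr0 if_same.
rewrite -{1}(addUBm bv) mdegD mdeg1 add1n eqSS; case: ifP => //; by rewrite mulr0.
Qed.

Lemma pihomog_lin0 (x : 'I_n -> K) f : pihomog mdeg 0 (linform x * f) = 0.
Proof.
apply/mpolyP => b; rewrite mcoeff_pihomog mcoeff0; case: eqP => // /eqP.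
rewrite mdeg_eq0 => /eqP ->; rewrite /linform mulr_suml raddf_sum big1 //= => v _.
by rewrite -scalerAl mcoeffZ mcoeffXM mnm0E eqxx mulr0.
Qed.

(** [Jst] admits only homogeneous cofactors; these arise as homogeneous components of an arbitrary
    expression of f in the ideal of Theta. *)
Lemma lspan_Jst i f : Hpiece i f ->
  (SR_proj D f \in lspan (theta_multiples theta) <-> Jst D c finset.set0 d i f).
Proof.
move=> hf; rewrite lspan_theta; split.
  move=> [Y fE]; pose q := f - \sum_(r < d) linform (c r) * Y r.
  have qI : SRI D finset.set0 q.
    apply/SR_proj_eqP; rewrite fE rmorph_sum; apply: eq_bigr => r _ /=.
    by rewrite rmorphM /= hc mulrC.
  have -> : f = pihomog mdeg i q + \sum_(r < d) pihomog mdeg i (linform (c r) * Y r).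
    rewrite -raddf_sum -raddfD /q subrK.
    by apply/esym/pihomog_dE.
  have sJ := subsp_Jst D c finset.set0 d i.
  apply: (subspD sJ).
    apply: (gensub_I (@subsp_homog K n) (lmulP c)); split; first exact: pihomogP.
    by move=> b bD; rewrite mcoeff_pihomog qI // if_same.
  apply: (subsp_sum _ sJ) => r _.
  case: i {hf sJ} => [|i]; first by rewrite pihomog_lin0;
    exact: (subsp0 (subsp_Jst D c finset.set0 d 0)).
  by rewrite pihomog_lin; apply: Jst_lmul => //; apply: pihomogP.
have sP : subsp (fun f => exists Y : 'I_d -> {mpoly K[n]}, SR_proj D f =
  \sum_r SR_proj D (Y r) * theta r).
  split; first by exists (fun=> 0); rewrite [LHS]rmorph0 big1 // => r _;
    rewrite rmorph0 mul0r.
  move=> a u v [Y uE] [Z vE]; exists (fun r => a *: Y r + Z r).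
  rewrite rmorphD /= SR_projZ uE vE scaler_sumr -big_split; apply: eq_bigr => r _ /=.
  by rewrite rmorphD /= SR_projZ mulrDl scalerAl.
suff H r f' : (r <= d)%N -> Jst D c finset.set0 r i f' ->
    exists Y : 'I_d -> {mpoly K[n]}, SR_proj D f' = \sum_r SR_proj D (Y r) * theta r.
  exact: H.
elim: r f' => [|r IH] f' rd /=.
  move=> [_ If]; exists (fun=> 0); rewrite big1 => [|r _];
    last by rewrite rmorph0 mul0r.
  by rewrite -(rmorph0 (SR_proj D)); apply/SR_proj_eqP; rewrite subr0.
move=> [u [w [/(IH _ (ltnW rd)) hu _ ->]]].
apply: (subspD sP) => //; exists (fun l : 'I_d => if l == Ordinal rd then w else 0).
rewrite (bigD1 (Ordinal rd)) //= eqxx big1 ?addr0 => [|l lr]; last first.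
  by rewrite (negPf lr) rmorph0 mul0r.
by rewrite /lmul rmorphM /= (hc (Ordinal rd)) mulrC.
Qed.

Section Action.
Variables (g : {perm 'I_n}) (p : nat) (chi mu nu : K).
Hypothesis pK : p%:R != 0 :> K.
Hypothesis Dg : forall s : {set 'I_n}, ([set g v | v in s] \in D) = (s \in D).
Hypothesis gp : (g ^+ p = 1)%g.
Hypothesis chi_p : chi ^+ p = 1.
Hypothesis mu_p : mu ^+ p = 1.
Hypothesis theta_g : forall r, SR_act g (theta r) = nu *: theta r.

Lemma SR_act_lspan x : x \in lspan (theta_multiples theta) ->
  SR_act g x \in lspan (theta_multiples theta).
Proof.
move=> /lspan_theta[Y ->].
have f0 : SR_act g (0 : SR_ring K D) = 0 by apply: psi_0; apply: SR_actP.
have fD : {morph SR_act g : u v / u + v >-> (u : SR_ring K D) + v}.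
  by move=> u v; apply: psi_D; apply: SR_actP.
rewrite (big_morph (SR_act g) fD f0); apply: rpred_sum => r _.
rewrite SR_actM // theta_g; apply: mem_lspan.
by exists (nu *: SR_act g (SR_proj D (Y r))), r;
  rewrite mulrC -scalerAl mulrC scalerAl.
Qed.

(** At the empty face [psi] acts on polynomials by the inverse of g, hence the inverted
    eigenvalue. *)
Lemma quot_fam i x :
  has_rd (eig (@psi K n g) chi mu (@Xfam K n 0) i)
    (eig (@psi K n g) chi mu (Jfam c D d 0) i) x ->
  has_dim (eigenpart (SR_quot_act theta g) (chi * mu ^+ i)^-1 (SR_quot_piece theta
    i)) x.
Proof.
have wp : (chi * mu ^+ i) ^+ p = 1 := wt_p chi_p mu_p i.
have w0 := wt_neq0 pK chi_p mu_p i.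
set w := chi * mu ^+ i in wp w0 *.
have wVp : w^-1 ^+ p = 1 by rewrite exprVn wp invr1.
have msymV f : msym g^-1%g (msym g f) = f by rewrite -msymMm mulgV msym1m.
have msymV' f : msym g (msym g^-1%g f) = f by rewrite -msymMm mulVg msym1m.
have psi0 F : psi g F finset.set0 = msym g^-1%g (F finset.set0).
  by rewrite psiE osign0 scale1r imset0.
move=> h.
apply: (has_dim_eigen pK (SR_actP Dg) (SR_act_p Dg gp) wVp (subsp_SR_piece K D i)
  (SR_act_piece Dg (i := i)) SR_act_lspan).
pose T (F : fam K n) (y : SR_ring K D) :=
  eig (@psi K n g) chi mu (@Xfam K n 0) i F /\ y = SR_proj D (F finset.set0).
have sX := subsp_eig chi mu (psiP g) (subsp_Xfam K n 0 i).
have eigF F : eig (@psi K n g) chi mu (@Xfam K n 0) i F ->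
    SR_act g (SR_proj D (F finset.set0)) = w^-1 *: SR_proj D (F finset.set0).
  move=> [_ pF]; rewrite SR_act_pi //.
  have := congr1 (fun F : fam K n => F finset.set0) pF; rewrite psi0 famZE => E.
  rewrite -SR_projZ; congr (SR_proj D _).
  by rewrite -[in RHS](msymV' (F finset.set0)) E msymZ scalerA mulVf // scale1r.
apply: (@has_rd_corr K _ _ T _ _ _ _ _ _ _ _ _ _ h).
- by split; [exact: subsp0|rewrite fam0E rmorph0].
- move=> a F y F' y' [F1 ->] [F1' ->]; split; first exact: subspP.
  by rewrite famDE famZE rmorphD /= SR_projZ.
- move=> F hF; exists (SR_proj D (F finset.set0)) => //; split; last exact: eigF.
  by exists (F finset.set0) => //; case: hF => /(_ finset.set0)[].
- move=> y [[f hf <-] fe].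
  have msymP (a : K) (u v : {mpoly K[n]}) : msym g (a *: u + v) =
    a *: msym g u + msym g v.
    by rewrite msymD msymZ.
  have msym_p (u : {mpoly K[n]}) : iter p (msym g) u =
    u by rewrite iter_msym gp msym1m.
  pose f' := eproj p (msym g) w^-1 f.
  have hf' : Hpiece i f'.
    apply: (@eproj_stable K p {mpoly K[n]} _ _ (@Hpiece K n i) _ (subsp_homog K n
      i)) => //.
    by move=> u; apply: msym_homog.
  have ef' : msym g f' = w^-1 *: f' by apply: eproj_eigen.
  have ff' : SRI D finset.set0 (f' - f).
    apply: (eproj_mod pK msymP wVp (subsp_SRI K D finset.set0)).
      by move=> u; apply: SRI_msym.
    by apply/SR_proj_eqP; rewrite -SR_act_pi // fe SR_projZ.
  have TF : eig (@psi K n g) chi mu (@Xfam K n 0) i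
      ([ffun s => if s == finset.set0 then f' else 0] : fam K n).
    split; first exact: Xfam0_emb.
    apply: famP => s; rewrite psiE famZE !ffunE.
    have -> : ([set g v | v in s] == finset.set0) = (s == finset.set0).
      by rewrite -!cards_eq0 card_imset //; apply: perm_inj.
    case: eqP => [->|_]; last by rewrite msym0 !scaler0.
    rewrite osign0 scale1r; apply: (@inj_msym n K g).
    by rewrite msymV' msymZ ef' scalerA mulfV // scale1r.
  exists ([ffun s => if s == finset.set0 then f' else 0] : fam K n) => //; split=> //.
  by rewrite ffunE eqxx; apply/esym/SR_proj_eqP.
- move=> F y [hF ->]; have [XF pF] := hF.
  have hF0 : Hpiece i (F finset.set0) by case: (XF finset.set0).
  have J0 : Jfam c D d 0 i F <-> Jst D c finset.set0 d i (F finset.set0).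
    rewrite JfamP; split=> [[_ ]|hJ]; first exact.
    split=> // s; case: (eqVneq s finset.set0) => [->//|s0].
    have [_ ->] := XF s; last by rewrite cards_eq0.
    exact: (subsp0 (subsp_Jst D c s d i)).
  split.
    move=> [/J0 hJ _]; split; [|exact: eigF|by apply/(lspan_Jst hF0)].
    by exists (F finset.set0).
  by move=> [_ _ hl]; split=> //; apply/J0/(lspan_Jst hF0).
Qed.

End Action.
End ThetaIdeal.

(** * From finite-dimensional quotients to the absence of common zeros *)

Section LinearSystem.
Variables (K : fieldType) (n d : nat) (D : scomplex n) (theta : 'I_d -> SR_ring K D).
Variables (g : {perm 'I_n}) (nu : K).
Hypothesis Dg : forall s : {set 'I_n}, ([set g v | v in s] \in D) = (s \in D).
Hypothesis nu0 : nu != 0.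
Hypothesis theta_g : forall r, SR_act g (theta r) = nu *: theta r.

Lemma msupU (v : 'I_n) : msup U_(v)%MM = [set v].
Proof.
by apply/setP => w; rewrite !inE mnm1E eqb0 negbK eq_sym.
Qed.

Lemma linform_coef (x : 'I_n -> K) v : (linform x)@_U_(v)%MM = x v.
Proof.
rewrite raddf_sum (bigD1 v) //= mcoeffZ mcoeffX eqxx mulr1 big1 ?addr0 // => w wv.
rewrite mcoeffZ mcoeffX; case: eqP => [/(congr1 (@msup n))|]; last by rewrite mulr0.
by rewrite !msupU => /set1_inj h; rewrite h eqxx in wv.
Qed.

Lemma lsop_forms : lsop theta -> exists c : nat -> 'I_n -> K,
  [/\ forall r : 'I_d, SR_proj D (linform (c r)) = theta r,
      forall r v, c r (g v) = nu^-1 * c r v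
    & no_common_zero D d c].
Proof.
move=> [th1 [N hN]].
have [f f1 fE] := choice_ex2 th1.
(* If v is not a vertex of D, then x_v is zero in the face ring and [theta] does not determine its
   coefficient. Setting it to 0 makes [c r] equivariant on the nose. *)
pose c (r : nat) v : K := if insub r is Some i then
  (if [set v] \in D then (f (i : 'I_d))@_U_(v)%MM else 0) else 0.
have cE (r : 'I_d) v : c r v = if [set v] \in D then (f r)@_U_(v)%MM else 0.
  by rewrite /c; case: insubP => [i _ /val_inj ->|] //; rewrite ltn_ord.
have hc (r : 'I_d) : SR_proj D (linform (c r)) = theta r.
  rewrite -fE; apply/SR_proj_eqP => b; rewrite finset.setU0 => bD.
  rewrite mcoeffB; case: (eqVneq (mdeg b) 1%N) => b1; last first.
    by rewrite (dhomog_nemf_coeff (linform_homog _) b1) (dhomog_nemf_coeff (f1 r)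
      b1) subrr.
  move/eqP: b1 => /mdeg1P[v /eqP bv]; rewrite bv msupU in bD *.
  by rewrite linform_coef cE bD subrr.
exists c; split=> //.
  move=> r v; case: (ltnP r d) => rd; last first.
    by rewrite /c; case: insubP => [i id _|_]; rewrite ?mulr0 //;
      rewrite ltnNge rd in id.
  rewrite -[r]/(nat_of_ord (Ordinal rd)) !cE.
  have -> : ([set g v] \in D) = ([set v] \in D) by rewrite -(Dg [set v]) imset_set1.
  case: ifP => vD; last by rewrite mulr0.
  set r' := Ordinal rd.
  have := theta_g r'; rewrite -fE SR_act_pi // -SR_projZ =>
    /SR_proj_eqP/(_ U_(g v)%MM).
  rewrite finset.setU0 msupU -imset_set1 Dg => /(_ vD) /eqP.
  rewrite mcoeffB mcoeffZ mcoeff_sym subr_eq0 => /eqP h.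
  apply: (mulfI nu0); rewrite mulrA mulfV // mul1r -h; congr (_@_ _).
  by apply/mnmP => w; rewrite mnmE !mnm1E (inj_eq perm_inj).
move=> x xD hx v0; apply/eqP/negPn/negP => xv0.
(* If x is a common zero with x v0 nonzero, restriction to the line through x ([ev] below) kills the
   ideal and the forms but sends the powers of x_v0 to nonzero multiples of distinct powers of X.
   These powers are then independent in a quotient of dimension N, although there are N + 1 of
   them. *)
pose y (k : nat) : {mpoly K[n]} := 'X_v0 ^+ k.
pose ly (k : 'I_N.+1) : SR_quot theta := lproj (theta_multiples theta) (SR_proj D
  (y k)).
have /has_dim_rd hN' := hN.
have s0 : subsp (fun v : SR_quot theta => v = 0).
  by split=> // a u v -> ->; rewrite scaler0 addr0.
have [a ha [k ak]] : exists2 a : 'I_N.+1 -> K, \sum_k a k *: ly k =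
  0 & exists k, a k != 0.
  apply: contrapT => nh; have := @steinitz _ _ _ _ N N.+1 ly s0 hN' (fun _ => I).
  rewrite ltnn => /(_ _)/notF; apply => a ha k; apply/eqP/negPn/negP => ak.
  by apply: nh; exists a => //; exists k.
have : SR_proj D (\sum_k a k *: y k) \in lspan (theta_multiples theta).
  rewrite -lproj_eq0 -ha lproj_sum rmorph_sum; apply/eqP; congr (lproj _ _).
  by apply: eq_bigr => i _; rewrite /= SR_projZ.
move=> /lspan_theta[Y hY].
pose ev : {mpoly K[n]} -> {poly K} := mmap (@polyC K) (fun v => (x v)%:P * 'X).
have evX v : ev 'X_v = (x v)%:P * 'X by rewrite /ev mmapX mmap1U.
have evZ (u : K) h : ev (u *: h) = u%:P * ev h by rewrite /ev mmapZ.
have evM h h' : ev (h * h') = ev h * ev h' by rewrite /ev rmorphM.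
have evD h h' : ev (h + h') = ev h + ev h' by rewrite /ev mmapD.
have ev0 : ev 0 = 0 by rewrite /ev mmap0.
have evlin (r : 'I_d) : ev (linform (c r)) = 0.
  rewrite /linform (big_morph ev evD ev0); under eq_bigr do rewrite evZ evX mulrA
    -polyCM.
  by rewrite -mulr_suml -(big_morph polyC (@polyCD K) (@polyC0 K)) hx // polyC0 mul0r.
have evI h : h \in SR_ideal (K := K) D -> ev h = 0.
  move=> /asboolP[r [u [q [Sq ->]]]]; rewrite (big_morph ev evD ev0) big1 // => i _.
  rewrite evZ; have [f' [s [sD ->]]] := Sq i.
  have [v vs vx] : exists2 v, v \in s & v \notin [set v | x v != 0].
    by apply/subsetPn; apply: contra sD => sb; exact: (scomplex_sub xD sb).
  rewrite evM (bigD1 v) //= evM evX.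
  by move: vx; rewrite inE negbK => /eqP ->; rewrite polyC0 !mul0r !mulr0.
have E : ev (\sum_k a k *: y k) = 0.
  have qI : \sum_k a k *: y k - \sum_(r < d) Y r * linform (c r) \in SR_ideal (K :=
    K) D.
    apply/SR_idealP/SR_proj_eqP; rewrite hY rmorph_sum; apply: eq_bigr => r _ /=.
    by rewrite rmorphM /= hc.
  rewrite -(subrK (\sum_(r < d) Y r * linform (c r)) (\sum_k _)) evD (evI _ qI) add0r.
  by rewrite (big_morph ev evD ev0) big1 // => r _; rewrite evM evlin mulr0.
have evy (i : nat) : ev (y i) = (x v0 ^+ i)%:P * 'X^i.
  by rewrite /y /ev rmorphXn /= -/(ev _) evX exprMn polyC_exp.
have := congr1 (fun q : {poly K} => q`_k) E.
rewrite (big_morph ev evD ev0) coef_sum coef0 (bigD1 k) //= evZ evy big1.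
  rewrite !coefCM coefXn eqxx mulr1 addr0 => /eqP.
  by rewrite mulf_eq0 (negPf ak) expf_eq0 (negPf xv0) andbF.
move=> i ik; rewrite evZ evy !coefCM coefXn.
by case: eqP => [/val_inj h|]; [rewrite h eqxx in ik|rewrite !mulr0].
Qed.

End LinearSystem.

(** * The Hilbert series *)

Lemma tvar_p p : (0 < p)%N -> tvar p ^+ p = 1.
Proof.
move=> p0; pose q : {poly rat} := 'X^p - 1.
have qm : q \is monic by rewrite monicXnsubC.
have qs : (1 < size q)%N by rewrite size_XnsubC.
have mq : mk_monic q = q by rewrite /mk_monic qm qs.
have q0 : in_qpoly q q = 0.
  by apply: val_inj; rewrite /= mq Pdiv.RingMonic.rmodpp.
have E k : tvar p ^+ k = in_qpoly q ('X ^+ k).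
  by elim: k => [|k IH]; [rewrite expr0 in_qpoly1|rewrite exprS IH exprS in_qpolyM].
rewrite E; have -> : 'X ^+ p = q + 1 :> {poly rat} by rewrite subrK.
by rewrite in_qpolyD q0 add0r in_qpoly1.
Qed.

Lemma tvar_mod p k : (0 < p)%N -> tvar p ^+ k = tvar p ^+ (k %% p).
Proof.
by move=> p0; rewrite {1}(divn_eq k p) exprD mulnC exprM tvar_p // expr1n mul1r.
Qed.

Section PolyToFam.
Variables (K : fieldType) (n : nat) (G : {set {set 'I_n}}) (g : {perm 'I_n}) (chi
  mu : K).

(* Families of degree 0 are polynomials placed at the empty face. *)
Lemma fam0_rd a N :
  has_rd (fun f : {mpoly K[n]} => Hpiece a f /\ msym g^-1%g f = (chi * mu ^+ a) *: f)
    (fun f => SRIh G finset.set0 a f /\ msym g^-1%g f = (chi * mu ^+ a) *: f) N ->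
  has_rd (eig (@psi K n g) chi mu (@Xfam K n 0) a) (eig (@psi K n g) chi mu (Ifam G
    0) a) N.
Proof.
move=> h.
have F0 F s : Xfam 0 a F -> s != finset.set0 -> F s = 0.
  by move=> XF s0; have [_ ->] := XF s; rewrite ?cards_eq0.
have sX := subsp_eig chi mu (psiP g) (subsp_Xfam K n 0 a).
apply: (@has_rd_corr K _ _ (fun f (F : fam K n) =>
  eig (@psi K n g) chi mu (@Xfam K n 0) a F /\
   f = F finset.set0) _ _ _ _ _ _ _ _ _ _ h).
- by split; [exact: subsp0|rewrite fam0E].
- move=> x f f' F F' [h1 ->] [h2 ->]; split; first exact: subspP.
  by rewrite famDE famZE.
- move=> f [f1 f2]; pose F : fam K n := [ffun s => if s == finset.set0 then f else 0].
  have EF : eig (@psi K n g) chi mu (@Xfam K n 0) a F.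
    split; first exact: Xfam0_emb.
    apply: famP => s; rewrite psiE famZE !ffunE.
    have -> : ([set g v | v in s] == finset.set0) = (s == finset.set0).
      by rewrite -!cards_eq0 card_imset //; apply: perm_inj.
    case: eqP => [->|_]; last by rewrite msym0 !scaler0.
    by rewrite osign0 scale1r f2.
  by exists F => //; split=> //; rewrite ffunE eqxx.
- move=> F [XF pF]; exists (F finset.set0) => //; split;
  first by case: (XF finset.set0).
  have := congr1 (fun F : fam K n => F finset.set0) pF.
  by rewrite psiE osign0 scale1r imset0 famZE.
- move=> f F [[XF pF] ->]; split=> [[[h1 h2] _]|[[_ IF] _]].
    split=> //; split=> // s; case: (eqVneq s finset.set0) => [-> //|s0].
    by rewrite F0 //; apply: SRI_0.
  split; first by split=> //; case: (XF finset.set0).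
  have := congr1 (fun F : fam K n => F finset.set0) pF.
  by rewrite psiE osign0 scale1r imset0 famZE.
Qed.

End PolyToFam.

Section WeightedHilbert.
Variables (K : fieldType) (n d p : nat) (D : scomplex n) (theta : 'I_d -> SR_ring K
  D).
Variables (g : {perm 'I_n}) (zeta : K) (m : nat).
Hypothesis pK : forall k, (0 < k)%N -> k%:R != 0 :> K.
Hypothesis zeta_prim : p.-primitive_root zeta.
Hypothesis D_dim : complex_dim D = d%:Z - 1.
Hypothesis D_Buchsbaum : Buchsbaum K D.
Hypothesis Dg : forall s : {set 'I_n}, ([set g v | v in s] \in D) = (s \in D).
Hypothesis gp : (g ^+ p = 1)%g.
Hypothesis gfree : forall k (s : {set 'I_n}), (0 < k < p)%N -> s \in D ->
  s != finset.set0 -> [set (g ^+ k)%g v | v in s] != s.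
Hypothesis theta_lsop : lsop theta.
Hypothesis theta_g : forall r, SR_act g (theta r) = zeta ^+ m *: theta r.

Lemma weighted_hilb i k : (k < p)%N -> exists2 x : nat,
  has_dim (eigenpart (SR_quot_act theta g) (zeta ^ (k : int)) (SR_quot_piece theta
    i)) x &
  (x%:R : rat) = p%:R^-1 * (h_number D d i + (-1) ^+ i.+1 * 'C(d, i)%:Z)%:~R
     + (-1) ^+ i * 'C(d, i)%:R * (k == m * i %% p)%N%:R
     + 'C(d, i)%:R * \sum_(j < i) (-1) ^+ (i - j - 1) *
        (betti_eigen D g zeta (j%:Z - 1) ((m * i)%:Z - k%:Z))%:R.
Proof.
move=> kp.
have p0 : (0 < p)%N by apply: leq_ltn_trans kp.
have zp : zeta ^+ p = 1 by apply: prim_expr_order.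
have z0 : zeta != 0.
  by apply: contra_eq_neq zp => ->; rewrite expr0n eq_sym (gtn_eqF p0) oner_eq0.
have zm0 : zeta ^+ m != 0 by rewrite expf_neq0.
have [c [hc cg nz]] := lsop_forms Dg zm0 theta_g theta_lsop.
have cD := scomplex_closed D.
(* [psi] inverts g, so the forms have weight [mu]. The value of [chi] makes the weight in degree i
   equal to zeta^(-k), that is zeta^k for g, and is itself the weight met in degree 0. *)
pose mu := (zeta ^+ m)^-1; pose chi := zeta ^ ((m * i)%:Z - k%:Z).
have mu_p : mu ^+ p = 1 by rewrite exprVn -exprM mulnC exprM zp expr1n invr1.
have chi_p : chi ^+ p = 1.
  by rewrite exprnP exprz_exp mulrC -exprz_exp -exprnP zp exp1rz.
have chimu : (chi * mu ^+ i)^-1 = zeta ^ (k : int).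
  rewrite /chi /mu exprVn -exprM expfzDr // -invr_expz -[zeta ^ ((m * i)%N :
    int)]/(zeta ^+ (m * i)).
  by rewrite mulrAC mulfV ?expf_neq0 // mul1r invrK.
have pKp : (p%:R : K) != 0 by apply: pK.
have Gg (s : {set 'I_n}) : s \in (D : {set {set 'I_n}}) -> [set g v | v in s] \in
  (D : {set {set 'I_n}}).
  by rewrite Dg.
have reg (s : {set 'I_n}) : s \in (D : {set {set 'I_n}}) -> s != finset.set0 ->
  star_regular D c d s.
  move=> sD s0; apply: star_regular_Buchsbaum => // t j tD t0 jt.
  exact: (Buchsbaum_acyclic cD D_dim).
(* The constants lie in the eigenspace of 1 only, whereas in positive degree every eigenspace has
   the same share of the monomials. *)
pose Dw a : nat := if a is 0%N then (chi == 1 : nat) else (facecount D a %/ p)%N.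
have hD a : has_rd (eig (@psi K n g) chi mu (@Xfam K n 0) a)
    (eig (@psi K n g) chi mu (Ifam D 0) a) (Dw a).
  apply: fam0_rd; case: a => [|a] /=.
    by rewrite expr0 mulr1; apply: weight_count0; apply: scomplex_face0.
  have [N hN NE] := weight_count pKp Gg gp gfree (ltn0Sn a) (wt_p chi_p mu_p a.+1).
  by rewrite -NE mulnK.
have DwE a : (0 < a)%N -> (Dw a * p = facecount D a)%N.
  case: a => // a _; have [N hN NE] := weight_count pKp Gg gp gfree (ltn0Sn a)
    (wt_p chi_p mu_p a.+1).
  by rewrite /= divnK // -NE dvdn_mull.
pose b j := betti_eigen D g zeta (j%:Z - 1) ((m * i)%:Z - k%:Z).
have hb j : has_rd
    (eig (@psi K n g) chi mu (cyc (@Xfam K n) (Ifam D) (fmul c) (@fdl K n) 0 j) 0)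
    (eig (@psi K n g) chi mu (bnd (@Xfam K n) (Ifam D) (fmul c) (@fdl K n) 0 j) 0)
      (b j).
  have sC : subsp (cyc (@Xfam K n) (Ifam D) (fmul c) (@fdl K n) 0 j 0).
    apply: subsp_cyc; [exact: subsp_Xfam|exact: subsp_Ifam|exact: fmulP|exact: fdlP].
  have sB : subsp (bnd (@Xfam K n) (Ifam D) (fmul c) (@fdl K n) 0 j 0).
    apply: subsp_bnd; [exact: subsp_Xfam|exact: subsp_Ifam|exact: fmulP|exact: fdlP].
  have [r hr] : exists r, has_rd
    (eig (@psi K n g) chi mu (cyc (@Xfam K n) (Ifam D) (fmul c) (@fdl K n) 0 j) 0)
    (eig (@psi K n g) chi mu (bnd (@Xfam K n) (Ifam D) (fmul c) (@fdl K n) 0 j) 0) r.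
    apply: (@fam_fin K n j 0); [exact: (subsp_eig chi mu (psiP g) sC)|exact:
      (subsp_eig chi mu (psiP g) sB)| |].
      move=> F [bF pF]; split=> //; move: bF.
      apply: bnd_cyc; [exact: subsp_Xfam|exact: Ifam_X|exact: fmulP
        |by move=> *; apply: fmul_X|exact: fdlP|exact: fdl_X
        |by move=> *; apply: fdl_I => //; exact: cD.2|exact: fdlK|exact: fdl_fmul].
    by move=> F [[XF _] _].
  have := has_dim_dim (cohomology_fam pKp cD Dg gp chi_p hr).
  by rewrite -[Defs.dim _]/(b j) => ->.
have [x hx xE] := equivariant_hilb pKp cD reg Gg gp chi_p mu_p cg hD hb i.
exists x.
  by have := quot_fam hc pKp Dg gp chi_p mu_p theta_g hx; rewrite chimu.
have chi1 : (chi == 1) = (k == m * i %% p)%N.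
  have -> : (chi == 1) = (zeta ^+ (m * i) == zeta ^+ k).
    rewrite /chi expfzDr // -invr_expz -[zeta ^ ((m * i)%N : int)]/(zeta ^+ (m *
      i)) -[zeta ^ (k : int)]/(zeta ^+ k).
    by rewrite -(inj_eq (mulIf (expf_neq0 k z0))) divfK ?expf_neq0 // mul1r.
  by rewrite (eq_prim_root_expr zeta_prim) eq_sym modn_small.
have p0q : (p%:R : rat) != 0 by rewrite pnatr_eq0 -lt0n.
(* Degree 0 is written as the uniform share plus a correction; the alternating sum turns the
   correction into the two terms in C(d, i), one with t^(mi) and one with the factor 1 / p. *)
have DwQ a : (Dw a)%:R = p%:R^-1 * (facecount D a)%:R + ((chi == 1)%:R - p%:R^-1) *
  (a == 0%N)%:R :> rat.
  case: a => [|a]; last by rewrite mulr0 addr0 -(DwE a.+1) // natrM mulrCA mulVf //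
    mulr1.
  rewrite (_ : facecount D 0 = 1%N); first by rewrite !mulr1 addrC subrK.
  rewrite facecount_sum (bigD1 finset.set0) /=; last exact: scomplex_face0.
  rewrite cards0 big1 // => s /andP[_ s0].
  by move: s0; rewrite -card_gt0; case: #|s|.
have -> : (x%:R : rat) = (x%:Z)%:~R by [].
rewrite xE rmorphD /=; congr (_ + _); last first.
  rewrite rmorphM /=; congr (_ * _); rewrite rmorph_sum; apply: eq_bigr => j _ /=.
  by rewrite rmorphM /= rmorphXn rmorphN1.
rewrite rmorph_sum /=.
have -> : \sum_(l < i.+1) ((-1) ^+ l * ('C(d, l) * Dw (i - l)%N)%:Z)%:~R =
  p%:R^-1 * (\sum_(l < i.+1) (-1) ^+ l * ('C(d, l) * facecount D (i - l)%N)%:Z)%:~R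
   + (-1) ^+ i * 'C(d, i)%:R * ((chi == 1)%:R - p%:R^-1) :> rat.
  rewrite rmorph_sum mulr_sumr.
  have -> : (-1) ^+ i * 'C(d, i)%:R * ((chi == 1)%:R - p%:R^-1) =
     \sum_(l < i.+1) (-1) ^+ l * 'C(d, l)%:R * ((chi == 1)%:R - p%:R^-1) * (i - l
       == 0)%N%:R :> rat.
    rewrite big_ord_recr /= subnn eqxx mulr1 big1 ?add0r // => l _.
    by rewrite subn_eq0 leqNgt ltn_ord mulr0.
  rewrite -big_split; apply: eq_bigr => l _ /=.
  rewrite !rmorphM /= rmorphXn rmorphN1 -!pmulrn DwQ.
  ring.
rewrite h_number_facecount; last by move=> s; apply: face_le.
rewrite chi1 rmorphD rmorphM /= rmorphXn rmorphN1 /= exprS.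
rewrite -[(_%:Z)%:~R]/('C(d, i)%:R).
ring.
Qed.

End WeightedHilbert.

Lemma coef_sum_Xn (R : nzRingType) (N i : nat) (A : nat -> R) :
  ((N <= i)%N -> A i = 0) -> (\sum_(0 <= k < N) A k *: 'X^k)`_i = A i.
Proof.
move=> Ai; rewrite coef_sum big_mkord; under eq_bigr do rewrite coefZ coefXn.
case: (ltnP i N) => iN; last first.
  rewrite Ai // big1 // => k _; case: eqP => [ik|]; last by rewrite mulr0.
  by have := ltn_ord k; rewrite -ik ltnNge iN.
rewrite (bigD1 (Ordinal iN)) //= eqxx mulr1 big1 ?addr0 // => k ki.
by case: eqP => [ik|]; [case/eqP: ki; apply: val_inj|rewrite mulr0].
Qed.

Lemma sign_scale (F : fieldType) (A : algType F) (e : nat) (q : F) (v : A) :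
  ((-1) ^+ e * q) *: v = (-1) ^+ e * (q *: v).
Proof.
rewrite -scalerA -[in LHS]signr_odd -[in RHS]signr_odd.
by case: (odd e); rewrite ?expr1 ?expr0 ?scaleN1r ?scale1r ?mul1r // mulN1r.
Qed.

Lemma nat_scale (F : fieldType) (A : algType F) (c : nat) (q : F) (v : A) :
  (c%:R * q) *: v = c%:R * (q *: v).
Proof. by rewrite -scalerA scaler_nat mulr_natl. Qed.

Theorem theorem4p2
  (p : nat) (p_prime : prime p)
  (R : realType) (K : fieldType) (iota : {rmorphism R[i] -> K})
  (zeta : K) (zeta_prim : p.-primitive_root zeta)
  (n d : nat) (D : scomplex n)
  (D_dim : complex_dim D = d%:Z - 1)
  (D_Buchsbaum : Buchsbaum K D)
  (to : {action 'Z_p &-> 'I_n})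
  (to_simplicial : simplicial_action to D)
  (to_free : free_action to D)
  (g : 'Z_p) (g_gen : <[g]>%g = [set: 'Z_p])
  (m : nat) (m_lt_p : (m < p)%N)
  (theta : 'I_d -> SR_ring K D)
  (theta_lsop : lsop theta)
  (theta_homog : forall k : 'I_d,
     eigenpart (SR_act (to^~ g)) (zeta ^ (m : int)) (SR_piece 1) (theta k)) :
  let t : tring p := tvar p in
  let h := h_number D d in
  let beta := betti_eigen D (to^~ g) zeta in
  let rhs : {poly tring p} :=
    \sum_(0 <= i < d.+1)
      ((-1) ^+ i * 'C(d, i)%:R * t ^+ (m * i)
       + (p%:R^-1 : rat) *: (\sum_(0 <= k < p) t ^+ k)
         * (h i + (-1) ^+ i.+1 * 'C(d, i)%:Z)%:~R) *: 'X^i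
    + \sum_(0 <= i < d.+1)
        ('C(d, i)%:R *: 'X^i
         * \sum_(0 <= j < i)
             ((-1) ^+ (i - j - 1)
              * \sum_(0 <= k < p)
                  t ^+ k * (beta (j%:Z - 1) ((m * i)%:Z - k%:Z))%:R)%:P) in
  forall i : nat,
    Hilb_coef p zeta (SR_quot_act theta (to^~ g)) (SR_quot_piece theta) i = rhs`_i.
Proof.
move=> t h beta rhs i.
pose ga : {perm 'I_n} := actperm to g.
have gaE k v : (ga ^+ k)%g v = to v (g ^+ k)%g.
  elim: k v => [|k IH] v; first by rewrite !expg0 perm1 act1.
  by rewrite !expgSr permM IH actpermE actM.
have toE : (to^~ g) = ga :> ('I_n -> 'I_n) by apply/funext => v; rewrite actpermE.
have ord_g : #[g]%g = p.
  by rewrite /order g_gen cardsT card_ord Zp_cast // prime_gt1.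
have gp : (ga ^+ p = 1)%g.
  have g1 : (g ^+ p = 1)%g by have := expg_order g; rewrite ord_g.
  by apply/permP => v; rewrite gaE g1 act1 perm1.
have setE k (s : {set 'I_n}) : [set (ga ^+ k)%g v | v in s] = (to^*)%act s (g ^+ k)%g.
  by rewrite /= setactE; apply: eq_imset => v; rewrite gaE.
have Dg (s : {set 'I_n}) : ([set ga v | v in s] \in D) = (s \in D).
  have := setE 1%N s; rewrite !expg1 => ->.
  exact: (acts_act to_simplicial (finset.in_setT g)).
have gfree k (s : {set 'I_n}) : (0 < k < p)%N -> s \in D -> s != finset.set0 ->
    [set (ga ^+ k)%g v | v in s] != s.
  move=> /andP[k0 kp] sD s0; rewrite setE; apply: to_free => //.
  by rewrite -order_dvdn ord_g gtnNdvd.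
have charK k : (0 < k)%N -> (k%:R : K) != 0.
  move=> k0; rewrite -(rmorph_nat iota) fmorph_eq0 pnatr_eq0.
  by rewrite -lt0n.
have theta_ga r : SR_act ga (theta r) = zeta ^+ m *: theta r.
  by have [_] := theta_homog r; rewrite toE -exprnP.
have p0 := prime_gt0 p_prime.
have hx (k : 'I_p) := weighted_hilb charK zeta_prim D_dim D_Buchsbaum Dg gp gfree
  theta_lsop theta_ga i (ltn_ord k).
have [x x1 x2] := choice_ex2 hx.
have tE k : t ^+ k = t ^+ (k %% p) by apply: tvar_mod.
pose b j k := beta (j%:Z - 1) ((m * i)%:Z - k%:Z).
pose S : tring p := \sum_(k < p) t ^+ k.
have LE : Hilb_coef p zeta (SR_quot_act theta (to^~ g)) (SR_quot_piece theta) i =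
    \sum_(k < p) ((x k)%:R : rat) *: t ^+ k.
  apply: eq_bigr => k _; rewrite toE (has_dim_dim (x1 k)).
  by rewrite scaler_nat mulr_natl.
rewrite LE.
under eq_bigr do rewrite x2 !scalerDl.
rewrite !big_split /= -scaler_sumr -/S.
have -> : \sum_(k < p) ((-1) ^+ i * 'C(d, i)%:R * ((k : nat) == (m * i) %% p)%N%:R
  : rat) *: t ^+ k
    = (-1) ^+ i * 'C(d, i)%:R * t ^+ (m * i).
  (* Exactly one k < p is congruent to mi, and t^p = 1 lets it stand for mi in the exponent. *)
  have mp : ((m * i) %% p < p)%N by rewrite ltn_mod.
  rewrite (bigD1 (Ordinal mp)) //= eqxx mulr1 big1 ?addr0 => [|k kp]; last first.
    rewrite (_ : (k == _ :> nat) = false) ?mulr0 ?scale0r //.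
    by apply/eqP => kE; case/eqP: kp; apply: val_inj.
  by rewrite -tE -mulrA sign_scale scaler_nat mulr_natl.
have -> : \sum_(k < p) ('C(d, i)%:R *
     \sum_(j < i) (-1) ^+ (i - j - 1) * (betti_eigen D ga zeta (j%:Z - 1) ((m *
       i)%:Z - k%:Z))%:R : rat) *: t ^+ k
   = 'C(d, i)%:R * \sum_(0 <= j < i) (-1) ^+ (i - j - 1) * \sum_(0 <= k < p) t ^+ k
     * (b j k)%:R.
  under eq_bigr do rewrite nat_scale scaler_suml.
  rewrite -mulr_sumr exchange_big big_mkord; congr (_ * _); apply: eq_bigr => j _ /=.
  rewrite big_mkord mulr_sumr; apply: eq_bigr => k _.
  by rewrite sign_scale scaler_nat mulr_natr /b /beta toE.
(* The sums in [rhs] stop at d while i is arbitrary; beyond d the h-number and the binomials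
   vanish. *)
rewrite /rhs coefD coef_sum_Xn => [|id]; last first.
  rewrite bin_small // /h h_number_out //; last by move=> s; apply: face_le.
  by rewrite mulr0n !mulr0 mul0r addr0.
rewrite [X in _ = _ + X](_ : _ = 'C(d, i)%:R * \sum_(0 <= j < i) (-1) ^+ (i - j - 1) *
    \sum_(0 <= k < p) t ^+ k * (b j k)%:R); last first.
  pose B i' : tring p := 'C(d, i')%:R * \sum_(0 <= j < i') (-1) ^+ (i' - j - 1) *
    \sum_(0 <= k < p) t ^+ k * (beta (j%:Z - 1) ((m * i')%:Z - k%:Z))%:R.
  rewrite (eq_bigr (fun i' => B i' *: 'X^i')); last first.
    move=> i' _; rewrite -(big_morph polyC (@polyCD _) (@polyC0 _)).
    by rewrite mulrC mul_polyC scalerA mulrC.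
  by rewrite coef_sum_Xn // => id; rewrite /B bin_small // mul0r.
congr (_ + _); rewrite addrC; congr (_ + _).
by rewrite big_mkord -/S -scalerA scaler_int -scalerAl mulrzr.
Qed.
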